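(* Let $d\ge1$ be an integer. Let $\{\varepsilon_j\}_{j\in\mathbb{Z}}$ be i.i.d. centered Gaussian random vectors in $\mathbb{R}^{d}$ with identity covariance matrix, and let $\Psi_l=(\psi_{ij,l})_{i,j=1,\dots,d}\in\mathbb{R}^{d\times d}$, $l\ge 0$, be matrices such that $\Psi_0$ is nonsingular and $\psi_{ij,l}=o\big(l^{-1/2}(\log l)^{-1}\big)$ as $l\to\infty$ for all $i,j$. Let $X_k=(X_{k,1},\dots,X_{k,d})'=\sum_{l=0}^\infty \Psi_l\varepsilon_{k-l}$, $k\in\mathbb{Z}$. Let $h:\mathbb{R}\to\mathbb{R}$ be measurable and $W_{k,i}=h(X_{k,i})$; assume $W_{k,i}\in[0,\infty)$ almost surely and $$\mathbb{P}(W_{k,i}>u)=u^{-\alpha}L(u),\qquad u>0,\ k\in\mathbb{Z},\ i=1,\dots,d,$$ where $\alpha\in(0,\infty)$ and $L$ is slowly varying at infinity (with $\alpha, L$ not depending on $k,i$). Let $a_{ij,r}\ge0$, $i,j=1,\dots,d$, $r\in\mathbb{Z}$, be such that for each $i$ we have $a_{ij,r}>0$ for some $j,r$, and such that for some $\epsilon\in(0,\alpha)$, $\sum_{r\in\mathbb{Z}}a_{ij,r}^{\alpha-\epsilon}<\infty$ for all $i,j$. Define $$Y^{\mathrm{M4}}_{k,i}=\bigvee_{r\in\mathbb{Z}}\bigvee_{j=1}^d a_{ij,r}W_{k-r,j},\qquad A_i=\sum_{r\in\mathbb{Z}}\sum_{j=1}^d a_{ij,r}^\alpha\in(0,\infty),\qquad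 M_{n,i}=\max_{1\le k\le n}Y^{\mathrm{M4}}_{k,i},$$ and $M_n=(M_{n,1},\dots,M_{n,d})'$. For each $\tau=(\tau_1,\dots,\tau_d)'\in(0,\infty)^d$ let $u_n(\tau)=(u_{n,1}(\tau_1),\dots,u_{n,d}(\tau_d))'$ be thresholds with $\lim_{n\to\infty}n\,\mathbb{P}(Y^{\mathrm{M4}}_{0,i}>u_{n,i}(\tau_i))=\tau_i$, $i=1,\dots,d$. Then $$\lim_{n\to\infty}\mathbb{P}(M_n\le u_n(\tau))=H(\tau)^{\theta(\tau)}=\exp\Big\{-\sum_{j=1}^d\bigvee_{r\in\mathbb{Z}}\bigvee_{i=1}^d\frac{a_{ij,r}^\alpha\tau_i}{A_i}\Big\},$$ where $$H(\tau)=\exp\Big\{-\sum_{j=1}^d\sum_{r\in\mathbb{Z}}\bigvee_{i=1}^d\frac{a_{ij,r}^\alpha\tau_i}{A_i}\Big\}$$ and the multivariate extremal index is $$\theta(\tau)=\frac{\sum_{j=1}^d\bigvee_{r\in\mathbb{Z}}\bigvee_{i=1}^d a_{ij,r}^\alpha\tau_i/A_i}{\sum_{j=1}^d\sum_{r\in\mathbb{Z}}\bigvee_{i=1}^d a_{ij,r}^\alpha\tau_i/A_i}.$$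
   Context: $\bigvee$ denotes maximum/supremum. Inequalities $\le$ between vectors are componentwise. Multivariate extremal index: for a stationary $\mathbb{R}^d$-valued sequence $\{Y_k\}$ with componentwise maxima $M_n$ over $k=1,\dots,n$ and thresholds $u_n(\tau)$ with $n\mathbb{P}(Y_{0,i}>u_{n,i}(\tau_i))\to\tau_i$ for $i=1,\dots,d$, let $\widehat M_n$ be the vector of componentwise maxima of $n$ i.i.d. copies of $Y_0$. The multivariate extremal index $\theta(\tau)\in[0,1]$ is defined by the limit relations $\mathbb{P}(\widehat M_n\le u_n(\tau))\to H(\tau)\in(0,1)$ and $\mathbb{P}(M_n\le u_n(\tau))\to H(\tau)^{\theta(\tau)}$. *)

(* Defs.v *)
From HB Require Import structures.
From mathcomp Require Export all_boot all_order all_algebra finmap.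
From mathcomp Require Export all_classical all_reals all_analysis measurable_realfun.
Export Order.TTheory GRing.Theory Num.Theory.
Export numFieldNormedType.Exports.

Set Implicit Arguments.
Unset Strict Implicit.
Unset Printing Implicit Defensive.

Local Open Scope classical_set_scope.
Local Open Scope ring_scope.

(* Random vectors are random variables with values in d.-tuple R (resp.
   d.-tuple (\bar R)), which carries the product sigma-algebra. *)

Definition same_law (R : realType) (d1 d2 dT : measure_display)
    (O1 : measurableType d1) (O2 : measurableType d2) (T : measurableType dT)
    (P1 : probability O1 R) (X1 : O1 -> T)
    (P2 : probability O2 R) (X2 : O2 -> T) : Prop :=
  forall B : set T, measurable B -> P1 (X1 @^-1` B) = P2 (X2 @^-1` B).

Definition mutually_independent (R : realType) (dO dT : measure_display)
    (O : measurableType dO) (T : measurableType dT) (I : choiceType)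
    (P : probability O R) (X : I -> O -> T) : Prop :=
  forall (J : {fset I}) (B : I -> set T), (forall j, measurable (B j)) ->
    P (\bigcap_(j in [set` J]) (X j @^-1` B j)) =
    (\prod_(j <- J) fine (P (X j @^-1` B j)))%:E.

Definition iid (R : realType) (dO dT : measure_display)
    (O : measurableType dO) (T : measurableType dT) (I : choiceType)
    (P : probability O R) (X : I -> O -> T) : Prop :=
  mutually_independent P X /\ forall j k, same_law P (X j) P (X k).

(* N(m, s^2); the case s = 0 is the point mass at m, whereas the library's
   normal_prob m 0 is the uniform law on [0, 1]. *)
Definition normal_law (R : realType) (m s : R) (B : set R) : \bar R :=
  if s == 0 then \d_m B else normal_prob m s B.

Definition gaussian_vector (R : realType) (dO : measure_display)
    (O : measurableType dO) (d : nat) (P : probability O R)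
    (Z : O -> d.-tuple R) : Prop :=
  forall c : 'I_d -> R, exists m s : R, 0 <= s /\
    forall B : set R, measurable B ->
      P ((fun w => \sum_(i < d) c i * tnth (Z w) i) @^-1` B)
      = normal_law m s B.

Definition centered_vector (R : realType) (dO : measure_display)
    (O : measurableType dO) (d : nat) (P : probability O R)
    (Z : O -> d.-tuple R) : Prop :=
  forall i : 'I_d, expectation P (fun w => tnth (Z w) i) = 0%E.

Definition identity_covariance (R : realType) (dO : measure_display)
    (O : measurableType dO) (d : nat) (P : probability O R)
    (Z : O -> d.-tuple R) : Prop :=
  forall i j : 'I_d,
    covariance P (fun w => tnth (Z w) i) (fun w => tnth (Z w) j)
    = ((i == j)%:R)%:E.

Definition slowly_varying (R : realType) (L : R -> R) : Prop :=
  [/\ measurable_fun (`]0, +oo[%classic : set R) L,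
      \forall x \near +oo, 0 < L x
    & forall t : R, 0 < t -> L (t * x) / L x @[x --> +oo] --> (1 : R)].

(* X_k = \sum_(l >= 0) Psi_l eps_(k-l), the partial sums over l converging
   almost surely, coordinate by coordinate. *)
Definition linear_process (R : realType) (dO : measure_display)
    (O : measurableType dO) (d : nat) (P : probability O R)
    (Psi : nat -> 'M[R]_d) (eps X : int -> O -> d.-tuple R) : Prop :=
  forall (k : int) (i : 'I_d), {ae P, forall w,
    (\sum_(0 <= l < n) \sum_(j < d) Psi l i j * tnth (eps (k - l%:Z) w) j)
      @[n --> \oo] --> tnth (X k w) i}.

(* The supremum is taken in \bar R because it is finite only almost surely. *)
Definition M4 (R : realType) (O : Type) (d : nat)
    (a : 'I_d -> 'I_d -> int -> R) (W : int -> 'I_d -> O -> R) (k : int)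
    (w : O) : d.-tuple (\bar R) :=
  [tuple ereal_sup [set (a i j r * W (k - r) j w)%:E
                   | r in [set: int] & j in [set: 'I_d]] | i < d].

(* Componentwise maximum over k = 1, ..., n (it is -oo for n = 0). *)
Definition running_max (R : realType) (O : Type) (d : nat)
    (Z : nat -> O -> d.-tuple (\bar R)) (n : nat) (i : 'I_d) (w : O) : \bar R :=
  \big[maxe/-oo%E]_(1 <= k < n.+1) tnth (Z k w) i.

Definition max_below (R : realType) (O : Type) (d : nat)
    (Z : nat -> O -> d.-tuple (\bar R)) (v : nat -> 'I_d -> R) (n : nat) :
    set O :=
  [set w | forall i : 'I_d, (running_max Z n i w <= (v n i)%:E)%E].

(* Yhat is an i.i.d. sequence of copies of Y_0, on its own probability
   space. *)
Definition iid_copies (R : realType) (d1 d2 dT : measure_display)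
    (O1 : measurableType d1) (O2 : measurableType d2) (T : measurableType dT)
    (P1 : probability O1 R) (Y0 : O1 -> T)
    (P2 : probability O2 R) (Yhat : nat -> O2 -> T) : Prop :=
  iid P2 Yhat /\ forall k, same_law P2 (Yhat k) P1 Y0.

(* theta is the extremal index, at the level of the thresholds v, of the
   sequence Y with associated i.i.d. sequence Yhat, and H is the limit for
   the latter. *)
Definition multivariate_extremal_index (R : realType)
    (d1 d2 : measure_display) (O1 : measurableType d1)
    (O2 : measurableType d2) (d : nat)
    (P1 : probability O1 R) (Y : int -> O1 -> d.-tuple (\bar R))
    (P2 : probability O2 R) (Yhat : nat -> O2 -> d.-tuple (\bar R))
    (v : nat -> 'I_d -> R) (H theta : R) : Prop :=
  [/\ 0 < H < 1,
      0 <= theta <= 1,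
      P2 (max_below Yhat v n) @[n --> \oo] --> H%:E
    & P1 (max_below (fun k => Y k%:Z) v n) @[n --> \oo]
        --> (H `^ theta)%:E].

Section M4_constants.
Context (R : realType) (d : nat) (a : 'I_d -> 'I_d -> int -> R) (alpha : R).

Definition M4_Abar (i : 'I_d) : \bar R :=
  (\esum_(r in [set: int]) (\sum_(j < d) a i j r `^ alpha)%:E)%E.

Definition M4_A (i : 'I_d) : R := fine (M4_Abar i).

(* The maximum is over nonnegative numbers, hence the neutral element 0. *)
Definition M4_weight (tau : 'I_d -> R) (j : 'I_d) (r : int) : R :=
  \big[Num.max/0]_(i < d) (a i j r `^ alpha * tau i / M4_A i).

Definition M4_sum (tau : 'I_d -> R) : R :=
  \sum_(j < d) fine (\esum_(r in [set: int]) (M4_weight tau j r)%:E)%E.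

Definition M4_sup (tau : 'I_d -> R) : R :=
  \sum_(j < d) sup (range (M4_weight tau j)).

Definition M4_H (tau : 'I_d -> R) : R := expR (- M4_sum tau).

Definition M4_theta (tau : 'I_d -> R) : R := M4_sup tau / M4_sum tau.

End M4_constants.

(* Main.v *)
(* X_{k,i} is sigma_i times a standard Gaussian variable Y_{k,i}. Since Psi_0 is
   nonsingular, the correlations of any two distinct Y's are bounded away from 1
   in absolute value, so two of them are both in sets of probability at most p
   with probability O(p^(1+h)). The decay of Psi makes the conditional variance
   of Y_{k,i} given the innovations before time k - n^h equal to 1 - o(1/log n),
   so that an event {Y_{k,i} in B} is independent of that past up to a relative
   error o(1) and an absolute error O(n^-2). Hence, for any sets B_{n,j} with
   n N(0,1)(B_{n,j}) -> lambda_j, the number of events {Y_{k,j} in B_{n,j}} that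
   occur for k <= n is asymptotically Poisson:
   P(no Y_{k,j} in B_{n,j} for k <= n) -> exp(- sum_j lambda_j).
   For the moving maxima, Potter bounds make the contributions of the filter
   coefficients summable uniformly in n. This yields n P(Y_0 not <= u_n) as a
   sum over (j, r), and reduces {M_n <= u_n} to finitely many lags r, where up
   to boundary effects it says that no Y_{k,j} is in the union over r of the
   exceedance sets for lag r. These are upper level sets of h(sigma_j .), hence
   nested, and the probability of the union is the maximum over r. *)

From HB Require Import structures.
Require Import Defs.
From mathcomp Require Import ring lra zify.

Set Implicit Arguments.
Unset Strict Implicit.
Unset Printing Implicit Defensive.

Local Open Scope classical_set_scope.
Local Open Scope ring_scope.

(** * Integrals against normal densities *)

(** Since [h] is only measurable, an exceedance set of [h (sigma_j x)] need not be a half-line, and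
    comparison inequalities for Gaussian maxima do not apply. Every Gaussian estimate is therefore
    made for arbitrary measurable sets, through densities and in terms of mass alone: a radius [r]
    splits a set into a bounded part, where density ratios are controlled, and a part in the
    Gaussian tail. For the mixing [r^2] is of order [log n], which is why the conditional variance
    must be within [o(1/log n)] of 1; that rate results from squaring and summing the decay
    [o(l^(-1/2) / log l)]. The linear process is only an almost sure limit of finite sums, so laws
    and independence are read off from limits of integrals of cosines. A free phase lets cosines do
    the work of complex exponentials, and independence becomes factorisation of a joint transform.
    Of two correlated variables, one is written as a multiple of the other plus an independent
    normal residual, and the other is frozen by Fubini. *)

Section normal_integral.
Context {R : realType}.
Local Notation mu := (@lebesgue_measure R).
Implicit Types m s x t u : R.

Lemma ge0_integral_normal_prob m s (f : R -> \bar R) :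
  measurable_fun setT f -> (forall x, 0 <= f x)%E ->
  (\int[normal_prob m s]_x f x = \int[mu]_x (f x * (normal_pdf m s x)%:E))%E.
Proof.
move=> mf f0.
have dom := normal_prob_dominates m s.
rewrite -(Radon_Nikodym_SigmaFinite.change_of_variables dom f0)//.
apply: ae_eq_integral => //.
- apply: emeasurable_funM => //.
  exact: measurable_int (Radon_Nikodym_SigmaFinite.f_integrable dom).
- by apply: emeasurable_funM => //; apply/measurable_EFinP; exact: measurable_normal_pdf.
(* The Radon-Nikodym derivative agrees almost everywhere with [normal_pdf m s], as both have the
   same integral over every measurable set. *)
apply: ae_eqe_mul2l; apply: integral_ae_eq => //.
- exact: Radon_Nikodym_SigmaFinite.f_integrable.
- by apply/measurable_EFinP; exact: measurable_normal_pdf.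
by move=> A _ mA; rewrite -Radon_Nikodym_SigmaFinite.f_integral.
Qed.

Lemma integrable_normal_prob m s (f : R -> R) : measurable_fun setT f ->
  mu.-integrable setT (fun x => (f x * normal_pdf m s x)%:E) ->
  (normal_prob m s).-integrable setT (EFin \o f).
Proof.
move=> mf /integrableP[_ fi]; apply/integrableP; split; first exact/measurable_EFinP.
rewrite ge0_integral_normal_prob//; last first.
  by apply: measurableT_comp => //; exact/measurable_EFinP.
apply: le_lt_trans fi; rewrite le_eqVlt; apply/orP; left; apply/eqP.
by apply: eq_integral => x _ /=; rewrite normrM EFinM (ger0_norm (normal_pdf_ge0 _ _ _)).
Qed.

Lemma integral_normal_prob m s (f : R -> R) : measurable_fun setT f ->
  mu.-integrable setT (fun x => (f x * normal_pdf m s x)%:E) ->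
  (\int[normal_prob m s]_x (f x)%:E = \int[mu]_x (f x * normal_pdf m s x)%:E)%E.
Proof.
move=> mf fi.
have mEf : measurable_fun setT (EFin \o f) by exact/measurable_EFinP.
have mp : measurable_fun setT (EFin \o normal_pdf m s).
  by apply/measurable_EFinP; exact: measurable_normal_pdf.
rewrite integralE [RHS]integralE; congr (_ - _)%E.
- rewrite (ge0_integral_normal_prob m s (measurable_funepos mEf) (funepos_ge0 _)).
  by apply: eq_integral => x _; rewrite !funeposE /= -!EFin_max -EFinM maxr_pMl ?normal_pdf_ge0// mul0r.
- rewrite (ge0_integral_normal_prob m s (measurable_funeneg mEf) (funeneg_ge0 _)).
  by apply: eq_integral => x _; rewrite !funenegE /= -!EFin_max -EFinM maxr_pMl ?normal_pdf_ge0// mul0r mulNr.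
Qed.

(** The fundamental theorem on [[-n-1, n+1]] and dominated convergence. It stands in for integration
    by parts over the line: the moment and transform identities below follow by exhibiting a
    primitive that vanishes at both ends. *)
Lemma integral_derive_eq0 (F f : R -> R) :
  (forall x, is_derive x 1 F (f x)) -> continuous f ->
  mu.-integrable setT (EFin \o f) ->
  F x @[x --> +oo] --> 0 -> F x @[x --> -oo] --> 0 ->
  (\int[mu]_x (f x)%:E = 0)%E.
Proof.
move=> dF cf fi Fy FNy.
have mf : measurable_fun setT (EFin \o f) by exact: measurable_int fi.
pose A (n : nat) := `[- n.+1%:R, n.+1%:R]%classic : set R.
have mA n : measurable (A n) by exact: measurable_itv.
have dom : (\int[mu]_x (((EFin \o f) \_ (A n)) x) @[n --> \oo] --> \int[mu]_x (f x)%:E)%E.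
  apply: (@dominated_cvg _ _ _ mu _ _ _ _ (abse \o (EFin \o f))) => //.
  - by move=> n; exact: ((measurable_restrictT (EFin \o f) (mA n)).1 (measurable_funTS mf)).
  - move=> x _; apply: cvg_near_cst; near=> n.
    rewrite /patch mem_set// /A/= in_itv/= -ler_norml.
    apply: (@le_trans _ _ n%:R); last by rewrite ler_nat.
    by near: n; exact: nbhs_infty_ger.
  - exact: integrable_abse.
  - move=> n x _; rewrite /patch; case: ifPn => _ //=; by rewrite normr0 lee_fin.
have Fn n : (\int[mu]_x (((EFin \o f) \_ (A n)) x) = (F n.+1%:R - F (- n.+1%:R))%:E)%E.
  rewrite -integral_mkcond EFinB; apply: continuous_FTC2 => //.
  - by rewrite (@lt_trans _ _ 0)// ?ltr0n// oppr_lt0 ltr0n.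
  - by apply: continuous_subspaceT.
  - split.
    + by move=> x _; have [] := dF x.
    + apply: cvg_at_right_filter; apply: differentiable_continuous.
      by apply/derivable1_diffP; have [] := dF (- n.+1%:R).
    + apply: cvg_at_left_filter; apply: differentiable_continuous.
      by apply/derivable1_diffP; have [] := dF n.+1%:R.
  - by move=> x _; rewrite derive1E; have [] := dF x.
have : (F n.+1%:R - F (- n.+1%:R))%:E @[n --> \oo] --> (0 - 0 : R)%:E.
  apply: cvg_EFin; first by near=> n.
  apply: (@cvgB _ R^o).
  - by move/cvg_pinftyP : Fy; apply; apply/cvgryPge => ?; near=> n;
      apply: (@le_trans _ _ n%:R); [near: n; exact: nbhs_infty_ger|rewrite ler_nat].
  - move/cvg_ninftyP : FNy; apply; apply/cvgrNyPle => c; near=> n.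
    rewrite lerNl; apply: (@le_trans _ _ n%:R); last by rewrite ler_nat.
    by near: n; exact: nbhs_infty_ger.
under eq_fun do rewrite -Fn.
move=> H; rewrite subr0 in H.
exact: (cvg_unique _ dom H).
Unshelve. all: by end_near. Qed.

Lemma is_derive_normal_pdf m s x : s != 0 ->
  is_derive x 1 (normal_pdf m s) (- (x - m) / s ^+ 2 * normal_pdf m s x).
Proof.
move=> s0; rewrite !normal_pdfE//.
pose g (y : R) := - (y - m) ^+ 2 / (s ^+ 2 *+ 2).
have dg : is_derive x 1 g (- (x - m) / s ^+ 2).
  have -> : g = (- (s ^+ 2 *+ 2)^-1) *: ((id - cst m) ^+ 2).
    by apply/funext => y; rewrite /g /= !fctE /= /GRing.scale /=; field.
  apply: is_derive_eq.
  by rewrite /GRing.scale /= !fctE /= /GRing.scale /=; field.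
have -> : (fun x : R => normal_peak s * normal_fun m s x) = normal_peak s *: (expR \o g).
  by apply/funext => y.
have de := is_derive1_comp (is_derive_expR (g x)) dg.
apply: is_derive_eq.
by rewrite /GRing.scale/= /normal_fun -/(g x); ring.
Qed.

Let C_ge0 s : 0 <= 4 * s ^+ 2 * normal_peak s.
Proof. by rewrite mulr_ge0 ?normal_peak_ge0// mulr_ge0// sqr_ge0. Qed.

(** Half of the Gaussian exponent absorbs the square: with [y = (x - m)^2 / (4 s^2)] the density is
    a multiple of [exp (- y) * exp (- y)], and [y * exp (- y) <= 1]. *)
Lemma normal_pdf_center_sqr_le m s x : s != 0 ->
  (x - m) ^+ 2 * normal_pdf m s x <=
  4 * s ^+ 2 * normal_peak s * expR (- (x - m) ^+ 2 / (4 * s ^+ 2)).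
Proof.
move=> s0; rewrite normal_pdfE//.
have s2 : 0 < s ^+ 2 by rewrite exprn_even_gt0.
set y := (x - m) ^+ 2 / (4 * s ^+ 2).
have -> : (x - m) ^+ 2 = 4 * s ^+ 2 * y by rewrite /y; field.
have -> : normal_fun m s x = expR (- y) * expR (- y).
  by rewrite -expRD /normal_fun; congr expR; rewrite /y; field.
rewrite (_ : - (4 * s ^+ 2 * y) / (4 * s ^+ 2) = - y); last by field.
rewrite (_ : _ * _ = 4 * s ^+ 2 * normal_peak s * expR (- y) * (y * expR (- y))); last by ring.
rewrite ler_piMr//; first by rewrite mulr_ge0 ?expR_ge0.
by rewrite expRN ler_pdivrMr ?expR_gt0// mul1r (le_trans _ (expR_ge1Dx y))//; lra.
Qed.

Lemma normal_pdf_center_sqr_ub m s x : s != 0 ->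
  (x - m) ^+ 2 * normal_pdf m s x <= 4 * s ^+ 2 * normal_peak s.
Proof.
move=> s0; apply: (le_trans (normal_pdf_center_sqr_le m x s0)).
rewrite ler_piMr//.
by rewrite -expR0 ler_expR mulNr oppr_le0 divr_ge0 ?sqr_ge0// mulr_ge0// sqr_ge0.
Qed.

Lemma integrable_normal_pdf_center_sqr m s : s != 0 ->
  mu.-integrable setT (fun x => ((x - m) ^+ 2 * normal_pdf m s x)%:E).
Proof.
(* The exponential left by the previous bound is, up to a constant, the normal density of variance
   [2 s^2]. *)
move=> s0; pose s' := Num.sqrt 2 * s.
have s'0 : s' != 0 by rewrite mulf_neq0// gt_eqF// sqrtr_gt0.
have s'2 : s' ^+ 2 = 2 * s ^+ 2 by rewrite exprMn sqr_sqrtr.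
pose C := 4 * s ^+ 2 * normal_peak s / normal_peak s'.
have := integrableZl measurableT C (integrable_normal_pdf m s').
apply: le_integrable => //.
  apply/measurable_EFinP; apply: measurable_funM; last exact: measurable_normal_pdf.
  by apply: measurable_funX; exact: measurable_funB.
move=> x _; rewrite /= !lee_fin !ger0_norm; last 2 first.
- by rewrite mulr_ge0 ?normal_pdf_ge0// divr_ge0 ?normal_peak_ge0.
- by rewrite mulr_ge0 ?normal_pdf_ge0 ?sqr_ge0.
apply: (le_trans (normal_pdf_center_sqr_le m x s0)).
rewrite (normal_pdfE _ s'0) le_eqVlt; apply/orP; left; apply/eqP.
rewrite [RHS]mulrA /C divfK; last by rewrite gt_eqF// normal_peak_gt0.
by congr (_ * expR _); rewrite s'2; field.
Qed.

Lemma cvg_center_ub (F : R -> R) m C : (forall x, `|F x| * `|x - m| <= C) ->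
  F x @[x --> +oo] --> 0 /\ F x @[x --> -oo] --> 0.
Proof.
move=> H.
have C0 : 0 <= C by apply: le_trans (H m); rewrite mulr_ge0.
have K e x : 0 < e -> C / e < `|x - m| -> `|F x| <= e.
  move=> e0 xm; have := H x; rewrite leNgt; apply: contraNT; rewrite -ltNge => Fe.
  have xm0 : 0 < `|x - m| by apply: le_lt_trans xm; rewrite divr_ge0// ltW.
  rewrite (@lt_trans _ _ (e * `|x - m|))// ?ltr_pM2r//.
  by rewrite mulrC -ltr_pdivrMr.
split; apply/cvgr0Pnorm_le => e e0; near=> x; apply: K => //.
- rewrite ger0_norm; first by rewrite ltrBrDr; near: x; apply: nbhs_pinfty_gt; rewrite num_real.
  by rewrite subr_ge0; near: x; apply: nbhs_pinfty_ge; rewrite num_real.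
- rewrite distrC ger0_norm.
    by rewrite ltrBrDr addrC -ltrBrDr; near: x; apply: nbhs_ninfty_lt; rewrite num_real.
  by rewrite subr_ge0; near: x; apply: nbhs_ninfty_le; rewrite num_real.
Unshelve. all: by end_near. Qed.

Lemma measurable_center m : measurable_fun setT (fun x : R => x - m).
Proof. exact: measurable_funB. Qed.

Lemma integrable_normal_pdf_center m s : s != 0 ->
  mu.-integrable setT (fun x => ((x - m) * normal_pdf m s x)%:E).
Proof.
move=> s0.
have := integrableD measurableT (integrable_normal_pdf m s) (integrable_normal_pdf_center_sqr m s0).
apply: le_integrable => //.
  apply/measurable_EFinP; apply: measurable_funM; last exact: measurable_normal_pdf.
  exact: measurable_center.
move=> x _; rewrite /= !lee_fin normrM (ger0_norm (normal_pdf_ge0 _ _ _)).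
apply: (@le_trans _ _ (normal_pdf m s x + (x - m) ^+ 2 * normal_pdf m s x)); last exact: ler_norm.
rewrite -[X in _ <= X + _]mul1r -mulrDl ler_wpM2r ?normal_pdf_ge0//.
set y := x - m.
have : 0 <= (y - 1) ^+ 2 by exact: sqr_ge0.
have : 0 <= (y + 1) ^+ 2 by exact: sqr_ge0.
have : 0 <= y ^+ 2 by exact: sqr_ge0.
by rewrite !expr2; have [] := ger0P y; lra.
Qed.

(** The product is [O(1 / |x - m|)]: the density and [(x - m)^2] times the density are both bounded,
    which leaves room for a factor of linear growth and one more [|x - m|]. *)
Lemma cvg_mul_normal_pdf (q : R -> R) K m s : s != 0 ->
  (forall x, `|q x| <= K * (1 + `|x - m|)) ->
  q x * normal_pdf m s x @[x --> +oo] --> 0 /\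
  q x * normal_pdf m s x @[x --> -oo] --> 0.
Proof.
move=> s0 qK.
have K0 : 0 <= K by have := le_trans (normr_ge0 _) (qK m); rewrite subrr normr0 addr0 mulr1.
apply: (@cvg_center_ub _ m (K * (normal_peak s + 2 * (4 * s ^+ 2 * normal_peak s)))) => x.
rewrite normrM (ger0_norm (normal_pdf_ge0 _ _ _)).
have := normal_pdf_center_sqr_ub m x s0; have := normal_pdf_ub m x s0.
have := normal_pdf_ge0 m s x; rewrite -(real_normK (num_real (x - m))).
have := qK x; set a := `|x - m|; set p := normal_pdf m s x => qa p0 pub pub2.
have a0 : 0 <= a by exact: normr_ge0.
apply: (@le_trans _ _ (K * (1 + a) * p * a)).
  by rewrite ler_wpM2r// ler_wpM2r.
rewrite -!mulrA ler_wpM2l//.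
apply: (@le_trans _ _ (p + 2 * (a ^+ 2 * p))); last by lra.
have : 0 <= p * (1 - a + a ^+ 2).
  rewrite mulr_ge0//; have : 0 <= (a - 1) ^+ 2 by exact: sqr_ge0.
  by rewrite !expr2; lra.
by rewrite !expr2; lra.
Qed.

Lemma integral_normal_pdf_center m s : s != 0 ->
  (\int[mu]_x ((x - m) * normal_pdf m s x)%:E = 0)%E.
Proof.
move=> s0.
have s2 : 0 < s ^+ 2 by rewrite exprn_even_gt0.
pose F := (- s ^+ 2) *: normal_pdf m s.
apply: (@integral_derive_eq0 F (fun x => (x - m) * normal_pdf m s x)).
- move=> x; have := is_deriveZ (- s ^+ 2) (is_derive_normal_pdf m x s0).
  by move=> H; apply: is_derive_eq; rewrite /GRing.scale/=; field.
- move=> x; apply: cvgM; last exact: continuous_normal_pdf.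
  by apply: (@cvgB _ R^o); [exact: cvg_id|exact: cvg_cst].
- exact: integrable_normal_pdf_center.
- have := @cvg_mul_normal_pdf (cst (- s ^+ 2)) (s ^+ 2) m s s0.
  move=> /(_ _)/proj1; apply => x; rewrite normrN (ger0_norm (ltW s2)).
  by rewrite ler_peMr ?(ltW s2)// lerDl.
- have := @cvg_mul_normal_pdf (cst (- s ^+ 2)) (s ^+ 2) m s s0.
  move=> /(_ _)/proj2; apply => x; rewrite normrN (ger0_norm (ltW s2)).
  by rewrite ler_peMr ?(ltW s2)// lerDl.
Qed.

Lemma integral_normal_pdf_center_sqr m s : s != 0 ->
  (\int[mu]_x ((x - m) ^+ 2 * normal_pdf m s x)%:E = (s ^+ 2)%:E)%E.
Proof.
move=> s0.
have s2 : 0 < s ^+ 2 by rewrite exprn_even_gt0.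
pose p := normal_pdf m s.
(* [F] has derivative [((x - m)^2 - s^2) * p x], so the second moment is [s^2] times the total mass
   1. *)
pose F := (- s ^+ 2) *: ((id - cst m) * p).
have E : (\int[mu]_x ((x - m) ^+ 2 * p x - s ^+ 2 * p x)%:E = 0)%E.
  have i2 := integrable_normal_pdf_center_sqr m s0.
  have i0 := integrableZl measurableT (s ^+ 2) (integrable_normal_pdf m s).
  have cc : forall x, {for x, continuous (fun x : R => x - m)}.
    by move=> x; apply: (@cvgB _ R^o); [exact: cvg_id|exact: cvg_cst].
  apply: (@integral_derive_eq0 F (fun x => (x - m) ^+ 2 * p x - s ^+ 2 * p x)).
  - move=> x; have dp := is_derive_normal_pdf m x s0.
    apply: is_derive_eq; rewrite !fctE /GRing.scale/= /GRing.scale /= -/p; by field.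
  - move=> x; apply: (@cvgB _ R^o); last first.
      by apply: cvgM; [exact: cvg_cst|exact: continuous_normal_pdf].
    apply: cvgM; last exact: continuous_normal_pdf.
    by apply: (cvg_comp (fun x => x - m) (fun x => x ^+ 2)); [exact: cc|exact: sqr_continuous].
  - exact: (integrableB measurableT i2 i0).
  - have := @cvg_mul_normal_pdf (fun x => (- s ^+ 2) * (x - m)) (s ^+ 2) m s s0.
    move=> /(_ _)/proj1; under eq_fun do rewrite -mulrA; apply => x.
    rewrite normrM normrN (ger0_norm (ltW s2)).
    by rewrite ler_wpM2l ?(ltW s2)// lerDr.
  - have := @cvg_mul_normal_pdf (fun x => (- s ^+ 2) * (x - m)) (s ^+ 2) m s s0.
    move=> /(_ _)/proj2; under eq_fun do rewrite -mulrA; apply => x.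
    rewrite normrM normrN (ger0_norm (ltW s2)).
    by rewrite ler_wpM2l ?(ltW s2)// lerDr.
move: E; under eq_integral do rewrite EFinB.
rewrite integralB//; last 2 first.
- exact: integrable_normal_pdf_center_sqr.
- exact: (integrableZl measurableT (s ^+ 2) (integrable_normal_pdf m s)).
under [X in (_ - X)%E]eq_integral do rewrite EFinM.
rewrite integralZl//; last exact: integrable_normal_pdf.
rewrite integral_normal_pdf mule1.
have := integrable_fin_num measurableT (integrable_normal_pdf_center_sqr m s0).
by case: integral => // r _; rewrite -EFinB => -[] /eqP; rewrite subr_eq0 => /eqP ->.
Qed.

End normal_integral.

(** * Cosine transform of the normal law *)

Section normal_char.
Context {R : realType}.
Local Notation mu := (@lebesgue_measure R).
Implicit Types m s x t u : R.

Lemma integrable_cos_normal_pdf s t u :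
  mu.-integrable setT (fun x => (cos (t * x + u) * normal_pdf 0 s x)%:E).
Proof.
apply: le_integrable (integrable_normal_pdf 0 s) => //.
  apply/measurable_EFinP; apply: measurable_funM; last exact: measurable_normal_pdf.
  apply: measurableT_comp; first by apply: continuous_measurable_fun; exact: continuous_cos.
  by apply: measurable_funD => //; exact: measurable_funM.
move=> x _ /=; rewrite lee_fin normrM ler_piMl// ler_norml cos_geN1 cos_le1//.
Qed.

(* The characteristic function G satisfies G' = - s^2 t G, by differentiation
   under the integral and integration by parts. *)
Lemma normal_cosE s t u : s != 0 ->
  \int[mu]_x (cos (t * x + u) * normal_pdf 0 s x) =
  cos u * expR (- (s ^+ 2 * t ^+ 2 / 2)).
Proof.
move=> s0.
have s2 : 0 < s ^+ 2 by rewrite exprn_even_gt0.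
pose p := normal_pdf 0 s.
pose f (t x : R) := cos (t * x + u) * p x.
pose G t := \int[mu]_x f t x.
have df (t' x : R) : is_derive t' 1 (f ^~ x) (- x * sin (t' * x + u) * p x).
  pose L (t : R) := t * x + u.
  have dl : is_derive t' 1 L x.
    rewrite (_ : L = x *: id + cst u); last first.
      by apply/funext => y; rewrite !fctE /GRing.scale /= mulrC.
    apply: is_derive_eq; by rewrite /GRing.scale/= addr0 mulr1.
  have dc := is_derive1_comp (is_derive_cos (L t')) dl.
  rewrite (_ : f ^~ x = p x *: (cos \o L)); last first.
    by apply/funext => y; rewrite /f !fctE /GRing.scale /= mulrC.
  by apply: is_derive_eq; rewrite /GRing.scale /=; ring.
have msin t' : measurable_fun setT (fun x : R => sin (t' * x + u)).
  apply: measurableT_comp; first by apply: continuous_measurable_fun; exact: continuous_sin.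
  by apply: measurable_funD => //; exact: measurable_funM.
have isin t' : mu.-integrable setT (fun x => (x * sin (t' * x + u) * p x)%:E).
  apply: le_integrable (integrable_normal_pdf_center 0 s0) => //.
    apply/measurable_EFinP; apply: measurable_funM; last exact: measurable_normal_pdf.
    by apply: measurable_funM => //; exact: msin.
  move=> x _ /=; rewrite lee_fin subr0 !normrM ler_wpM2r// ler_piMr//.
  by rewrite ler_norml sin_geN1 sin_le1.
have ibp t' : \int[mu]_x (x * sin (t' * x + u) * p x) = s ^+ 2 * t' * G t'.
  have : (\int[mu]_x (t' * f t' x - (s ^- 2) * (x * sin (t' * x + u) * p x))%:E = 0)%E.
    pose F := (fun x : R => sin (t' * x + u)) * p.
    have i1 := integrableZl measurableT t' (integrable_cos_normal_pdf s t' u).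
    have i2 := integrableZl measurableT (s ^- 2) (isin t').
    have cl : continuous (fun x : R => t' * x + u).
      move=> x; apply: (@cvgD _ R^o); last exact: cvg_cst.
      by apply: cvgM; [exact: cvg_cst|exact: cvg_id].
    have cp : continuous p by exact: continuous_normal_pdf.
    have csin : continuous (fun x : R => sin (t' * x + u)).
      by move=> x; apply: (cvg_comp _ sin); [exact: cl|exact: continuous_sin].
    have ccos : continuous (fun x : R => cos (t' * x + u)).
      by move=> x; apply: (cvg_comp _ cos); [exact: cl|exact: continuous_cos].
    apply: (@integral_derive_eq0 _ F (fun x => t' * f t' x - (s ^- 2) * (x * sin (t' * x + u) * p x))).
    - move=> x; have dp := is_derive_normal_pdf 0 x s0.
      pose L (x : R) := t' * x + u.
      have dl : is_derive x 1 L t'.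
        rewrite (_ : L = t' *: id + cst u); last first.
          by apply/funext => y; rewrite !fctE /GRing.scale /=.
        apply: is_derive_eq; by rewrite /GRing.scale/= addr0 mulr1.
      have ds := is_derive1_comp (is_derive_sin (L x)) dl.
      rewrite (_ : F = (sin \o L) * p)//.
      apply: is_derive_eq; rewrite /GRing.scale /= -/p /f; by field.
    - move=> x; apply: (@cvgB _ R^o).
        apply: cvgM; first exact: cvg_cst.
        by apply: cvgM; [exact: ccos|exact: cp].
      apply: cvgM; first exact: cvg_cst.
      apply: cvgM; last exact: cp.
      by apply: cvgM; [exact: cvg_id|exact: csin].
    - exact: (integrableB measurableT i1 i2).
    - apply: (@cvg_mul_normal_pdf _ _ 1 0 s s0 _).1 => x; rewrite mul1r.
      by rewrite (@le_trans _ _ 1)// ?lerDl// ler_norml sin_geN1 sin_le1.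
    - apply: (@cvg_mul_normal_pdf _ _ 1 0 s s0 _).2 => x; rewrite mul1r.
      by rewrite (@le_trans _ _ 1)// ?lerDl// ler_norml sin_geN1 sin_le1.
  have i1 := integrable_cos_normal_pdf s t' u.
  move/(congr1 fine); rewrite -[LHS]/(\int[mu]_x _).
  rewrite RintegralB//; last 2 first.
  - exact: (integrableZl measurableT t' i1).
  - exact: (integrableZl measurableT _ (isin t')).
  rewrite (RintegralZl t' measurableT i1) (RintegralZl (s ^- 2) measurableT (isin t')) -/(G t') => /eqP; rewrite /= subr_eq0 => /eqP E.
  by rewrite -mulrA E mulrA divff ?mul1r// gt_eqF.
have dG t' : is_derive t' 1 G (- (s ^+ 2 * t') * G t').
  have It : `]t' - 1, t' + 1[%classic t' by rewrite /= in_itv/=; apply/andP; split; lra.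
  have d1 x y : partial1of2 f x y = - y * sin (x * y + u) * p y.
    by rewrite partial1of2E; have [_ ->] := df x y.
  have h1 : forall x, `]t' - 1, t' + 1[%classic x -> mu.-integrable setT (EFin \o f x).
    by move=> x _; exact: integrable_cos_normal_pdf.
  have h2 : forall x y, `]t' - 1, t' + 1[%classic x -> setT y -> derivable (f ^~ y) x 1.
    by move=> x y _ _; have [] := df x y.
  have h3 : forall y, 0 <= `|y| * p y by move=> y; rewrite mulr_ge0// normal_pdf_ge0.
  have h4 : mu.-integrable setT (EFin \o (fun y => `|y| * p y)).
    apply: le_integrable (integrable_normal_pdf_center 0 s0) => //.
      apply/measurable_EFinP; apply: measurable_funM; last exact: measurable_normal_pdf.
      exact: (@normr_measurable R setT).
    by move=> x _ /=; rewrite lee_fin subr0 !normrM normr_id.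
  have h5 : forall x y, `]t' - 1, t' + 1[%classic x -> setT y -> `|partial1of2 f x y| <= `|y| * p y.
    move=> x y _ _; rewrite d1 !normrM normrN (ger0_norm (normal_pdf_ge0 _ _ _)).
    rewrite ler_wpM2r ?normal_pdf_ge0// ler_piMr// ler_norml sin_geN1 sin_le1//.
  have D := differentiation_under_integral measurableT It h1 h2 h3 h4 h5.
  have Dv := derivable_under_integral measurableT It h1 h2 h3 h4 h5.
  apply: DeriveDef => //; rewrite -derive1E D.
  have -> : \int[mu]_y partial1of2 f t' y = \int[mu]_y (- 1 * (y * sin (t' * y + u) * p y)).
    by apply: eq_Rintegral => y _; rewrite d1; ring.
  by rewrite (RintegralZl (- 1) measurableT (isin t')) ibp mulN1r mulNr.
(* [E] solves the opposite equation [E' = s^2 t E], so [G * E] is constant and equals its value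
   [cos u] at 0. *)
pose E (t : R) := expR (s ^+ 2 * t ^+ 2 / 2).
have dE t' : is_derive t' 1 E (s ^+ 2 * t' * E t').
  pose L (t : R) := s ^+ 2 * t ^+ 2 / 2.
  have dl : is_derive t' 1 L (s ^+ 2 * t').
    rewrite (_ : L = (s ^+ 2 / 2) *: (id ^+ 2)); last first.
      by apply/funext => y; rewrite !fctE /GRing.scale /= /L mulrAC.
    by apply: is_derive_eq; rewrite /GRing.scale/= /GRing.scale /=; field.
  have de := is_derive1_comp (is_derive_expR (L t')) dl.
  rewrite (_ : E = expR \o L)//.
  by apply: is_derive_eq; rewrite /= mulrC.
have dGE t' : is_derive t' 1 (G * E) 0.
  have H1 := dG t'; have H2 := dE t'.
  by apply: is_derive_eq; rewrite /GRing.scale /=; ring.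
have := is_derive_0_is_cst t 0 dGE.
rewrite !fctE /E expr0n/= mulr0 mul0r expR0 mulr1.
have -> : G 0 = cos u.
  rewrite /G /f; under eq_Rintegral do rewrite mul0r add0r.
  rewrite RintegralZl//; last exact: integrable_normal_pdf.
  by rewrite /Rintegral integral_normal_pdf mulr1.
by move=> <-; rewrite expRN mulfK // gt_eqF// expR_gt0.
Qed.

End normal_char.

Section bounded_integral.
Context {R : realType} {dO : measure_display} {O : measurableType dO}
  (P : probability O R).
Implicit Types f : O -> R.

Lemma bounded_prob_integrable f M : measurable_fun setT f ->
  (forall w, `|f w| <= M) -> P.-integrable setT (EFin \o f).
Proof.
move=> mf fM; apply: measurable_bounded_integrable => //.
  by rewrite (le_lt_trans (@probability_le1 _ _ _ P _ _))// ltry.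
by exists M; split; [exact: num_real|move=> x Mx y _; apply: (le_trans (fM y)); exact: ltW].
Qed.

Lemma bounded_cvg_Rintegral (f_ : nat -> O -> R) f M :
  (forall n, measurable_fun setT (f_ n)) -> measurable_fun setT f ->
  (forall n w, `|f_ n w| <= M) ->
  {ae P, forall w, f_ n w @[n --> \oo] --> f w} ->
  \int[P]_w f_ n w @[n --> \oo] --> \int[P]_w f w.
Proof.
move=> mf_ mf fM ff.
have iM : P.-integrable setT (EFin \o cst M).
  apply: (@bounded_prob_integrable _ `|M|) => // w; by [].
have mE n : measurable_fun setT (EFin \o f_ n) by exact/measurable_EFinP.
have mEf : measurable_fun setT (EFin \o f) by exact/measurable_EFinP.
have cvE : {ae P, forall w, setT w -> (EFin \o f_ n) w @[n --> \oo] --> (EFin \o f) w}.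
  by apply: filterS ff => w h _; apply: cvg_EFin => //; exact: nearW.
have ub : {ae P, forall w n, setT w -> (`|(EFin \o f_ n) w| <= (EFin \o cst M) w)%E}.
  by apply: aeW => w n _; rewrite lee_fin.
have [fi _ H] := dominated_convergence measurableT mE mEf cvE iM ub.
have F : (\int[P]_w (f w)%:E)%E \is a fin_num by exact: integrable_fin_num.
by apply: fine_cvg; rewrite /Rintegral fineK.
Qed.

End bounded_integral.

(** * Cosine transforms determine laws *)

Section trig_determines.
Context {R : realType}.

(** The phase [c] brings in the sines and [a = 0] the constants. By the product formula for cosines
    the class is then an algebra, hence stable under composition with a polynomial such as
    [sign_step]. *)
Inductive trig_poly : (R -> R) -> Prop :=
| trig_cos (a c : R) : trig_poly (fun x => cos (a * x + c))
| trig_add f g : trig_poly f -> trig_poly g -> trig_poly (fun x => f x + g x)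
| trig_scale (k : R) f : trig_poly f -> trig_poly (fun x => k * f x).

Lemma trig_mul f g : trig_poly f -> trig_poly g -> trig_poly (fun x => f x * g x).
Proof.
elim=> {f} [a c|f1 f2 _ h1 _ h2|k f _ h] tg; last 2 first.
- rewrite (_ : (fun x => _) = fun x => f1 x * g x + f2 x * g x).
    exact: trig_add (h1 tg) (h2 tg).
  by apply/funext => x; rewrite mulrDl.
- rewrite (_ : (fun x => _) = fun x => k * (f x * g x)); first exact: trig_scale (h tg).
  by apply/funext => x; rewrite mulrA.
elim: tg => {g} [b e|g1 g2 _ h1 _ h2|k g _ h].
- rewrite (_ : (fun x => _) = fun x => 2^-1 * (cos ((a + b) * x + (c + e)) + cos ((a - b) * x + (c - e)))).
    by apply: trig_scale; apply: trig_add; exact: trig_cos.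
  apply/funext => x.
  have -> : (a + b) * x + (c + e) = (a * x + c) + (b * x + e) by ring.
  have -> : (a - b) * x + (c - e) = (a * x + c) - (b * x + e) by ring.
  by rewrite (cosD (a * x + c)) (cosB (a * x + c)); field.
- rewrite (_ : (fun x => _) = fun x => cos (a * x + c) * g1 x + cos (a * x + c) * g2 x).
    exact: trig_add.
  by apply/funext => x; rewrite mulrDr.
- rewrite (_ : (fun x => _) = fun x => k * (cos (a * x + c) * g x)).
    exact: trig_scale.
  by apply/funext => x; rewrite mulrCA.
Qed.

(* The iterates of this odd polynomial converge to the sign function on
   [-1, 1], which turns trigonometric polynomials into indicators. *)
Definition sign_step (y : R) : R := (3 * y - y ^+ 3) / 2.

Lemma trig_sign_step n (f : R -> R) : trig_poly f -> trig_poly (fun x => iter n sign_step (f x)).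
Proof.
move=> tf; elim: n => [//|n IH].
rewrite (_ : (fun x => _) = fun x => (3 / 2) * iter n sign_step (f x) +
   (- 2^-1) * (iter n sign_step (f x) * (iter n sign_step (f x) * iter n sign_step (f x)))).
  by apply: trig_add; apply: trig_scale => //; apply: trig_mul => //; exact: trig_mul.
by apply/funext => x; rewrite iterS /sign_step; set z := iter _ _ _; rewrite !exprS expr0; field.
Qed.

(** [1 - sign_step y = (1 - y)^2 (2 + y) / 2], and symmetrically for [1 + sign_step y]; both are
    nonnegative on [[-1, 1]]. *)
Lemma sign_step_bound (y : R) : `|y| <= 1 -> `|sign_step y| <= 1.
Proof.
rewrite !ler_norml => /andP[y1 y2]; rewrite /sign_step.
have h1 : 0 <= (1 - y) ^+ 2 * (2 + y) by rewrite mulr_ge0 ?sqr_ge0//; lra.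
have h2 : 0 <= (1 + y) ^+ 2 * (2 - y) by rewrite mulr_ge0 ?sqr_ge0//; lra.
by move: h1 h2; rewrite !exprS expr0 => h1 h2; apply/andP; split; nra.
Qed.

Lemma iter_sign_step_bound n (y : R) : `|y| <= 1 -> `|iter n sign_step y| <= 1.
Proof. by move=> y1; elim: n => [//|n IH]; rewrite iterS; exact: sign_step_bound. Qed.

Lemma iter_sign_stepN n (y : R) : iter n sign_step (- y) = - iter n sign_step y.
Proof.
elim: n => [//|n IH]; rewrite !iterS IH /sign_step.
by rewrite !exprS expr0; field.
Qed.

(** Each step multiplies the distance [1 - z] to the fixed point 1 by [(1 - z) (2 + z) / 2], which
    decreases in [z > 0]. As the iterates stay above [y], the factor at [y] bounds all of them. *)
Lemma iter_sign_step_pos n (y : R) : 0 < y <= 1 ->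
  y <= iter n sign_step y <= 1 /\
  1 - iter n sign_step y <= ((1 - y) * (2 + y) / 2) ^+ n.
Proof.
move=> /andP[y0 y1]; elim: n => [|n [/andP[I1 I2] I3]]; first by rewrite /= lexx y1 expr0; split => //; lra.
rewrite iterS; set z := iter n sign_step y in I1 I2 I3 *.
have E : 1 - sign_step z = (1 - z) * ((1 - z) * (2 + z) / 2).
  by rewrite /sign_step !exprS expr0; field.
have H : (1 - z) * (2 + z) / 2 <= (1 - y) * (2 + y) / 2.
  rewrite ler_pM2r//; nra.
have H0 : 0 <= (1 - z) * (2 + z) / 2 by rewrite divr_ge0// mulr_ge0; lra.
have H1 : (1 - z) * (2 + z) / 2 <= 1 by rewrite ler_pdivrMr//; nra.
split.
  have : 1 - sign_step z <= 1 - z by rewrite E ler_piMr//; lra.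
  have : 0 <= 1 - sign_step z by rewrite E mulr_ge0//; lra.
  by move=> ? ?; apply/andP; split; lra.
rewrite E exprSr; apply: ler_pM => //; lra.
Qed.

Lemma cvg_iter_sign_step (y : R) : `|y| <= 1 ->
  iter n sign_step y @[n --> \oo] --> Num.sg y.
Proof.
have pos (z : R) : 0 < z <= 1 -> iter n sign_step z @[n --> \oo] --> (1 : R).
  move=> z01; have /andP[z0 z1] := z01.
  pose r := (1 - z) * (2 + z) / 2.
  have r0 : 0 <= r by rewrite divr_ge0// mulr_ge0; lra.
  have r1 : r < 1 by rewrite ltr_pdivrMr//; nra.
  have gr : r ^+ n @[n --> \oo] --> (0 : R) by apply: cvg_expr; rewrite ger0_norm.
  have g1 : 1 - r ^+ n @[n --> \oo] --> (1 : R).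
    by rewrite -[X in _ --> X]subr0; apply: (@cvgB _ R^o) => //; exact: cvg_cst.
  apply: (@squeeze_cvgr _ _ _ _ (fun n => 1 - r ^+ n) (fun _ => 1 : R) _ _ 1 g1); last exact: cvg_cst.
  near=> n; have [/andP[_ h1] h2] := iter_sign_step_pos n z01.
  by rewrite h1 andbT lerBlDl -lerBlDr.
move=> y1; have [y0|y0|->] := ltrgt0P y.
- by rewrite gtr0_sg//; apply: pos; rewrite y0 -(gtr0_norm y0).
- rewrite ltr0_sg// (_ : (fun n => _) = fun n => - iter n sign_step (- y)); last first.
    by apply/funext => n; rewrite iter_sign_stepN opprK.
  apply: (@cvgN _ R^o); apply: pos; rewrite oppr_gt0 y0/=.
  by rewrite -(ltr0_norm y0).
- rewrite sgr0 (_ : (fun n => _) = fun=> 0); first exact: cvg_cst.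
  apply/funext; elim=> [//|n IH]; rewrite iterS IH /sign_step.
  by rewrite expr0n/= mulr0 subr0 mul0r.
Unshelve. all: by end_near. Qed.

Lemma trig_poly_bounded f : trig_poly f ->
  measurable_fun setT f /\ exists M, forall x, `|f x| <= M.
Proof.
elim=> {f} [a c|f g _ [mf [M fM]] _ [mg [N gN]]|k f _ [mf [M fM]]].
- split; last by exists 1 => x; rewrite ler_norml cos_geN1 cos_le1.
  apply: measurableT_comp; first by apply: continuous_measurable_fun; exact: continuous_cos.
  by apply: measurable_funD => //; exact: measurable_funM.
- split; first exact: measurable_funD.
  by exists (M + N) => x; rewrite (le_trans (ler_normD _ _))// lerD.
- split; first exact: measurable_funM.
  by exists (`|k| * M) => x; rewrite normrM ler_wpM2l.
Qed.

Context {d1 d2 : measure_display} {O1 : measurableType d1} {O2 : measurableType d2}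
  (P1 : probability O1 R) (P2 : probability O2 R).
Variables (Z1 xi1 : O1 -> R) (Z2 xi2 : O2 -> R).
Hypotheses (mZ1 : measurable_fun setT Z1) (mZ2 : measurable_fun setT Z2)
  (mxi1 : measurable_fun setT xi1) (mxi2 : measurable_fun setT xi2)
  (xi1_le1 : forall w, `|xi1 w| <= 1) (xi2_le1 : forall w, `|xi2 w| <= 1).
Hypothesis same_cos : forall a c,
  \int[P1]_w (cos (a * Z1 w + c) * xi1 w) = \int[P2]_w (cos (a * Z2 w + c) * xi2 w).

Let same_int (f : R -> R) := [/\ measurable_fun setT f, (exists M : R, forall x, `|f x| <= M) &
  \int[P1]_w (f (Z1 w) * xi1 w) = \int[P2]_w (f (Z2 w) * xi2 w)].

Let mint d (O : measurableType d) (P : probability O R) (Z xi : O -> R) (f : R -> R) (M : R) :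
  measurable_fun setT Z -> measurable_fun setT xi -> (forall w, `|xi w| <= 1) ->
  measurable_fun setT f -> (forall x, `|f x| <= M) ->
  P.-integrable setT (EFin \o (fun w => f (Z w) * xi w)).
Proof.
move=> mZ mxi xi1' mf fM; apply: (@bounded_prob_integrable _ _ _ P _ M).
  by apply: measurable_funM => //; exact: measurableT_comp.
by move=> w; rewrite normrM -[M]mulr1 ler_pM.
Qed.

Let same_add f g : same_int f -> same_int g -> same_int (fun x => f x + g x).
Proof.
move=> [mf [M fM] Ef] [mg [N gN] Eg]; split.
- exact: measurable_funD.
- by exists (M + N) => x; rewrite (le_trans (ler_normD _ _))// lerD.
- under eq_Rintegral do rewrite mulrDl; under [RHS]eq_Rintegral do rewrite mulrDl.
  rewrite RintegralD//; [|exact: mint fM|exact: mint gN].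
  by rewrite RintegralD//; [|exact: mint fM|exact: mint gN]; rewrite Ef Eg.
Qed.

Let same_scale k f : same_int f -> same_int (fun x => k * f x).
Proof.
move=> [mf [M fM] Ef]; split.
- exact: measurable_funM.
- by exists (`|k| * M) => x; rewrite normrM ler_wpM2l.
- under eq_Rintegral do rewrite -mulrA; under [RHS]eq_Rintegral do rewrite -mulrA.
  rewrite RintegralZl//; last exact: mint fM.
  by rewrite RintegralZl//; [rewrite Ef|exact: mint fM].
Qed.

Let same_lim (f_ : nat -> R -> R) f M : (forall n, same_int (f_ n)) ->
  (forall n x, `|f_ n x| <= M) -> (forall x, f_ n x @[n --> \oo] --> f x) -> same_int f.
Proof.
move=> Sf fM ff.
have mf : measurable_fun setT f.
  by apply: (measurable_fun_cvg (h := f_)) => [n|x _]; [have [] := Sf n|exact: ff].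
have fM' x : `|f x| <= M.
  apply: (@cvgr_to_le _ _ _ _ _ _ _ (cvg_norm (ff x))).
  exact: nearW.
have L d (O : measurableType d) (P : probability O R) (Z xi : O -> R) :
   measurable_fun setT Z -> measurable_fun setT xi -> (forall w, `|xi w| <= 1) ->
   \int[P]_w (f_ n (Z w) * xi w) @[n --> \oo] --> \int[P]_w (f (Z w) * xi w).
  move=> mZ mxi xi1'; apply: (@bounded_cvg_Rintegral _ _ _ _ _ _ M).
  - move=> n; apply: measurable_funM => //; apply: measurableT_comp => //.
    by have [] := Sf n.
  - by apply: measurable_funM => //; exact: measurableT_comp.
  - by move=> n w; rewrite normrM -[M]mulr1 ler_pM.
  - by apply: aeW => w; apply: cvgM; [exact: ff|exact: cvg_cst].
split => //; first by exists M.
have L1 := L _ _ P1 _ _ mZ1 mxi1 xi1_le1; have L2 := L _ _ P2 _ _ mZ2 mxi2 xi2_le1.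
rewrite (_ : (fun n => _) = fun n => \int[P2]_w (f_ n (Z2 w) * xi2 w)) in L1; last first.
  by apply/funext => n; have [] := Sf n.
exact: (cvg_unique _ L1 L2).
Qed.

Let same_trig f : trig_poly f -> same_int f.
Proof.
move=> tf; have [mf fM] := trig_poly_bounded tf; split => //.
elim: tf => {f mf fM} [a c|f g tf Ef tg Eg|k f tf Ef]; first exact: same_cos.
- have [mf [M fM]] := trig_poly_bounded tf; have [mg [N gN]] := trig_poly_bounded tg.
  by have [] := @same_add f g (And3 mf (ex_intro _ _ fM) Ef) (And3 mg (ex_intro _ _ gN) Eg).
- have [mf [M fM]] := trig_poly_bounded tf.
  by have [] := @same_scale k f (And3 mf (ex_intro _ _ fM) Ef).
Qed.

Let sg_le1 (y : R) : `|Num.sg y| <= 1.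
Proof. by rewrite normr_sg; case: eqP. Qed.

(** The sign of [x - b] is a double limit: iterating [sign_step] on [sin ((x - b) / (n + 1))] gives
    the sign of this sine, and for large [n] the argument lies in [(-pi, pi)], where the sine has
    the sign of [x - b]. *)
Let same_sg b : same_int (fun x => Num.sg (x - b)).
Proof.
apply: (@same_lim (fun n x => Num.sg (sin ((x - b) / n.+1%:R))) _ 1) => //.
  move=> n; apply: (@same_lim (fun k x => iter k sign_step (sin ((x - b) / n.+1%:R))) _ 1).
  - move=> k; apply: same_trig; apply: (@trig_sign_step k (fun x => sin ((x - b) / n.+1%:R))).
    rewrite (_ : (fun x => _) = fun x => cos (n.+1%:R^-1 * x + (- b / n.+1%:R - pi / 2))); first exact: trig_cos.
    by apply/funext => x; rewrite addrA cosBpihalf; congr sin; field.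
  - by move=> k x; apply: iter_sign_step_bound; rewrite ler_norml sin_geN1 sin_le1.
  - by move=> x; apply: cvg_iter_sign_step; rewrite ler_norml sin_geN1 sin_le1.
move=> x; apply: cvg_near_cst; near=> n.
have n0 : (0 : R) < n.+1%:R by rewrite ltr0n.
have small : `|(x - b) / n.+1%:R| < pi.
  rewrite normrM normfV (ger0_norm (ltW n0)) ltr_pdivrMr// mulrC -ltr_pdivrMr ?pi_gt0//.
  by rewrite (@lt_trans _ _ n%:R)// ?ltr_nat//; near: n; exact: nbhs_infty_gtr.
have [xb|xb|->] := ltrgt0P (x - b).
- rewrite gtr0_sg ?(gtr0_sg xb)//; apply: sin_gt0_pi.
  have y0 : 0 < (x - b) / n.+1%:R by rewrite divr_gt0.
  by rewrite y0 -(gtr0_norm y0).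
- rewrite ltr0_sg ?(ltr0_sg xb)//; rewrite -oppr_gt0 -sinN; apply: sin_gt0_pi.
  have y0 : (x - b) / n.+1%:R < 0 by rewrite pmulr_llt0// invr_gt0.
  by rewrite oppr_gt0 y0 -(ltr0_norm y0).
- by rewrite mul0r sin0 sgr0.
Unshelve. all: by end_near. Qed.

Let same_ray b : same_int (\1_(`]b, +oo[%classic : set R)).
Proof.
(* The jump is placed at [b + 1/(n+1)]: the value 1/2 of [(1 + sg) / 2] at the jump then disappears
   in the limit, and [b] itself gets 0 because the ray is open. The constant 1 is written
   [cos (0 * x + 0)] to be a [trig_poly]. *)
apply: (@same_lim (fun n x => 2^-1 * (Num.sg (x - (b + n.+1%:R^-1)) + cos (0 * x + 0))) _ 1).
- by move=> n; apply: same_scale; apply: same_add; [exact: same_sg|apply: same_trig; exact: trig_cos].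
- move=> n x; rewrite mul0r add0r cos0 ger0_norm.
    by have := sg_le1 (x - (b + n.+1%:R^-1)); rewrite ler_norml => /andP[]; lra.
  by have := sg_le1 (x - (b + n.+1%:R^-1)); rewrite ler_norml => /andP[]; lra.
- move=> x; apply: cvg_near_cst; near=> n.
  have n0 : (0 : R) < n.+1%:R^-1 by rewrite invr_gt0 ltr0n.
  rewrite mul0r add0r cos0 indicE; case: (ltP b x) => bx.
    rewrite mem_set/= ?in_itv/= ?bx// gtr0_sg; first by lra.
    rewrite subr_gt0 -ltrBrDl -[ltRHS]invrK ltf_pV2 ?posrE ?invr_gt0 ?subr_gt0 ?ltr0n//.
    by rewrite (@lt_trans _ _ n%:R)// ?ltr_nat//; near: n; exact: nbhs_infty_gtr.
  rewrite memNset/=; last by rewrite in_itv/= andbT; apply/negP; rewrite -leNgt.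
  rewrite ltr0_sg ?mulr0n /=; first by lra.
  by rewrite subr_lt0 (le_lt_trans bx)// ltrDl.
Unshelve. all: by end_near. Qed.

(** The sets with equal integrals form a Dynkin system containing the open rays. The weights serve
    two purposes: with weight 1 a law is recovered from its cosines, and with a weight depending on
    a second variable a factorisation over cosines becomes one over events. *)
Lemma cos_determines A : measurable A ->
  \int[P1]_w (\1_A (Z1 w) * xi1 w) = \int[P2]_w (\1_A (Z2 w) * xi2 w).
Proof.
pose D := [set A : set R | measurable A /\ same_int (\1_A)].
suff DM : measurable `<=` D by move=> /DM[_ []].
have dD : dynkin D.
  split.
  - split => //; have := same_trig (trig_cos 0 0).
    by congr same_int; apply/funext => x; rewrite mul0r add0r cos0 indicT.
  - move=> B [mB SB]; split; first exact: measurableC.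
    have := same_add (same_trig (trig_cos 0 0)) (same_scale (-1) SB).
    by congr same_int; apply/funext => x; rewrite mul0r add0r cos0 mulN1r !indicE in_setC; case: (x \in B) => /=; lra.
  - move=> F tF DF; have mF k : measurable (F k) by case: (DF k).
    split; first exact: bigcupT_measurable.
    apply: (@same_lim (fun n => \1_(\big[setU/set0]_(k < n) F k)) _ 1).
    + elim=> [|n IH].
        rewrite big_ord0; have := same_scale 0 (same_trig (trig_cos 0 0)).
        by congr same_int; apply/funext => x; rewrite mul0r indic0.
      have [_ Sn] := DF n; have := same_add IH Sn.
      congr same_int; apply/funext => x; rewrite big_ord_recr/= !indicE in_setU.
      have [xn|xn] := boolP (x \in F n); last by rewrite orbF addr0.
      rewrite orbT; suff -> : x \in \big[setU/set0]_(i < n) F i = false by rewrite add0r.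
      apply/negbTE/negP; rewrite inE -bigcup_mkord => -[k /= kn Fk].
      have := @trivIsetP _ _ setT F; rewrite inE in xn.
      move=> /proj1 /(_ tF k n I I); rewrite (ltn_eqF kn) => /(_ isT).
      by apply/eqP/set0P; exists x.
    + by move=> n x; rewrite indicE; case: (_ \in _); rewrite ?normr1 ?normr0.
    + move=> x; apply: cvg_near_cst.
      have [[k _ Fk]|xN] := pselect ((\bigcup_k F k) x).
        near=> n; rewrite !indicE !mem_set//; first by exists k.
        by rewrite -bigcup_mkord; exists k => //=; near: n; exact: nbhs_infty_gt.
      near=> n; rewrite !indicE !memNset//.
      by rewrite -bigcup_mkord => -[k _ Fk]; apply: xN; exists k.
have -> : (measurable : set (set R)) = <<s @RGenOInfty.G R >> by exact: RGenOInfty.measurableE.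
rewrite -setI_closed_g_dynkin_g_sigma_algebra.
  by apply: smallest_sub => // _ [x ->]; split; [exact: measurable_itv|exact: same_ray].
move=> _ _ [x ->] [y ->]; exists (Num.max x y).
by apply/seteqP; split => z/=; rewrite !in_itv/= !andbT gt_max => /andP.
Unshelve. all: by end_near. Qed.

End trig_determines.

(** * Independence of generated sigma-algebras *)

Section generated_independence.
Context {R : realType} {dO dT : measure_display} {O : measurableType dO}
  {T : measurableType dT} {I : choiceType} (P : probability O R) (X : I -> O -> T).
Hypothesis mX : forall j, measurable_fun setT (X j).
Hypothesis indepX : mutually_independent P X.
Implicit Types Q : set I.

(** [J] may contain indices outside [Q], where the constraint is trivial; two cylinders can thus be
    written over a common finite index set. *)
Definition cylinders Q : set (set O) :=
  [set A | exists (J : {fset I}) (B : I -> set T),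
     [/\ forall j, measurable (B j), forall j, ~ Q j -> B j = setT &
         A = \bigcap_(j in [set` J]) (X j @^-1` B j)]].

Lemma measurable_cylinders Q : cylinders Q `<=` measurable.
Proof.
move=> _ [J [B [mB _ ->]]]; apply: fin_bigcap_measurable => // j _.
by rewrite -[X in measurable X]setTI; exact: mX.
Qed.

Lemma cylinders_setT Q : cylinders Q setT.
Proof. by exists fset0, (fun=> setT); split => //; apply/seteqP; split. Qed.

Lemma cylinders_preimage Q j (B : set T) : Q j -> measurable B -> cylinders Q (X j @^-1` B).
Proof.
move=> Qj mB; exists [fset j]%fset, (fun k => if k == j then B else setT); split.
- by move=> k; case: ifP.
- by move=> k; case: eqP => // ->.
- apply/seteqP; split => [w Bw k /=|w /(_ j)]; first by rewrite inE => /eqP ->; rewrite eqxx; exact: Bw.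
  by rewrite /= inE !eqxx; apply.
Qed.

Let ext (J : {fset I}) (B : I -> set T) j := if j \in J then B j else setT.

Let capE (J K : {fset I}) (B : I -> set T) : (J `<=` K)%fset ->
  \bigcap_(j in [set` J]) (X j @^-1` B j) = \bigcap_(j in [set` K]) (X j @^-1` ext J B j).
Proof.
move=> /fsubsetP JK; apply/seteqP; split => w Hw j /=.
  by move=> jK; rewrite /ext; case: ifPn => // jJ; exact: Hw.
by move=> jJ; have := Hw j (JK _ jJ); rewrite /ext jJ.
Qed.

Lemma setI_closed_cylinders Q : setI_closed (cylinders Q).
Proof.
move=> _ _ [J1 [B1 [m1 Q1 ->]]] [J2 [B2 [m2 Q2 ->]]].
exists (J1 `|` J2)%fset, (fun j => ext J1 B1 j `&` ext J2 B2 j); split.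
- by move=> j; rewrite /ext; apply: measurableI; case: ifP.
- by move=> j nQ; rewrite /ext Q1// Q2//; case: ifP; case: ifP; rewrite setTI.
- rewrite (@capE J1 (J1 `|` J2)%fset) ?fsubsetUl// (@capE J2 (J1 `|` J2)%fset) ?fsubsetUr//.
  apply/seteqP; split => [w [h1 h2] j jJ|w h].
    by split; [exact: h1|exact: h2].
  by split => j jJ; have [] := h j jJ.
Qed.

Let cylinders_indep Q1 Q2 A B : (forall j, Q1 j -> ~ Q2 j) ->
  cylinders Q1 A -> cylinders Q2 B -> (P (A `&` B) = P A * P B)%E.
Proof.
move=> Q12 [J1 [B1 [m1 Q1B ->]]] [J2 [B2 [m2 Q2B ->]]].
rewrite (@capE J1 (J1 `|` J2)%fset) ?fsubsetUl// (@capE J2 (J1 `|` J2)%fset) ?fsubsetUr//.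
set J := (J1 `|` J2)%fset; set C1 := ext J1 B1; set C2 := ext J2 B2.
have mC1 j : measurable (C1 j) by rewrite /C1 /ext; case: ifP.
have mC2 j : measurable (C2 j) by rewrite /C2 /ext; case: ifP.
have -> : \bigcap_(j in [set` J]) (X j @^-1` C1 j) `&` \bigcap_(j in [set` J]) (X j @^-1` C2 j) =
   \bigcap_(j in [set` J]) (X j @^-1` (C1 j `&` C2 j)).
  apply/seteqP; split => [w [h1 h2] j jJ|w h].
    by split; [exact: h1|exact: h2].
  by split => j jJ; have [] := h j jJ.
rewrite !indepX//; last by move=> j; exact: measurableI.
rewrite -EFinM -big_split/=; congr (_%:E); apply: eq_bigr => j _.
have [Qj|nQ] := pselect (Q1 j).
  have -> : C2 j = setT by rewrite /C2 /ext Q2B ?if_same//; exact: Q12.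
  by rewrite setIT preimage_setT probability_setT mulr1.
have -> : C1 j = setT by rewrite /C1 /ext Q1B ?if_same.
by rewrite setTI preimage_setT probability_setT mul1r.
Qed.

Lemma measurable_sigma_cylinders Q A : <<s cylinders Q >> A -> measurable A.
Proof. by apply: smallest_sub; [exact: sigma_algebra_measurable|exact: measurable_cylinders]. Qed.

(** As functions of [A] both sides are finite measures, a restriction and a multiple of [P], so
    agreement on the pi-system [G] is enough. *)
Let mproduct (B : set O) (mB : measurable B) (c : {nonneg R}) A G :
  setI_closed G -> G `<=` measurable -> G setT -> (forall A, G A -> (P (A `&` B) = c%:num%:E * P A)%E) ->
  <<s G >> A -> (P (A `&` B) = c%:num%:E * P A)%E.
Proof.
move=> GI Gm GT H sA.
have := @g_sigma_algebra_measure_unique _ R O G Gm (fun=> setT) (fun=> GT) _ (mrestr P mB) (mscale c P) GI H _ A sA.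
apply; first by rewrite bigcup_const//; exists 0%N.
by move=> _; apply: (le_lt_trans (@probability_le1 _ _ _ P _ _)); rewrite ?ltry//; exact: measurableI.
Qed.

(** Two extension passes: the first factor goes from cylinders to the generated sigma-algebra
    against a fixed cylinder, then the second factor does so against a fixed event of the first
    sigma-algebra. *)
Lemma sigma_cylinders_indep Q1 Q2 A B : (forall j, Q1 j -> ~ Q2 j) ->
  <<s cylinders Q1 >> A -> <<s cylinders Q2 >> B -> (P (A `&` B) = P A * P B)%E.
Proof.
move=> Q12 sA sB.
have fE (C : set O) : measurable C -> (fine (P C))%:E = P C.
  by move=> mC; rewrite fineK// fin_num_measure.
have c0 (C : set O) : 0 <= fine (P C) by exact: fine_ge0.
have mA := measurable_sigma_cylinders sA; have mB := measurable_sigma_cylinders sB.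
have step C : cylinders Q2 C -> (P (A `&` C) = P C * P A)%E.
  move=> QC; have mC := measurable_cylinders QC.
  rewrite -[P C]fE// -[fine _]/((NngNum (c0 C))%:num).
  apply: (@mproduct C mC _ A (cylinders Q1)) => //.
  - exact: setI_closed_cylinders.
  - exact: measurable_cylinders.
  - exact: cylinders_setT.
  - by move=> D QD; rewrite (cylinders_indep Q12 QD QC) muleC; congr (_ * _)%E; rewrite -[LHS]fE.
rewrite setIC -[P A]fE// -[fine _]/((NngNum (c0 A))%:num).
apply: (@mproduct A mA _ B (cylinders Q2)) => //.
- exact: setI_closed_cylinders.
- exact: measurable_cylinders.
- exact: cylinders_setT.
- by move=> D QD; rewrite setIC step// muleC; congr (_ * _)%E; rewrite -[LHS]fE.
Qed.

Definition measurable_wrt Q (f : O -> R) :=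
  @measurable_fun _ _ (g_sigma_algebraType (cylinders Q)) R setT f.

Lemma measurable_wrt_preimage Q f B : measurable_wrt Q f -> measurable B ->
  <<s cylinders Q >> (f @^-1` B).
Proof. by move=> mf mB; rewrite -[_ @^-1` _]setTI; exact: mf. Qed.

Lemma measurable_wrtT Q f : measurable_wrt Q f -> measurable_fun setT f.
Proof.
move=> mf _ B mB; rewrite setTI; apply: (@measurable_sigma_cylinders Q).
exact: measurable_wrt_preimage.
Qed.

Lemma measurable_wrt_comp Q (g : T -> R) j : Q j -> measurable_fun setT g ->
  measurable_wrt Q (fun w => g (X j w)).
Proof.
move=> Qj mg _ B mB; rewrite setTI; apply: sub_gen_smallest.
rewrite (_ : _ @^-1` _ = X j @^-1` (g @^-1` B))//; apply: cylinders_preimage => //.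
by rewrite -[_ @^-1` _]setTI; exact: mg.
Qed.

End generated_independence.

(** * Freezing an independent variable; shifts and tails of normal laws *)

Section independent_pair.
Context {R : realType} {dO dT : measure_display} {O : measurableType dO}
  {T : measurableType dT} (P : probability O R).

(** Independence makes the law of [(W, Z)] a product measure, so [W] may be frozen. [T] is left
    general because [W] will also stand for a whole sigma-algebra of the past. *)
Lemma indep_pair_integral (W : O -> T) (Z : O -> R) (nu : probability (measurableTypeR R) R) (S : set (T * measurableTypeR R)) :
  measurable_fun setT W -> measurable_fun setT Z ->
  (forall A, measurable A -> P (Z @^-1` A) = nu A) ->
  (forall A B, measurable A -> measurable B ->
     (P (W @^-1` B `&` Z @^-1` A) = P (W @^-1` B) * P (Z @^-1` A))%E) ->
  measurable S ->
  (P [set w | S (W w, Z w)] = \int[P]_w nu (xsection S (W w)))%E.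
Proof.
move=> mW mZ lZ ind mS.
pose W' : {mfun O >-> T} := HB.pack W (isMeasurableFun.Build _ _ _ _ W mW).
have mZ' : @measurable_fun _ _ O (measurableTypeR R) setT Z by exact: mZ.
have mWZ : @measurable_fun _ _ O (T * measurableTypeR R)%type setT (fun w => (W w, Z w)).
  exact: measurable_fun_pair.
pose WZ : {mfun O >-> (T * measurableTypeR R)%type} := HB.pack (fun w => (W w, Z w)) (isMeasurableFun.Build _ _ _ _ _ mWZ).
have := @product_measure_unique _ _ T (measurableTypeR R) R (distribution P W') nu (distribution P WZ) _ S mS.
rewrite /= /distribution /= /pushforward => <-.
  rewrite /product_measure1 /= ge0_integral_pushforward//.
  exact: measurable_fun_xsection.
move=> B A mB mA; rewrite -lZ// -ind//.
Qed.

End independent_pair.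

Section normal_shift.
Context {R : realType}.
Local Notation mu := (@lebesgue_measure R).

Lemma normal_prob_shift (v s : R) (A : set R) : measurable A -> s != 0 ->
  normal_prob 0 s [set z | A (z + v)] = normal_prob v s A.
Proof.
move=> mA s0.
have mshift : @measurable_fun _ _ (measurableTypeR R) (measurableTypeR R) setT (fun z : R => z + v).
  exact: (@measurable_funD _ _ R setT id (cst v)).
pose sh : {mfun (measurableTypeR R) >-> (measurableTypeR R)} := HB.pack (fun z : R => z + v) (isMeasurableFun.Build _ _ _ _ _ mshift).
(* The two laws are compared on the rays [[x, +oo[] only, where a change of variable applies. *)
apply: esym; apply: (@measure_unique _ R (measurableTypeR R) (@RGenCInfty.G R) (fun n => `[- n%:R, +oo[%classic) (RGenCInfty.measurableE R) _ _ _ (normal_prob v s) (distribution (normal_prob 0 s) sh) _ _ A mA).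
- move=> _ _ [x ->] [y ->]; exists (Num.max x y).
  by apply/seteqP; split => z/=; rewrite !in_itv/= !andbT ge_max => /andP.
- by move=> n; exists (- n%:R).
- apply/seteqP; split => // x _; exists (Num.truncn `|x|).+1 => //=.
  rewrite in_itv/= andbT lerNl (le_trans (ler_norm _))// normrN.
  by rewrite ltW// truncnS_gt.
- move=> _ [x ->].
  rewrite /distribution /pushforward /= /normal_prob.
  have -> : sh @^-1` `[x, +oo[ = `[x - v, +oo[%classic.
    by apply/seteqP; split => z/=; rewrite !in_itv/= !andbT lerBlDr.
  have dF (z : R) : is_derive z 1 (fun z : R => z + v) (1 : R).
    rewrite (_ : (fun z => _) = id + cst v)//.
    by apply: is_derive_eq; rewrite addr0.
  have F'E : (fun z : R => z + v)^`()%classic = cst 1.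
    by apply/funext => z; rewrite derive1E; have [_ ->] := dF z.
  have := @increasing_ge0_integration_by_substitutiony R (fun z => z + v) (normal_pdf v s) (x - v).
  rewrite subrK => ->.
  + apply: eq_integral => z _; rewrite F'E /= !fctE /= mulr1 !normal_pdfE//.
    by rewrite /normal_fun addrK subr0.
  + by move=> y z _ _ yz; rewrite ltrD2r.
  + by rewrite F'E => y _; exact: cvg_cst.
  + by rewrite F'E; exact: is_cvg_cst.
  + by rewrite F'E; exact: is_cvg_cst.
  + split; first by move=> y _; have [] := dF y.
    by apply: cvg_at_right_filter; apply: cvgD; [exact: cvg_id|exact: cvg_cst].
  + exact: cvg_addrr.
  + exact/continuous_subspaceT/continuous_normal_pdf.
  + by move=> y _; exact: normal_pdf_ge0.
- by move=> k; rewrite (le_lt_trans (@probability_le1 _ _ _ (normal_prob v s) _ _))// ltry.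
Qed.

End normal_shift.

Section normal_bounds.
Context {R : realType}.
Local Notation mu := (@lebesgue_measure R).
Implicit Types (m s c r x y z : R) (A G : set R).

Lemma normal_prob_le m s m' s' c A : measurable A -> 0 <= c ->
  (forall x, A x -> normal_pdf m s x <= c * normal_pdf m' s' x) ->
  (normal_prob m s A <= c%:E * normal_prob m' s' A)%E.
Proof.
move=> mA c0 H; rewrite /normal_prob -ge0_integralZl//; last 2 first.
- by apply: measurable_funTS; apply/measurable_EFinP; exact: measurable_normal_pdf.
- by move=> x _; rewrite lee_fin normal_pdf_ge0.
apply: ge0_le_integral => //.
- by move=> x _; rewrite lee_fin normal_pdf_ge0.
- by apply: measurable_funTS; apply/measurable_EFinP; exact: measurable_normal_pdf.
- apply: measurable_funeM; apply: measurable_funTS; apply/measurable_EFinP; exact: measurable_normal_pdf.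
Qed.

Lemma measurable_norm_gt r : measurable [set x : R | r < `|x|].
Proof.
rewrite -[X in measurable X]setTI -[X in _ `&` X]/((fun x : R => `|x|) @^-1` [set y | r < y]).
rewrite (_ : [set y | r < y] = `]r, +oo[%classic).
  exact: (@normr_measurable R setT).
by apply/seteqP; split => y /=; rewrite in_itv/= andbT.
Qed.

Lemma measurable_norm_le r : measurable [set x : R | `|x| <= r].
Proof.
rewrite (_ : [set x | _] = ~` [set x : R | r < `|x|]); first by apply: measurableC; exact: measurable_norm_gt.
by apply/seteqP; split => x/=; rewrite leNgt => /negP.
Qed.

Lemma normal_peak_le s s' : 0 < s -> s <= s' -> normal_peak s' <= normal_peak s.
Proof.
move=> s0 ss'; have s'0 : 0 < s' by exact: lt_le_trans ss'.
have pos (u : R) : 0 < u -> 0 < u ^+ 2 * pi *+ 2.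
  by move=> u0; rewrite pmulrn_lgt0// mulr_gt0 ?pi_gt0// exprn_gt0.
rewrite /normal_peak lef_pV2 ?posrE ?sqrtr_gt0; [|exact: pos|exact: pos].
by rewrite ler_wsqrtr// lerMn2r/= ler_pM2r ?pi_gt0// ler_pXn2r// nnegrE ltW.
Qed.

(** Exponential tilting: for [x > r], [x^2 >= r^2 + (x - r)^2], so the centred density is at most
    [exp (- r^2 / (2 s^2))] times the density centred at [r], whose mass is at most 1. The factor 2
    counts the two sides. *)
Lemma normal_tail s r : 0 < s -> 0 <= r ->
  (normal_prob 0 s [set x | (r < `|x|)%R] <= (2 * expR (- (r ^+ 2 / (2 * s ^+ 2))))%:E)%E.
Proof.
move=> s0 r0; set e := expR _.
have e0 : 0 <= e by exact: expR_ge0.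
have sn0 : s != 0 by rewrite gt_eqF.
have s2 : 0 < (2 * s ^+ 2)^-1 by rewrite invr_gt0 mulr_gt0// exprn_gt0.
pose A1 := [set x : R | r < x]; pose A2 := [set x : R | x < - r].
have mA1 : measurable A1.
  rewrite (_ : A1 = `]r, +oo[%classic)//; by apply/seteqP; split => y /=; rewrite in_itv/= andbT.
have mA2 : measurable A2.
  rewrite (_ : A2 = `]-oo, (- r)[%classic)//; by apply/seteqP; split => y /=; rewrite in_itv/=.
have half m A : measurable A -> (forall x, A x -> normal_pdf 0 s x <= e * normal_pdf m s x) ->
    (normal_prob 0 s A <= e%:E)%E.
  move=> mA H; apply: (le_trans (normal_prob_le mA e0 H)).
  rewrite -[leRHS]mule1; apply: lee_wpmul2l; rewrite ?lee_fin//.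
  exact: (@probability_le1 _ _ _ (normal_prob m s)).
have -> : [set x : R | r < `|x|] = A1 `|` A2.
  apply/seteqP; split => x /=; rewrite lter_normr /A1 /A2 /= ltrNr.
    by move=> /orP.
  by move=> ?; apply/orP.
apply: (@le_trans _ _ (normal_prob 0 s A1 + normal_prob 0 s A2)%E).
  exact: (@measureU2 _ _ _ (normal_prob 0 s)).
rewrite mulrDl mul1r EFinD; apply: leeD.
- apply: (half r) => // x rx; rewrite !normal_pdfE// mulrCA ler_wpM2l ?normal_peak_ge0//.
  rewrite /normal_fun /e -expRD ler_expR -mulr_natl !mulNr -opprD lerN2 -mulrDl ler_pM2r//.
  by rewrite /A1/= in rx; nra.
- apply: (half (- r)) => // x rx; rewrite !normal_pdfE// mulrCA ler_wpM2l ?normal_peak_ge0//.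
  rewrite /normal_fun /e -expRD ler_expR -mulr_natl !mulNr -opprD lerN2 -mulrDl ler_pM2r//.
  by rewrite /A2/= in rx; nra.
Qed.

(** When the variance grows to [t^2], a set of given standard mass gains no more, up to a constant,
    than a tail does. On [|x| <= r] the density ratio is at most [exp (r^2 / 2 - r^2 / (2 t^2))],
    and beyond [r] the tail bound applies; hence [3 = 1 + 2]. *)
Lemma normal_tilt t r A : measurable A -> 1 <= t -> 0 <= r ->
  (normal_prob 0 1 A <= (expR (- (r ^+ 2 / 2)))%:E ->
   normal_prob 0 t A <= (3 * expR (- (r ^+ 2 / (2 * t ^+ 2))))%:E)%E.
Proof.
move=> mA t1 r0 pA.
have t0 : 0 < t by exact: lt_le_trans t1.
have tn0 : t != 0 by rewrite gt_eqF.
pose In := A `&` [set x | `|x| <= r]; pose Out := A `&` [set x | r < `|x|].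
have mIn : measurable In by apply: measurableI => //; exact: measurable_norm_le.
have mOut : measurable Out by apply: measurableI => //; exact: measurable_norm_gt.
have -> : A = In `|` Out.
  rewrite -setIUr -[LHS]setIT; congr (_ `&` _); apply/seteqP; split => // x _ /=.
  by case: (leP `|x| r); [left|right].
apply: (@le_trans _ _ (normal_prob 0 t In + normal_prob 0 t Out)%E).
  exact: (@measureU2 _ _ _ (normal_prob 0 t)).
rewrite (_ : 3 = 1 + 2)// mulrDl mul1r EFinD; apply: leeD; last first.
  apply: le_trans (normal_tail t0 r0).
  apply: (@le_measure _ _ _ (normal_prob 0 t)); rewrite ?inE//; last by move=> x [].
  exact: measurable_norm_gt.
set k := expR (r ^+ 2 / 2 - r ^+ 2 / (2 * t ^+ 2)).
apply: (@le_trans _ _ (k%:E * normal_prob 0 1 In)%E).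
  apply: normal_prob_le; rewrite ?expR_ge0// => x [_ /= xr].
  rewrite !normal_pdfE ?oner_eq0// mulrCA.
  apply: ler_pM; rewrite ?normal_peak_ge0 ?normal_fun_ge0 ?normal_peak_le//.
  rewrite /normal_fun /k -expRD ler_expR !subr0 expr1n.
  have x2 : x ^+ 2 <= r ^+ 2 by rewrite -(real_normK (num_real x)) ler_pXn2r ?nnegrE.
  have ti : (t ^+ 2)^-1 <= 1 by rewrite invf_le1 ?exprn_gt0// -[1](expr1n _ 2) ler_pXn2r ?nnegrE// ltW.
  rewrite -subr_ge0 (_ : _ - _ = (r ^+ 2 - x ^+ 2) * (1 - (t ^+ 2)^-1) / 2); last by field.
  by rewrite divr_ge0// mulr_ge0// subr_ge0.
apply: (@le_trans _ _ (k%:E * (expR (- (r ^+ 2 / 2)))%:E)%E).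
  apply: lee_wpmul2l; first by rewrite lee_fin expR_ge0.
  apply: le_trans pA.
  by apply: (@le_measure _ _ _ (normal_prob 0 1)); rewrite ?inE//; move=> x [].
by rewrite -EFinM /k -expRD addrAC subrr add0r.
Qed.

End normal_bounds.

(** * Two-point bounds and mixing for Gaussian variables *)

Section gaussian_pair.
Context {R : realType}.

(* A correlated Gaussian density is dominated by a product of wider ones:
   x^2 - 2 rho x y + y^2 >= (1 - |rho|) (x^2 + y^2). *)
Lemma gaussian_pair_density (rho rho0 s t x y : R) : `|rho| <= rho0 -> rho0 < 1 ->
  s = Num.sqrt (1 - rho ^+ 2) -> t = Num.sqrt (1 + rho0) ->
  normal_pdf (rho * y) s x * normal_pdf 0 1 y <=
  (normal_peak (Num.sqrt (1 - rho0 ^+ 2)) * normal_peak 1 / normal_peak t ^+ 2) *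
    (normal_pdf 0 t x * normal_pdf 0 t y).
Proof.
move=> r0 r1 sE tE.
have r00 : 0 <= rho0 by exact: le_trans r0.
have rr : rho ^+ 2 <= rho0 ^+ 2 by rewrite -(real_normK (num_real rho)) ler_pXn2r ?nnegrE.
have r2 : rho0 ^+ 2 < 1 by rewrite expr_lt1.
have s2 : s ^+ 2 = 1 - rho ^+ 2 by rewrite sE sqr_sqrtr//; lra.
have t2 : t ^+ 2 = 1 + rho0 by rewrite tE sqr_sqrtr//; lra.
have s0 : 0 < s by rewrite sE sqrtr_gt0; lra.
have t0 : 0 < t by rewrite tE sqrtr_gt0; lra.
have S0 : 0 < Num.sqrt (1 - rho0 ^+ 2) by rewrite sqrtr_gt0; lra.
rewrite !normal_pdfE ?oner_eq0 ?gt_eqF//.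
have tp : normal_peak t != 0 by rewrite gt_eqF// normal_peak_gt0// gt_eqF.
rewrite mulrACA (_ : _ / _ * _ = normal_peak (Num.sqrt (1 - rho0 ^+ 2)) * normal_peak 1 *
  (normal_fun 0 t x * normal_fun 0 t y)); last by field.
apply: ler_pM; rewrite ?mulr_ge0 ?normal_peak_ge0 ?normal_fun_ge0//.
  rewrite ler_wpM2r ?normal_peak_ge0//; apply: normal_peak_le => //.
  by rewrite sE ler_wsqrtr//; lra.
rewrite /normal_fun -!expRD ler_expR !subr0 s2 t2 expr1n -subr_ge0.
have d1 : 0 < 1 - rho ^+ 2 by lra.
have d2 : 0 < 1 + rho0 by lra.
rewrite (_ : _ - _ = ((x ^+ 2 - 2 * rho * x * y + y ^+ 2) * (1 + rho0) - (x ^+ 2 + y ^+ 2) * (1 - rho ^+ 2)) / (2 * (1 - rho ^+ 2) * (1 + rho0))); last by field; rewrite !gt_eqF.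
apply: divr_ge0; last by rewrite !mulr_ge0// ltW.
have /andP[h1 h2] : - rho0 <= rho <= rho0 by rewrite -ler_norml.
have X : 0 <= x ^+ 2 by exact: sqr_ge0.
have Y : 0 <= y ^+ 2 by exact: sqr_ge0.
pose q := `|rho|.
have q2 : rho ^+ 2 = q ^+ 2 by rewrite /q real_normK ?num_real.
have q0 : 0 <= q by exact: normr_ge0.
have xy : 2 * rho * x * y <= q * (x ^+ 2 + y ^+ 2).
  have : 2 * rho * x * y <= `|2 * rho * x * y| by exact: ler_norm.
  move/le_trans; apply; rewrite !normrM (ger0_norm (ler0n _ 2)) -/q.
  have : 0 <= (`|x| - `|y|) ^+ 2 by exact: sqr_ge0.
  rewrite sqrrB !real_normK ?num_real// => H.
  have : 0 <= q * (x ^+ 2 - (`|x| * `|y|) *+ 2 + y ^+ 2) by rewrite mulr_ge0.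
  by rewrite -mulr_natr; lra.
have l1 : (1 - q) * (x ^+ 2 + y ^+ 2) <= x ^+ 2 - 2 * rho * x * y + y ^+ 2 by lra.
have l2 : (1 - q) * (x ^+ 2 + y ^+ 2) * (1 + rho0) <= (x ^+ 2 - 2 * rho * x * y + y ^+ 2) * (1 + rho0).
  by rewrite ler_pM2r.
rewrite subr_ge0; apply: le_trans l2.
rewrite q2 (_ : 1 - q ^+ 2 = (1 - q) * (1 + q)); last by ring.
rewrite (_ : (x ^+ 2 + y ^+ 2) * _ = ((1 - q) * (x ^+ 2 + y ^+ 2)) * (1 + q)); last by ring.
have hq : q <= rho0 by exact: r0.
rewrite ler_wpM2l//; last by rewrite lerD2l.
by apply: mulr_ge0; [lra|exact: addr_ge0].
Qed.

Lemma normal_probZ (c m s : R) (A : set R) : measurable A -> 0 <= c ->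
  (c%:E * normal_prob m s A =
   \int[lebesgue_measure]_(x in A) (c%:E * (normal_pdf m s x)%:E))%E.
Proof.
move=> mA c0; rewrite /normal_prob ge0_integralZl//.
- by apply: measurable_funTS; apply/measurable_EFinP; exact: measurable_normal_pdf.
- by move=> x _; rewrite lee_fin normal_pdf_ge0.
Qed.

Context {dO : measure_display} {O : measurableType dO} (P : probability O R).

Lemma ge0_integral_law (Y : O -> R) (nu : probability (measurableTypeR R) R) (f : R -> \bar R) :
  measurable_fun setT Y -> (forall B, measurable B -> P (Y @^-1` B) = nu B) ->
  measurable_fun setT f -> (forall y, 0 <= f y)%E ->
  (\int[P]_w f (Y w) = \int[nu]_y f y)%E.
Proof.
move=> mY lY mf f0.
pose Y' : {mfun O >-> measurableTypeR R} :=
  HB.pack Y (isMeasurableFun.Build dO _ O (measurableTypeR R) Y mY).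
rewrite -[LHS](@ge0_integral_distribution _ _ _ (measurableTypeR R) _ P Y' f mf f0).
by apply: eq_measure_integral => B mB _; exact: lY.
Qed.

(** The conditional density given [Y = y], times the density of [Y], is dominated by a product of
    normal densities of variance [t^2 = 1 + rho0]. The integral then factorises, and [normal_tilt]
    bounds each factor by [3 exp (- r^2 / (2 t^2))]. *)
Lemma gaussian_pair_bound (rho rho0 r : R) (Y Z : O -> R) (A G : set R) :
  `|rho| <= rho0 -> rho0 < 1 -> 0 <= r ->
  measurable_fun setT Y -> measurable_fun setT Z -> measurable A -> measurable G ->
  (forall B, measurable B -> P (Y @^-1` B) = normal_prob 0 1 B) ->
  (forall B, measurable B -> P (Z @^-1` B) = normal_prob 0 (Num.sqrt (1 - rho ^+ 2)) B) ->
  (forall A B, measurable A -> measurable B ->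
     (P (Y @^-1` B `&` Z @^-1` A) = P (Y @^-1` B) * P (Z @^-1` A))%E) ->
  (normal_prob 0 1 A <= (expR (- (r ^+ 2 / 2)))%:E)%E ->
  (normal_prob 0 1 G <= (expR (- (r ^+ 2 / 2)))%:E)%E ->
  (P [set w | A (Z w + rho * Y w)%R /\ G (Y w)] <=
    (9 * (normal_peak (Num.sqrt (1 - rho0 ^+ 2)) * normal_peak 1 / normal_peak (Num.sqrt (1 + rho0)) ^+ 2)
     * expR (- (r ^+ 2 / (1 + rho0))))%:E)%E.
Proof.
move=> rr0 r01 r0 mY mZ mA mG lY lZ ind pA pG.
set s := Num.sqrt (1 - rho ^+ 2) in lZ *; set t := Num.sqrt (1 + rho0).
set C := _ / _ ^+ 2.
have r00 : 0 <= rho0 by exact: le_trans rr0.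
have rr : rho ^+ 2 <= rho0 ^+ 2 by rewrite -(real_normK (num_real rho)) ler_pXn2r ?nnegrE.
have r2 : rho0 ^+ 2 < 1 by rewrite expr_lt1.
have s0 : s != 0 by rewrite gt_eqF// /s sqrtr_gt0; lra.
have t1 : 1 <= t by rewrite /t -{1}(sqrtr1) ler_wsqrtr//; lra.
have t2 : t ^+ 2 = 1 + rho0 by rewrite /t sqr_sqrtr//; lra.
have C0 : 0 <= C by rewrite divr_ge0 ?mulr_ge0 ?normal_peak_ge0 ?exprn_ge0 ?normal_peak_ge0.
pose S := [set q : measurableTypeR R * measurableTypeR R | A (q.2 + rho * q.1) /\ G q.1].
have mS : measurable S.
  apply: (@measurableI _ _ [set q : measurableTypeR R * measurableTypeR R | A (q.2 + rho * q.1)] [set q | G q.1]).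
    rewrite -[X in measurable X]setTI.
    have mf : measurable_fun setT (fun q : measurableTypeR R * measurableTypeR R => (q.2 : R) + rho * (q.1 : R)).
      apply: measurable_funD; first exact: measurable_snd.
      by apply: measurable_funM => //; exact: measurable_fst.
    by apply: mf.
  rewrite -[X in measurable X]setTI.
  by apply: (@measurable_fst _ _ (measurableTypeR R) (measurableTypeR R)).
have -> : [set w | A (Z w + rho * Y w) /\ G (Y w)] = [set w | S (Y w, Z w)] by [].
rewrite (indep_pair_integral (W := Y) mY mZ lZ ind mS).
have secE y : xsection S y = if y \in G then [set z | A (z + rho * y)] else set0.
  apply/seteqP; split => z; rewrite /xsection /=.
    by move=> /set_mem[Az Gy]; rewrite mem_set.
  by case: ifPn => // yG Az; apply/mem_set; split => //; exact: set_mem yG.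
have mf : measurable_fun setT (fun y : R => normal_prob 0 s (xsection S y)).
  exact: (@measurable_fun_xsection _ _ (measurableTypeR R) (measurableTypeR R) R (normal_prob 0 s)).
rewrite (@ge0_integral_law Y (normal_prob 0 1) (fun y => normal_prob 0 s (xsection S y)))//.
rewrite ge0_integral_normal_prob//.
pose NA := normal_prob 0 t A.
have NAf : NA \is a fin_num by exact: fin_num_measure.
have mg : measurable_fun setT (fun y : R => (C * fine NA)%:E * (normal_pdf 0 t y)%:E)%E.
  by apply: measurable_funeM; apply/measurable_EFinP; exact: measurable_normal_pdf.
apply: (@le_trans _ _ (\int[lebesgue_measure]_(y in G) ((C * fine NA)%:E * (normal_pdf 0 t y)%:E))%E).
  rewrite [leRHS]integral_mkcond; apply: ge0_le_integral => //.
  - by move=> y _; rewrite mule_ge0// lee_fin normal_pdf_ge0.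
  - apply: emeasurable_funM => //; apply/measurable_EFinP; exact: measurable_normal_pdf.
  - exact: ((measurable_restrictT _ mG).1 (measurable_funTS mg)).
  move=> y _; rewrite /patch secE; case: ifPn => yG; last by rewrite measure0 mul0e.
  rewrite normal_prob_shift//.
  have H : (normal_prob (rho * y) s A * (normal_pdf 0 1 y)%:E <= (C * normal_pdf 0 t y)%:E * NA)%E.
    have Cp0 : 0 <= C * normal_pdf 0 t y by rewrite mulr_ge0 ?normal_pdf_ge0.
    rewrite /NA (normal_probZ 0 t mA Cp0) muleC (normal_probZ (rho * y) s mA (normal_pdf_ge0 0 1 y)).
    apply: ge0_le_integral => //.
    - by move=> x _; rewrite mule_ge0 ?lee_fin ?normal_pdf_ge0.
    - by apply: measurable_funeM; apply: measurable_funTS; apply/measurable_EFinP; exact: measurable_normal_pdf.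
    - by apply: measurable_funeM; apply: measurable_funTS; apply/measurable_EFinP; exact: measurable_normal_pdf.
    move=> x _; rewrite -!EFinM lee_fin mulrC.
    have := gaussian_pair_density x y rr0 r01 (erefl s) (erefl t).
    by rewrite -/C; lra.
  apply: (le_trans H); rewrite -[NA in leLHS]fineK// -!EFinM lee_fin; lra.
have NA0 : 0 <= fine NA by apply: fine_ge0; exact: (@measure_ge0 _ _ _ (normal_prob 0 t)).
have NG0 : 0 <= fine (normal_prob 0 t G) by apply: fine_ge0; exact: (@measure_ge0 _ _ _ (normal_prob 0 t)).
have CN0 : 0 <= C * fine NA by rewrite mulr_ge0.
rewrite -(normal_probZ 0 t mG CN0).
have tA := normal_tilt mA t1 r0 pA; have tG := normal_tilt mG t1 r0 pG.
have NGf : normal_prob 0 t G \is a fin_num by exact: fin_num_measure.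
rewrite -[normal_prob 0 t G]fineK// -EFinM lee_fin.
have eA : fine NA <= 3 * expR (- (r ^+ 2 / (2 * t ^+ 2))) by rewrite -lee_fin fineK.
have eG : fine (normal_prob 0 t G) <= 3 * expR (- (r ^+ 2 / (2 * t ^+ 2))) by rewrite -lee_fin fineK.
have -> : expR (- (r ^+ 2 / (1 + rho0))) = expR (- (r ^+ 2 / (2 * t ^+ 2))) * expR (- (r ^+ 2 / (2 * t ^+ 2))).
  by rewrite -expRD t2; congr expR; field; rewrite gt_eqF//; lra.
set e := expR _ in eA eG *.
rewrite (_ : 9 * C * (e * e) = C * ((3 * e) * (3 * e))); last by ring.
by apply: le_trans (ler_wpM2l C0 (ler_pM NA0 NG0 eA eG)); rewrite [leRHS]mulrA.
Qed.

End gaussian_pair.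

Section gaussian_mixing.
Context {R : realType}.

(* Only a lower bound on the density ratio is needed: applied to an event and
   to its complement it controls the dependence in both directions. *)
Lemma normal_pdf_shift_lower (v r del x z : R) : 0 <= v -> v ^+ 2 <= 2^-1 ->
  0 <= r -> 0 <= del -> `|x| <= r -> `|z| <= del ->
  (1 - (r ^+ 2 * v ^+ 2 + 2 * r * del + del ^+ 2)) * normal_pdf 0 1 x <=
  normal_pdf z (Num.sqrt (1 - v ^+ 2)) x.
Proof.
move=> v0 v2 r0 d0 xr zd; set s := Num.sqrt _; set eta := _ + del ^+ 2.
have v20 : 0 <= v ^+ 2 by exact: sqr_ge0.
have s2 : s ^+ 2 = 1 - v ^+ 2 by rewrite sqr_sqrtr//; lra.
have s0 : 0 < s by rewrite sqrtr_gt0; lra.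
have s1 : s <= 1 by rewrite /s -[leRHS]sqrtr1 ler_wsqrtr//; lra.
rewrite !normal_pdfE ?oner_eq0 ?gt_eqF// mulrCA.
apply: (@le_trans _ _ (normal_peak 1 * normal_fun z s x)); last first.
  by rewrite ler_wpM2r ?normal_fun_ge0// normal_peak_le.
rewrite ler_wpM2l ?normal_peak_ge0//.
have x2 : x ^+ 2 <= r ^+ 2 by rewrite -(real_normK (num_real x)) ler_pXn2r ?nnegrE.
have z2 : z ^+ 2 <= del ^+ 2 by rewrite -(real_normK (num_real z)) ler_pXn2r ?nnegrE.
have xz : - (x * z) <= r * del.
  rewrite (le_trans (ler_norm _))// normrN normrM; exact: ler_pM.
have E : 1 - eta <= expR (- eta) by have := expR_ge1Dx (- eta).
apply: (@le_trans _ _ (expR (- eta) * normal_fun 0 1 x)).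
  by rewrite ler_wpM2r ?normal_fun_ge0.
rewrite /normal_fun -expRD ler_expR subr0 s2 expr1n.
have d1 : 0 < 1 - v ^+ 2 by lra.
(* This compares the two exponents, cleared of denominators. Since [v^2 <= 1/2], at least [eta] is
   left of [2 * eta * (1 - v^2)], and it pays for [x^2 v^2], the cross term and [z^2]. *)
have K : (x - z) ^+ 2 <= (x ^+ 2 + 2 * eta) * (1 - v ^+ 2).
  have h1 : x ^+ 2 * v ^+ 2 <= r ^+ 2 * v ^+ 2 by rewrite ler_wpM2r.
  have eta0 : 0 <= eta by rewrite /eta !addr_ge0 ?mulr_ge0 ?sqr_ge0.
  have h2 : eta <= 2 * eta * (1 - v ^+ 2).
    have : 0 <= eta * (1 - 2 * v ^+ 2) by rewrite mulr_ge0//; lra.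
    by lra.
  have h3 : x ^+ 2 * v ^+ 2 + (- (x * z)) * 2 + z ^+ 2 <= eta by rewrite /eta; lra.
  rewrite sqrrB -mulr_natr; lra.
rewrite -subr_ge0 (_ : _ - _ = ((x ^+ 2 + 2 * eta) * (1 - v ^+ 2) - (x - z) ^+ 2) / (2 * (1 - v ^+ 2))); last first.
  by field; rewrite gt_eqF.
by rewrite divr_ge0 ?mulr_ge0 ?subr_ge0//; lra.
Qed.

Context {dO dT : measure_display} {O : measurableType dO} {T : measurableType dT}
  (P : probability O R) (W : O -> T) (U : O -> R) (V : T -> R) (v : R) (B : set R).
Hypotheses (mW : measurable_fun setT W) (mU : measurable_fun setT U)
  (mV : measurable_fun setT V) (mB : measurable B).
Hypotheses (v0 : 0 <= v) (v2 : v ^+ 2 <= 2^-1).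
Hypothesis lU : forall A, measurable A ->
  P (U @^-1` A) = normal_prob 0 (Num.sqrt (1 - v ^+ 2)) A.
Hypothesis lX : forall A, measurable A ->
  P [set w | A (U w + V (W w))] = normal_prob 0 1 A.
Hypothesis ind : forall A C, measurable A -> measurable C ->
  (P (W @^-1` C `&` U @^-1` A) = P (W @^-1` C) * P (U @^-1` A))%E.
Variables (r del : R).
Hypotheses (r0 : 0 <= r) (del0 : 0 <= del).

Let eta := r ^+ 2 * v ^+ 2 + 2 * r * del + del ^+ 2.

(** With [W] frozen and [|V (W)| <= del], [U + V (W)] is normal with a mean of size at most [del]
    and variance [1 - v^2]; on [|x| <= r] its density is at least [1 - eta] times the standard
    one. *)
Lemma gaussian_mixing_lower (D : set T) : measurable D -> eta <= 1 ->
  ((1 - eta)%:E * normal_prob 0 1 (B `&` [set x | (`|x| <= r)%R]) *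
    P (W @^-1` (D `&` [set t | (`|V t| <= del)%R])) <=
  P ([set w | B (U w + V (W w))%R] `&` W @^-1` D))%E.
Proof.
move=> mD eta1; pose s := Num.sqrt (1 - v ^+ 2).
have s0 : s != 0 by rewrite gt_eqF// /s sqrtr_gt0 subr_gt0 (le_lt_trans v2)// invf_lt1// ltr1n.
set D' := D `&` _; set B' := B `&` _.
have mD' : measurable D'.
  apply: measurableI => //; rewrite -[X in measurable X]setTI.
  by apply: (mV _ (measurable_norm_le del)).
have mB' : measurable B' by apply: measurableI => //; exact: measurable_norm_le.
pose S := [set q : T * measurableTypeR R | D' q.1 /\ B' ((q.2 : R) + V q.1)].
have mS : measurable S.
  apply: (@measurableI _ _ [set q : T * measurableTypeR R | D' q.1] [set q | B' ((q.2 : R) + V q.1)]).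
    rewrite -[X in measurable X]setTI.
    by apply: (@measurable_fst _ _ T (measurableTypeR R)).
  rewrite -[X in measurable X]setTI.
  have mf : measurable_fun setT (fun q : T * measurableTypeR R => (q.2 : R) + V q.1).
    apply: measurable_funD; first exact: measurable_snd.
    by apply: measurableT_comp => //; exact: measurable_fst.
  by apply: mf.
apply: (@le_trans _ _ (P [set w | S (W w, U w)])); last first.
  apply: le_measure; rewrite ?inE.
  - rewrite -[X in measurable X]setTI.
    have mf : measurable_fun setT (fun w => (W w, U w : measurableTypeR R)) by exact: measurable_fun_pair.
    by apply: mf.
  - apply: measurableI; rewrite -[X in measurable X]setTI; last by apply: mW.
    have mf : measurable_fun setT (fun w => U w + V (W w)).
      by apply: measurable_funD => //; exact: measurableT_comp.
    by apply: mf.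
  - by move=> w [[]] /= ? _ [] ? _.
rewrite (indep_pair_integral mW mU lU ind mS).
have N0 : (0 <= normal_prob 0 1 B')%E by exact: (@measure_ge0 _ _ _ (normal_prob 0 1)).
have e0 : 0 <= 1 - eta by rewrite subr_ge0.
have mDD : measurable (W @^-1` D') by rewrite -[X in measurable X]setTI; apply: mW.
have mI : measurable_fun setT (fun w => (\1_(W @^-1` D') w : R)%:E).
  by apply/measurable_EFinP; exact: measurable_indic.
set k := (_ * normal_prob 0 1 B')%E.
have k0 : (0 <= k)%E by rewrite mule_ge0// lee_fin.
rewrite -[W @^-1` D']setIT -(@integral_indic _ _ _ P setT measurableT _ mDD).
rewrite -(@ge0_integralZl _ _ _ P setT measurableT _ mI) => [|w _ //|//].
apply: ge0_le_integral; [exact: measurableT| | | |].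
- by move=> w _; rewrite mule_ge0// lee_fin.
- exact: measurable_funeM.
- have mS' : measurable_fun setT (fun t : T => normal_prob 0 s (xsection S t)).
    exact: (@measurable_fun_xsection _ _ T (measurableTypeR R) R (normal_prob 0 s)).
  exact: (measurableT_comp mS' mW).
move=> w _; have [[Dw Vw]|wD] := pselect (D' (W w)); last first.
  have -> : (\1_(W @^-1` D') w : R) = 0 by rewrite indicE memNset.
  by rewrite mule0; exact: (@measure_ge0 _ _ _ (normal_prob 0 s)).
have -> : (\1_(W @^-1` D') w : R) = 1 by rewrite indicE mem_set.
rewrite mule1.
have -> : xsection S (W w) = [set z | B' (z + V (W w))].
  apply/seteqP; split => z; rewrite /xsection /=; first by move=> /set_mem[].
  by move=> Bz; apply/mem_set; split.
apply: (@le_trans _ _ (normal_prob (V (W w)) s B')); last first.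
  by rewrite -(normal_prob_shift (V (W w)) mB' s0).
rewrite /k (normal_probZ 0 1 mB' e0) /normal_prob.
apply: ge0_le_integral => //.
- by move=> x _; rewrite mule_ge0 ?lee_fin ?normal_pdf_ge0.
- by apply: measurable_funeM; apply: measurable_funTS; apply/measurable_EFinP; exact: measurable_normal_pdf.
- by apply: measurable_funTS; apply/measurable_EFinP; exact: measurable_normal_pdf.
by move=> x [_ xr]; rewrite -EFinM lee_fin; exact: normal_pdf_shift_lower.
Qed.

(** The error [eta + P(|V| > del)] comes from the density ratio and from discarding large values of
    [V], the other from discarding [|x| > r]. The former multiplies the probability of the event, so
    it stays small after summation over [n] rare events. *)
Lemma gaussian_mixing (D : set T) : measurable D ->
  `|fine (P ([set w | B (U w + V (W w))] `&` W @^-1` D)) -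
    fine (P [set w | B (U w + V (W w))]) * fine (P (W @^-1` D))| <=
  fine (P [set w | B (U w + V (W w))]) *
     (eta + fine (P [set w | del < `|V (W w)|])) + 2 * expR (- (r ^+ 2 / 2)).
Proof.
move=> mD; set E := [set w | B _]; set t := fine (P [set w | del < _]).
set q := 2 * _.
have mX : measurable_fun setT (fun w => U w + V (W w)).
  by apply: measurable_funD => //; exact: measurableT_comp.
have mE : measurable E by rewrite -[X in measurable X]setTI; apply: mX.
have eta0 : 0 <= eta by rewrite /eta !addr_ge0 ?mulr_ge0 ?sqr_ge0.
have mWD (C : set T) : measurable C -> measurable (W @^-1` C).
  by move=> mC; rewrite -[X in measurable X]setTI; apply: mW.
have fE (C : set O) : measurable C -> (fine (P C))%:E = P C.
  by move=> mC; rewrite fineK// fin_num_measure.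
have f0 (C : set O) : 0 <= fine (P C) by exact: fine_ge0.
have f1 (C : set O) : measurable C -> fine (P C) <= 1.
  by move=> mC; rewrite -lee_fin fE// probability_le1.
have mVd : measurable [set t | `|V t| <= del].
  by rewrite -[X in measurable X]setTI; apply: (mV _ (measurable_norm_le del)).
have mVd' : measurable [set t | del < `|V t|].
  by rewrite -[X in measurable X]setTI; apply: (mV _ (measurable_norm_gt del)).
have t0 : 0 <= t by exact: f0.
have q0 : 0 <= q by rewrite mulr_ge0// expR_ge0.
have p0 : 0 <= fine (P E) by exact: f0.
have p1 : fine (P E) <= 1 by exact: f1.
have PE : P E = normal_prob 0 1 B := lX mB.
have lower C : measurable C ->
    fine (P E) * fine (P (W @^-1` C)) - fine (P E) * (eta + t) - q <= fine (P (E `&` W @^-1` C)).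
  move=> mC.
  have c0 : 0 <= fine (P (W @^-1` C)) by exact: f0.
  have c1 : fine (P (W @^-1` C)) <= 1 by apply: f1; exact: mWD.
  have EC0 : 0 <= fine (P (E `&` W @^-1` C)) by exact: f0.
  (* For [eta > 1] the left side of [lower] is nonpositive. *)
  have [eta1|eta1] := leP eta 1; last first.
    apply: le_trans EC0.
    have : fine (P E) * fine (P (W @^-1` C)) <= fine (P E) * (eta + t).
      by rewrite ler_wpM2l//; lra.
    by lra.
  have := gaussian_mixing_lower mC eta1.
  set a := normal_prob 0 1 _; set D' := C `&` _.
  have mB' : measurable (B `&` [set x | `|x| <= r]) by apply: measurableI => //; exact: measurable_norm_le.
  have aE : a = (fine a)%:E by rewrite fineK// (@fin_num_measure _ _ _ (normal_prob 0 1)).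
  have a0 : 0 <= fine a by apply: fine_ge0; exact: (@measure_ge0 _ _ _ (normal_prob 0 1)).
  have mD' : measurable D' by exact: measurableI.
  rewrite -/E -(fE (W @^-1` D'))//; last exact: mWD.
  rewrite -(fE (E `&` W @^-1` C)); last by apply: measurableI => //; exact: mWD.
  rewrite aE -!EFinM lee_fin => H; apply: le_trans H.
  have ap : fine (P E) - q <= fine a.
    rewrite lerBlDr -lee_fin EFinD -aE fE// PE.
    apply: (@le_trans _ _ (a + normal_prob 0 1 [set x | (r < `|x|)%R])%E).
      apply: le_trans (@measureU2 _ _ _ (normal_prob 0 1) _ _ mB' (measurable_norm_gt r)).
      apply: (@le_measure _ _ _ (normal_prob 0 1)); rewrite ?inE//; first by apply: measurableU => //; exact: measurable_norm_gt.
      by move=> x Bx /=; case: (leP `|x| r); [left|right].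
    apply: leeD2l; apply: (le_trans (normal_tail ltr01 r0)).
    by rewrite expr1n mulr1.
  have ap' : fine a <= fine (P E).
    rewrite -lee_fin -aE fE// PE.
    by apply: (@le_measure _ _ _ (normal_prob 0 1)); rewrite ?inE//; move=> x [].
  have bD : fine (P (W @^-1` C)) - t <= fine (P (W @^-1` D')).
    have mWC := mWD _ mC; have mWD' := mWD _ mD'.
    have mt : measurable [set w | del < `|V (W w)|] by exact: (mWD _ mVd').
    rewrite lerBlDr -lee_fin EFinD !fE//.
    apply: le_trans (@measureU2 _ _ _ P _ _ (mWD _ mD') (mWD _ mVd')).
    apply: le_measure; rewrite ?inE//; first exact: measurableU.
    by move=> w Cw; case: (leP `|V (W w)| del); [left|right].
  have b1 : fine (P (W @^-1` D')) <= 1 by apply: f1; exact: mWD.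
  have b0 : 0 <= fine (P (W @^-1` D')) by exact: f0.
  set b := fine (P (W @^-1` D')) in bD b1 b0 *.
  set a' := fine a in a0 ap ap' *.
  set c := fine (P (W @^-1` C)) in c0 c1 bD *.
  set p := fine (P E) in p0 p1 ap ap' *.
  have h1 : eta * (a' * b) <= eta * p.
    by rewrite ler_wpM2l// -[leRHS]mulr1; apply: ler_pM.
  have h2 : a' * (c - t) <= a' * b by rewrite ler_wpM2l.
  have h3 : (p - q) * c <= a' * c by rewrite ler_wpM2r.
  have h4 : q * c <= q by rewrite ler_piMr.
  have h5 : a' * t <= p * t by rewrite ler_wpM2r.
  by lra.
have L1 := lower D mD; have L2 := lower (~` D) (measurableC mD).
have SC : fine (P (W @^-1` (~` D))) = 1 - fine (P (W @^-1` D)).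
  rewrite -[W @^-1` (~` D)]/(~` (W @^-1` D)) probability_setC; last exact: mWD.
  by rewrite -(fE (W @^-1` D)) -?EFinB//; exact: mWD.
have SE : fine (P E) = fine (P (E `&` W @^-1` D)) + fine (P (E `&` W @^-1` (~` D))).
  apply/EFin_inj; rewrite EFinD !fE//; [|by apply: measurableI => //; apply: mWD; exact: measurableC|by apply: measurableI => //; apply: mWD].
  rewrite -[in LHS](setIT E) -[in LHS](setUv (W @^-1` D)) setIUr measureU//.
  - by apply: measurableI => //; exact: mWD.
  - by apply: measurableI => //; apply: measurableC; exact: mWD.
  - by rewrite setIACA setICr setI0.
rewrite SC in L2; rewrite ler_norml; apply/andP; split; lra.
Qed.

End gaussian_mixing.

(** * Moments and cosine transforms of Gaussian vectors; independence from transforms *)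

Section integral_law.
Context {R : realType} {dO : measure_display} {O : measurableType dO} (P : probability O R).

Lemma integrable_law (Y : O -> R) (nu : probability (measurableTypeR R) R) (f : R -> R) :
  measurable_fun setT Y -> (forall B, measurable B -> P (Y @^-1` B) = nu B) ->
  measurable_fun setT f -> nu.-integrable setT (EFin \o f) ->
  P.-integrable setT (fun w => (f (Y w))%:E).
Proof.
move=> mY lY mf /integrableP[_ fi].
have mEf : measurable_fun setT (EFin \o f) by exact/measurable_EFinP.
apply/integrableP; split; first exact: (measurableT_comp mEf mY).
rewrite (@ge0_integral_law _ _ _ P Y nu (fun y => `|(f y)%:E|%E))//.
exact: measurableT_comp.
Qed.

Lemma integral_law (Y : O -> R) (nu : probability (measurableTypeR R) R) (f : R -> R) :
  measurable_fun setT Y -> (forall B, measurable B -> P (Y @^-1` B) = nu B) ->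
  measurable_fun setT f ->
  (\int[P]_w (f (Y w))%:E = \int[nu]_y (f y)%:E)%E.
Proof.
move=> mY lY mf.
have mEf : measurable_fun setT (EFin \o f) by exact/measurable_EFinP.
rewrite integralE [RHS]integralE; congr (_ - _)%E.
- rewrite -(@ge0_integral_law _ _ _ P Y nu ((EFin \o f)^\+)%E mY lY (measurable_funepos mEf) (funepos_ge0 _)).
  by apply: eq_integral => w _; rewrite !funeposE.
- rewrite -(@ge0_integral_law _ _ _ P Y nu ((EFin \o f)^\-)%E mY lY (measurable_funeneg mEf) (funeneg_ge0 _)).
  by apply: eq_integral => w _; rewrite !funenegE.
Qed.

Variables (Y : O -> R) (m s : R).
Hypotheses (mY : measurable_fun setT Y)
  (lY : forall B, measurable B -> P (Y @^-1` B) = normal_law m s B).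

Lemma normal_law_moments :
  [/\ P.-integrable setT (fun w => (Y w - m)%:E),
      P.-integrable setT (fun w => ((Y w - m) ^+ 2)%:E),
      (\int[P]_w (Y w - m)%:E = 0)%E &
      (\int[P]_w ((Y w - m) ^+ 2)%:E = (s ^+ 2)%:E)%E].
Proof.
have m1 : measurable_fun setT (fun x : R => x - m) by exact: measurable_center.
have m2 : measurable_fun setT (fun x : R => (x - m) ^+ 2) by exact: measurable_funX.
have [s0|s0] := eqVneq s 0.
  pose nu : probability (measurableTypeR R) R := \d_(m : measurableTypeR R).
  have lY' B : measurable B -> P (Y @^-1` B) = nu B by move=> mB; rewrite lY// /normal_law s0 eqxx.
  have dI (f : R -> R) : measurable_fun setT f -> (\int[nu]_x (f x)%:E = (f m)%:E)%E.
    by move=> mf; rewrite integral_dirac ?diracT ?mul1e//; exact/measurable_EFinP.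
  have dP (f : R -> R) : measurable_fun setT f -> nu.-integrable setT (EFin \o f).
    move=> mf; apply/integrableP; split; first exact/measurable_EFinP.
    by rewrite (dI (fun x => `|f x|)) ?ltry//; exact: measurableT_comp.
  split.
  - exact: (integrable_law mY lY' m1 (dP _ m1)).
  - exact: (integrable_law mY lY' m2 (dP _ m2)).
  - by rewrite (integral_law mY lY' m1) dI// subrr.
  - by rewrite (integral_law mY lY' m2) dI// subrr s0.
have lY' B : measurable B -> P (Y @^-1` B) = normal_prob m s B by move=> mB; rewrite lY// /normal_law (negbTE s0).
have i1 := integrable_normal_pdf_center m s0.
have i2 := integrable_normal_pdf_center_sqr m s0.
split.
- exact: (integrable_law mY lY' m1 (integrable_normal_prob m1 i1)).
- exact: (integrable_law mY lY' m2 (integrable_normal_prob m2 i2)).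
- by rewrite (integral_law mY lY' m1) (integral_normal_prob m1 i1) integral_normal_pdf_center.
- by rewrite (integral_law mY lY' m2) (integral_normal_prob m2 i2) integral_normal_pdf_center_sqr.
Qed.

Lemma normal_law_cos t u : m = 0 ->
  \int[P]_w cos (t * Y w + u) = cos u * expR (- (s ^+ 2 * t ^+ 2 / 2)).
Proof.
move=> m0.
have mc : measurable_fun setT (fun x : R => cos (t * x + u)).
  apply: measurableT_comp; first by apply: continuous_measurable_fun; exact: continuous_cos.
  by apply: measurable_funD => //; exact: measurable_funM.
have [s0|s0] := eqVneq s 0.
  pose nu : probability (measurableTypeR R) R := \d_(m : measurableTypeR R).
  have lY' B : measurable B -> P (Y @^-1` B) = nu B by move=> mB; rewrite lY// /normal_law s0 eqxx.
  rewrite /Rintegral (integral_law mY lY' mc) integral_dirac ?diracT ?mul1e//=; last exact/measurable_EFinP.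
  by rewrite m0 mulr0 add0r s0 expr0n/= !mul0r oppr0 expR0 mulr1.
have lY' B : measurable B -> P (Y @^-1` B) = normal_prob 0 s B by move=> mB; rewrite lY// /normal_law (negbTE s0) m0.
rewrite /Rintegral (integral_law mY lY' mc) (integral_normal_prob mc); last exact: integrable_cos_normal_pdf.
by rewrite -normal_cosE.
Qed.

End integral_law.

Section gaussian_vectors.
Context {R : realType} {dO : measure_display} {O : measurableType dO} {d : nat}
  (P : probability O R) (Z : O -> d.-tuple R).
Hypothesis mZ : measurable_fun setT Z.

Definition dot (c : 'I_d -> R) (z : d.-tuple R) : R := \sum_(j < d) c j * tnth z j.
Definition sqnorm (c : 'I_d -> R) : R := \sum_(j < d) c j ^+ 2.

Lemma measurable_dot c : measurable_fun setT (dot c).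
Proof.
apply: measurable_sum => j; apply: measurable_funM => //.
exact: measurable_tnth.
Qed.

Hypotheses (gZ : gaussian_vector P Z) (cZ : centered_vector P Z) (vZ : identity_covariance P Z).

Let mT i : measurable_fun setT (fun w => tnth (Z w) i).
Proof. by apply: (measurableT_comp (measurable_tnth i)). Qed.

Let coord i : exists m s, forall B, measurable B -> P ((fun w => tnth (Z w) i) @^-1` B) = normal_law m s B.
Proof.
have [m [s [_ H]]] := gZ (fun j => (j == i)%:R); exists m, s => B mB; rewrite -(H B mB).
congr (P (_ @^-1` B)); apply/funext => w.
rewrite (bigD1 i)//= eqxx mul1r big1 ?addr0// => j /negbTE ->.
by rewrite mul0r.
Qed.

Let iT i : P.-integrable setT (fun w => (tnth (Z w) i)%:E).
Proof.
have [m [s /(normal_law_moments (mT i))[i1 _ _ _]]] := coord i.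
have ic : P.-integrable setT (EFin \o cst m) by apply: (@bounded_prob_integrable _ _ _ P _ `|m|).
have := integrableD measurableT i1 ic; apply: eq_integrable => // w _.
by rewrite -EFinD /= subrK.
Qed.

Let iT2 i : P.-integrable setT (fun w => (tnth (Z w) i ^+ 2)%:E).
Proof.
have [m [s /(normal_law_moments (mT i))[i1 i2 _ _]]] := coord i.
have ic : P.-integrable setT (EFin \o cst (- m ^+ 2)) by apply: (@bounded_prob_integrable _ _ _ P _ `|- m ^+ 2|).
have := integrableD measurableT (integrableD measurableT i2 (integrableZl measurableT (2 * m) (iT i)))
   ic; apply: eq_integrable => // w _.
by rewrite -EFinM /= -!EFinD; congr EFin; ring.
Qed.

Let iTT i j : P.-integrable setT (fun w => (tnth (Z w) i * tnth (Z w) j)%:E).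
Proof.
have := integrableD measurableT (iT2 i) (iT2 j); apply: le_integrable => //.
  by apply/measurable_EFinP; exact: measurable_funM.
move=> w _ /=; rewrite lee_fin; set x := tnth _ _; set y := tnth _ _.
have x2 := sqr_ge0 (x - y); have y2 := sqr_ge0 (x + y).
have xx := sqr_ge0 x; have yy := sqr_ge0 y.
rewrite [leRHS]ger0_norm ?addr_ge0// ler_norml; move: x2 y2 xx yy.
by rewrite !expr2 => *; apply/andP; split; nra.
Qed.

Let ET i : (\int[P]_w (tnth (Z w) i)%:E = 0)%E.
Proof. by have := cZ i; rewrite unlock. Qed.

Let ETT i j : (\int[P]_w (tnth (Z w) i * tnth (Z w) j)%:E = ((i == j)%:R)%:E)%E.
Proof.
have := vZ i j; rewrite unlock !cZ /= unlock => <-.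
by apply: eq_integral => w _; rewrite !fctE /= !subr0.
Qed.

(** [gaussian_vector] gives a normal law with unknown parameters; they are identified by computing
    the mean and the second moment of [dot c Z] a second time, from the centring and the identity
    covariance. *)
Lemma gaussian_dot_law c : exists s,
  s ^+ 2 = sqnorm c /\ forall B, measurable B -> P ((fun w => dot c (Z w)) @^-1` B) = normal_law 0 s B.
Proof.
have [m [s [_ H]]] := gZ c.
have mD : measurable_fun setT (fun w => dot c (Z w)) by exact: (measurableT_comp (measurable_dot c) mZ).
have [i1 i2 e1 e2] := normal_law_moments mD H.
have m0 : m = 0.
  have ic : P.-integrable setT (EFin \o cst m) by apply: (@bounded_prob_integrable _ _ _ P _ `|m|).
  have E0 : (\int[P]_w (dot c (Z w))%:E = 0)%E.
    under eq_integral do rewrite /dot -sumEFin.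
    rewrite integral_sum//; last by move=> j; exact: (integrableZl measurableT (c j) (iT j)).
    rewrite big1// => j _; under eq_integral do rewrite EFinM.
    by rewrite integralZl// ET mule0.
  have iD : P.-integrable setT (fun w => (dot c (Z w))%:E).
    by have := integrableD measurableT i1 ic; apply: eq_integrable => // w _; rewrite -EFinD /= subrK.
  move: e1; under eq_integral do rewrite EFinB.
  have Em : (\int[P]_w m%:E = m%:E)%E.
    by rewrite integral_cst// [X in (_ * X)%E](@probability_setT _ _ _ P) mule1.
  rewrite integralB// E0 Em sub0e -EFinN => -[] /eqP.
  by rewrite oppr_eq0 => /eqP.
exists s; split; last by rewrite -m0.
move: e2; rewrite m0; under eq_integral => w _.
  rewrite subr0 expr2 /dot big_distrl/=.
  under eq_bigr do rewrite big_distrr/=.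
  rewrite -sumEFin; under eq_bigr do rewrite -sumEFin.
  over.
have iC i j : P.-integrable setT (fun w => (c i * tnth (Z w) i * (c j * tnth (Z w) j))%:E).
  have := integrableZl measurableT (c i * c j) (iTT i j); apply: eq_integrable => // w _.
  by rewrite -EFinM; congr EFin; ring.
rewrite integral_sum//; last by move=> i; apply: integrable_sum => // j _; exact: iC.
under eq_bigr => i _.
  rewrite integral_sum//.
  under eq_bigr => j _.
    rewrite (_ : integral _ _ _ = (c i * c j * (i == j)%:R)%:E); last first.
      under eq_integral do rewrite mulrACA EFinM.
      by rewrite integralZl// ETT.
    over.
  rewrite sumEFin (bigD1 i)//= eqxx mulr1 big1 ?addr0; last first.
    by move=> j /negbTE ji; rewrite eq_sym ji mulr0.
  over.
by rewrite sumEFin => -[] <-.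
Qed.

Lemma gaussian_dot_cos c t u :
  \int[P]_w cos (t * dot c (Z w) + u) = cos u * expR (- (sqnorm c * t ^+ 2 / 2)).
Proof.
have [s [<- H]] := gaussian_dot_law c.
by apply: (normal_law_cos _ H) => //; exact: (measurableT_comp (measurable_dot c) mZ).
Qed.

End gaussian_vectors.

Section char_law.
Context {R : realType} {dO : measure_display} {O : measurableType dO} (P : probability O R).
Implicit Types (Y Z : O -> R).

Lemma Rintegral_indic_comp (P' : probability O R) Y (B : set R) : measurable_fun setT Y -> measurable B ->
  \int[P']_w (\1_B (Y w)) = fine (P' (Y @^-1` B)).
Proof.
move=> mY mB; rewrite /Rintegral; congr fine.
have mYB : measurable (Y @^-1` B) by rewrite -[X in measurable X]setTI; exact: mY.
rewrite (eq_integral (fun w => (\1_(Y @^-1` B) w)%:E)); last by move=> w _; rewrite !indicE.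
by rewrite integral_indic// setIT.
Qed.

Lemma cos_law Y s : measurable_fun setT Y ->
  (forall t u, \int[P]_w cos (t * Y w + u) = cos u * expR (- (s ^+ 2 * t ^+ 2 / 2))) ->
  forall B, measurable B -> P (Y @^-1` B) = normal_law 0 s B.
Proof.
move=> mY H B mB.
have [nu nuE nucos] : exists2 nu : probability (measurableTypeR R) R,
    normal_law 0 s B = nu B & forall t u, \int[nu]_x cos (t * x + u) = cos u * expR (- (s ^+ 2 * t ^+ 2 / 2)).
  have mc t u : measurable_fun setT (fun x : R => cos (t * x + u)).
    apply: measurableT_comp; first by apply: continuous_measurable_fun; exact: continuous_cos.
    by apply: measurable_funD => //; exact: measurable_funM.
  have [s0|s0] := eqVneq s 0.
    exists (\d_(0 : measurableTypeR R)); first by rewrite /normal_law s0 eqxx.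
    move=> t u; have mE : measurable_fun setT (fun x : R => (cos (t * x + u))%:E) by exact/measurable_EFinP.
    rewrite /Rintegral integral_dirac ?diracT ?mul1e//=.
    by rewrite mulr0 add0r s0 expr0n/= !mul0r oppr0 expR0 mulr1.
  exists (normal_prob 0 s); first by rewrite /normal_law (negbTE s0).
  move=> t u; rewrite /Rintegral (integral_normal_prob (mc t u)); last exact: integrable_cos_normal_pdf.
  by rewrite -normal_cosE.
have mid : @measurable_fun _ _ (measurableTypeR R) R setT id by exact: measurable_id.
have n1 : `|1 : R| <= 1 by rewrite normr1.
have /(_ _ B mB) := @cos_determines R _ _ O (measurableTypeR R) P nu Y (cst 1) id (cst 1) mY
  mid (measurable_cst _) (measurable_cst _) (fun=> n1) (fun=> n1).
have -> : \int[P]_w (\1_B (Y w) * cst 1 w) = fine (P (Y @^-1` B)).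
  by rewrite -Rintegral_indic_comp//; apply: eq_Rintegral => w _; rewrite mulr1.
have -> : \int[nu]_x (\1_B (id x) * cst 1 x) = fine (nu B).
  rewrite /Rintegral; congr fine; under eq_integral do rewrite mulr1.
  by rewrite integral_indic// setIT.
have mYB : measurable (Y @^-1` B) by rewrite -[X in measurable X]setTI; exact: mY.
rewrite nuE -[X in _ -> X = _]fineK ?fin_num_measure// -[X in _ -> _ = X]fineK ?fin_num_measure//.
move=> -> // a c.
transitivity (\int[P]_w cos (a * Y w + c)); first by apply: eq_Rintegral => x _; rewrite mulr1.
by rewrite H -nucos; apply: eq_Rintegral => x _; rewrite mulr1.
Qed.

Let c1 (x : R) : `|cos x| <= 1. Proof. by rewrite ler_norml cos_geN1 cos_le1. Qed.

Let mcos (f : O -> R) : measurable_fun setT f -> measurable_fun setT (fun w => cos (f w)).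
Proof. by move=> mf; apply: measurableT_comp => //; apply: continuous_measurable_fun; exact: continuous_cos. Qed.

Let mlin (f : O -> R) (a u : R) : measurable_fun setT f -> measurable_fun setT (fun w => a * f w + u).
Proof. by move=> mf; apply: measurable_funD => //; exact: measurable_funM. Qed.

Let mind Y (B : set R) : measurable_fun setT Y -> measurable B ->
  measurable_fun setT (fun w => \1_B (Y w) : R).
Proof.
move=> mY mB; have mB' : measurable_fun setT (\1_B : R -> R) by exact: measurable_indic.
exact: (measurableT_comp mB' mY).
Qed.

Let cos_factor Y (f : O -> R) B : measurable_fun setT Y -> measurable_fun setT f ->
  (forall w, `|f w| <= 1) -> measurable B ->
  (forall c v, \int[P]_w (cos (c * Y w + v) * f w) = (\int[P]_w cos (c * Y w + v)) * (\int[P]_w f w)) ->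
  \int[P]_w (\1_B (Y w) * f w) = fine (P (Y @^-1` B)) * \int[P]_w f w.
Proof.
move=> mY mf f1 mB Hf.
have fle : `|\int[P]_w f w| <= 1.
  have fi := bounded_prob_integrable P mf f1.
  apply: (le_trans (le_normr_Rintegral measurableT fi)).
  have : \int[P]_w `|f w| <= \int[P]_w (cst 1 w).
    apply: le_Rintegral => //; first exact: integrable_abse fi.
    by apply: (@bounded_prob_integrable _ _ _ P _ 1) => // w; rewrite normr1.
  by rewrite Rintegral_cst// [X in fine X](@probability_setT _ _ _ P) mul1r.
have := @cos_determines R _ _ O O P P Y f Y (cst (\int[P]_w f w)) mY mY mf (measurable_cst _) f1 (fun=> fle) _ B mB.
move=> ->; last first.
  by move=> a c; rewrite Hf RintegralZr//; apply: (@bounded_prob_integrable _ _ _ P _ 1) => //; apply: mcos; exact: mlin.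
rewrite RintegralZr//; last first.
  apply: (@bounded_prob_integrable _ _ _ P _ 1) => //; last by move=> w; rewrite indicE; case: (_ \in _); rewrite ?normr1 ?normr0.
  exact: mind.
by rewrite Rintegral_indic_comp.
Qed.

(** The joint transform is even in [c], so by the product formula the mean of
    [cos (a Z + u) * cos (c Y + v)] factorises. One use of [cos_factor] replaces the cosine of [Y]
    by an indicator, a second one that of [Z]. *)
Lemma cos_indep Y Z s1 s2 : measurable_fun setT Y -> measurable_fun setT Z ->
  (forall a c u, \int[P]_w cos (a * Z w + c * Y w + u) =
     cos u * expR (- (s1 ^+ 2 * a ^+ 2 / 2)) * expR (- (s2 ^+ 2 * c ^+ 2 / 2))) ->
  forall A B, measurable A -> measurable B ->
  (P (Y @^-1` B `&` Z @^-1` A) = P (Y @^-1` B) * P (Z @^-1` A))%E.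
Proof.
move=> mY mZ H A B mA mB.
have HZ a u : \int[P]_w cos (a * Z w + u) = cos u * expR (- (s1 ^+ 2 * a ^+ 2 / 2)).
  have := H a 0 u; rewrite expr0n/= mulr0 mul0r oppr0 expR0 mulr1 => <-.
  by apply: eq_Rintegral => w _; rewrite mul0r addr0.
have HY c u : \int[P]_w cos (c * Y w + u) = cos u * expR (- (s2 ^+ 2 * c ^+ 2 / 2)).
  have := H 0 c u; rewrite expr0n/= mulr0 mul0r oppr0 expR0 mulr1 => <-.
  by apply: eq_Rintegral => w _; rewrite mul0r add0r.
have HZY a u c v : \int[P]_w (cos (a * Z w + u) * cos (c * Y w + v)) =
    (\int[P]_w cos (a * Z w + u)) * (\int[P]_w cos (c * Y w + v)).
  have i1 a' c' u' : P.-integrable setT (EFin \o (fun w => cos (a' * Z w + c' * Y w + u'))).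
    apply: (@bounded_prob_integrable _ _ _ P _ 1) => // ; apply: mcos.
    by apply: measurable_funD => //; apply: measurable_funD; exact: measurable_funM.
  rewrite (_ : \int[P]_w _ = \int[P]_w (2^-1 * (cos (a * Z w + c * Y w + (u + v)) + cos (a * Z w + (- c) * Y w + (u - v))))); last first.
    apply: eq_Rintegral => w _.
    have -> : a * Z w + c * Y w + (u + v) = (a * Z w + u) + (c * Y w + v) by ring.
    have -> : a * Z w + (- c) * Y w + (u - v) = (a * Z w + u) - (c * Y w + v) by ring.
    by rewrite (cosD (a * Z w + u)) (cosB (a * Z w + u)); field.
  rewrite RintegralZl//; last by have := integrableD measurableT (i1 a c (u + v)) (i1 a (- c) (u - v)).
  rewrite RintegralD//.
  by rewrite !H HZ HY cosD cosB sqrrN; field.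
have mYB : measurable (Y @^-1` B) by rewrite -[X in measurable X]setTI; exact: mY.
have mZA : measurable (Z @^-1` A) by rewrite -[X in measurable X]setTI; exact: mZ.
have m1B := mind mY mB.
have E : \int[P]_w (\1_A (Z w) * \1_B (Y w)) = fine (P (Z @^-1` A)) * \int[P]_w \1_B (Y w).
  apply: cos_factor => //; first by move=> w; rewrite indicE; case: (_ \in _); rewrite ?normr1 ?normr0.
  move=> a u; rewrite Rintegral_indic_comp// [RHS]mulrC -cos_factor//.
  - by apply: eq_Rintegral => w _; rewrite mulrC.
  - by apply: mcos; exact: mlin.
  - by move=> c v; rewrite [RHS]mulrC -HZY; apply: eq_Rintegral => w _; rewrite mulrC.
rewrite Rintegral_indic_comp// in E.
have mI := measurableI _ _ mYB mZA.
rewrite -[LHS]fineK ?fin_num_measure// -[P (Y @^-1` B)]fineK ?fin_num_measure//.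
rewrite -[P (Z @^-1` A)]fineK ?fin_num_measure// -EFinM [in RHS]mulrC -E; congr EFin.
rewrite /Rintegral; congr fine; rewrite -[in LHS](setIT (_ `&` _)) -integral_indic//.
apply: eq_integral => w _; congr EFin; rewrite !indicE in_setI.
by rewrite [RHS]mulrC -natrM mulnb.
Qed.

End char_law.

Section indep_expectation.
Context {R : realType} {dO : measure_display} {O : measurableType dO} (P : probability O R).

Lemma indep_Rintegral (A B : O -> R) (f g : R -> R) :
  measurable_fun setT A -> measurable_fun setT B ->
  measurable_fun setT f -> measurable_fun setT g ->
  (forall x, `|f x| <= 1) -> (forall x, `|g x| <= 1) ->
  (forall C D, measurable C -> measurable D ->
     (P (A @^-1` C `&` B @^-1` D) = P (A @^-1` C) * P (B @^-1` D))%E) ->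
  \int[P]_w (f (A w) * g (B w)) = (\int[P]_w f (A w)) * (\int[P]_w g (B w)).
Proof.
move=> mA mB mf mg f1 g1 ind.
pose A' : {mfun O >-> measurableTypeR R} := HB.pack A (isMeasurableFun.Build dO _ O (measurableTypeR R) A mA).
pose B' : {mfun O >-> measurableTypeR R} := HB.pack B (isMeasurableFun.Build dO _ O (measurableTypeR R) B mB).
have mAB : @measurable_fun _ _ O (measurableTypeR R * measurableTypeR R)%type setT (fun w => (A w, B w)).
  exact: (@measurable_fun_pair _ _ _ O (measurableTypeR R) (measurableTypeR R)).
pose AB : {mfun O >-> (measurableTypeR R * measurableTypeR R)%type} :=
  HB.pack (fun w => (A w, B w)) (isMeasurableFun.Build dO _ O (measurableTypeR R * measurableTypeR R)%type _ mAB).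
pose mu : probability (measurableTypeR R) R := distribution P A'.
pose nu : probability (measurableTypeR R) R := distribution P B'.
pose F (q : measurableTypeR R * measurableTypeR R) : R := f q.1 * g q.2.
have mF : measurable_fun setT F.
  apply: measurable_funM.
    by apply: (measurableT_comp mf); exact: measurable_fst.
  by apply: (measurableT_comp mg); exact: measurable_snd.
have mEF : measurable_fun setT (EFin \o F) by exact/measurable_EFinP.
have F1 q : `|F q| <= 1 by rewrite normrM -[1]mulr1 ler_pM.
have lA D : measurable D -> P (A @^-1` D) = mu D by [].
have lB D : measurable D -> P (B @^-1` D) = nu D by [].
have fi : (\int[mu]_x (f x)%:E \is a fin_num)%E.
  by apply: integrable_fin_num => //; exact: (@bounded_prob_integrable _ _ _ mu f 1 mf f1).
have gi : (\int[nu]_x (g x)%:E \is a fin_num)%E.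
  by apply: integrable_fin_num => //; exact: (@bounded_prob_integrable _ _ _ nu g 1 mg g1).
rewrite /Rintegral (integral_law mA lA mf) (integral_law mB lB mg) -fineM//; congr fine.
transitivity (\int[distribution P AB]_q (F q)%:E)%E.
  rewrite integral_distribution//.
  apply: (@bounded_prob_integrable _ _ _ P (fun w => F (A w, B w)) 1) => //.
  exact: (measurableT_comp mF mAB).
transitivity (\int[(mu \x nu)%E]_q (F q)%:E)%E.
  apply: eq_measure_integral => S mS _; apply: esym.
  apply: (@product_measure_unique _ _ _ _ R mu nu (distribution P AB)) => //.
have FI : (mu \x nu)%E.-integrable setT (EFin \o F).
  apply: (@bounded_prob_integrable _ _ _ (mu \x nu)%E F 1) => //.
rewrite -(integral12_prod_meas1 FI) /fubini_F /=.
under eq_integral => x _.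
  under eq_integral do rewrite /F /= EFinM.
  rewrite integralZl//; last exact: (@bounded_prob_integrable _ _ _ nu g 1 mg g1).
  over.
rewrite -(fineK gi) integralZr//; exact: (@bounded_prob_integrable _ _ _ mu f 1 mf f1).
Qed.

End indep_expectation.

(** * Gaussian linear processes *)

Section linear_sums.
Context {R : realType} {dO : measure_display} {O : measurableType dO} {d : nat}
  (P : probability O R) (eps : int -> O -> d.-tuple R).
Hypotheses (mE : forall k, measurable_fun setT (eps k)) (indE : mutually_independent P eps).
Implicit Types (b : nat -> 'I_d -> R) (k : int) (n : nat).

Definition lsum b k n (w : O) : R := \sum_(0 <= l < n) dot (b l) (eps (k - l%:Z) w).
Definition lvar b n : R := \sum_(0 <= l < n) sqnorm (b l).

Lemma lsum_wrt (Q : set int) b k n : (forall l, (l < n)%N -> Q (k - l%:Z)) ->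
  measurable_wrt eps Q (lsum b k n).
Proof.
move=> Qk; rewrite /measurable_wrt /lsum.
elim: n Qk => [|n IH] Qk.
  by under eq_fun do rewrite big_geq//; exact: measurable_cst.
under eq_fun do rewrite big_nat_recr//=.
apply: measurable_funD; first by apply: IH => l ln; apply: Qk; exact: ltnW.
by apply: measurable_wrt_comp; [exact: Qk|exact: measurable_dot].
Qed.

Lemma measurable_lsum b k n : measurable_fun setT (lsum b k n).
Proof. exact: (measurable_wrtT mE (@lsum_wrt setT b k n (fun _ _ => I))). Qed.

(** A version of the infinite sum that is defined everywhere and measurable with respect to the
    innovations involved; the given process is only almost surely equal to such a function. *)
Definition limS b k (w : O) : R := fine (limn_esup (fun n => (lsum b k n w)%:E)).

Lemma limS_cvg b k w x : lsum b k n w @[n --> \oo] --> x -> limS b k w = x.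
Proof.
move=> H; rewrite /limS is_cvg_limn_esupE.
  by rewrite (@cvg_lim _ _ _ _ _ _ x%:E)//; apply: cvg_EFin => //; exact: nearW.
by apply/cvg_ex; exists x%:E; apply: cvg_EFin => //; exact: nearW.
Qed.

Lemma limS_wrt (Q : set int) b k : (forall l, Q (k - l%:Z)) -> measurable_wrt eps Q (limS b k).
Proof.
move=> Qk; rewrite /measurable_wrt /limS.
apply: (measurableT_comp (fine_measurable measurableT)).
apply: measurable_fun_limn_esup => n; apply/measurable_EFinP.
by apply: lsum_wrt => l _.
Qed.

Lemma measurable_limS b k : measurable_fun setT (limS b k).
Proof. exact: (measurable_wrtT mE (@limS_wrt setT b k (fun _ => I))). Qed.

Hypotheses (gE : forall k, gaussian_vector P (eps k))
  (cE : forall k, centered_vector P (eps k)) (vE : forall k, identity_covariance P (eps k)).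

Let mcos t u : measurable_fun setT (fun x : R => cos (t * x + u)).
Proof.
apply: measurableT_comp; first by apply: continuous_measurable_fun; exact: continuous_cos.
by apply: measurable_funD => //; exact: measurable_funM.
Qed.

Let c1 (x : R) : `|cos x| <= 1. Proof. by rewrite ler_norml cos_geN1 cos_le1. Qed.

Lemma lsum_cos b k n t u :
  \int[P]_w cos (t * lsum b k n w + u) = cos u * expR (- (lvar b n * t ^+ 2 / 2)).
Proof.
elim: n u => [|n IH] u.
  rewrite /lvar big_geq// !mul0r oppr0 expR0 mulr1 /lsum.
  under eq_Rintegral do rewrite big_geq// mulr0 add0r.
  by rewrite Rintegral_cst// [X in fine X](@probability_setT _ _ _ P) mulr1.
pose B w := dot (b n) (eps (k - n%:Z) w).
have mB : measurable_fun setT B by exact: (measurableT_comp (measurable_dot _) (mE _)).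
have BE v : \int[P]_w cos (t * B w + v) = cos v * expR (- (sqnorm (b n) * t ^+ 2 / 2)).
  exact: (gaussian_dot_cos (mE _) (gE _) (cE _) (vE _)).
have mA := measurable_lsum b k n.
have ind C D : measurable C -> measurable D ->
   (P (lsum b k n @^-1` C `&` B @^-1` D) = P (lsum b k n @^-1` C) * P (B @^-1` D))%E.
  move=> mC mD.
  apply: (@sigma_cylinders_indep _ _ _ _ _ _ P eps mE indE [set q : int | (k - n%:Z < q)%R] [set q | q = k - n%:Z]).
  - by move=> q /= + qE; rewrite qE ltxx.
  - apply: measurable_wrt_preimage => //; apply: lsum_wrt => l ln /=; lia.
  - apply: measurable_wrt_preimage => //; apply: measurable_wrt_comp => //.
    exact: measurable_dot.
rewrite /lvar big_nat_recr//= -/(lvar b n).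
have i0 (s s' v v' : R) : P.-integrable setT (EFin \o (fun w => cos (s * lsum b k n w + v) * cos (s' * B w + v'))).
  apply: (@bounded_prob_integrable _ _ _ P _ 1).
    by apply: measurable_funM; [exact: (measurableT_comp (mcos _ _) mA)|exact: (measurableT_comp (mcos _ _) mB)].
  by move=> w; rewrite normrM -[1]mulr1 ler_pM.
(* The addition formula, each sine being a cosine shifted by [pi / 2] so that [IH] and [BE] cover
   it; the shifted cosine of [B] has mean 0. *)
transitivity (\int[P]_w (cos (t * lsum b k n w + u) * cos (t * B w + 0) -
   cos (t * lsum b k n w + (u - pi / 2)) * cos (t * B w + (0 - pi / 2)))).
  apply: eq_Rintegral => w _; rewrite /lsum big_nat_recr//= -/(lsum b k n w) -/(B w).
  rewrite !(addrA _ _ (- (pi / 2))) !cosBpihalf -cosD; congr cos; ring.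
rewrite RintegralB//.
rewrite !(@indep_Rintegral _ _ _ P (lsum b k n) B (fun x => cos (t * x + _)) (fun x => cos (t * x + _)))//.
rewrite !IH !BE cos0 mul1r sub0r cosN cos_pihalf mul0r mulr0 subr0.
rewrite (_ : - ((lvar b n + sqnorm (b n)) * t ^+ 2 / 2) = - (lvar b n * t ^+ 2 / 2) + - (sqnorm (b n) * t ^+ 2 / 2)); last by ring.
by rewrite expRD mulrA.
Qed.

Lemma limit_cos b k (T : O -> R) (v t u : R) : measurable_fun setT T ->
  {ae P, forall w, lsum b k n w @[n --> \oo] --> T w} ->
  lvar b n @[n --> \oo] --> v ->
  \int[P]_w cos (t * T w + u) = cos u * expR (- (v * t ^+ 2 / 2)).
Proof.
move=> mT cT cv.
have h1 : \int[P]_w cos (t * lsum b k n w + u) @[n --> \oo] --> \int[P]_w cos (t * T w + u).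
  apply: (@bounded_cvg_Rintegral _ _ _ P _ _ 1).
  - by move=> n; exact: (measurableT_comp (mcos t u) (measurable_lsum b k n)).
  - exact: (measurableT_comp (mcos t u) mT).
  - by [].
  - apply: filterS cT => w H.
    apply: (cvg_comp _ cos); last exact: continuous_cos.
    by apply: (@cvgD _ R^o); [apply: cvgM => //; exact: cvg_cst|exact: cvg_cst].
have h2 : \int[P]_w cos (t * lsum b k n w + u) @[n --> \oo] --> cos u * expR (- (v * t ^+ 2 / 2)).
  under eq_fun do rewrite lsum_cos.
  apply: cvgM; first exact: cvg_cst.
  apply: (cvg_comp _ expR); last exact: continuous_expR.
  apply: (@cvgN _ R^o); apply: cvgM; last exact: cvg_cst.
  by apply: cvgM => //; exact: cvg_cst.
exact: (cvg_unique _ h1 h2).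
Qed.

End linear_sums.

(** * Correlation bounds from the coefficients *)

Section coefficient_bounds.
Context {R : realType} {d : nat}.
Implicit Types (b : nat -> 'I_d -> R).

(** Padding with [e] zeros turns the series at time [k] into one at time [k + e], so two variables
    at different times become series in the same innovations. *)
Definition delay (e : nat) b (l : nat) : 'I_d -> R :=
  if (e <= l)%N then b (l - e)%N else fun=> 0.

Definition inner (x y : 'I_d -> R) : R := \sum_(j < d) x j * y j.

Lemma sqnorm_ge0 (x : 'I_d -> R) : 0 <= sqnorm x.
Proof. by apply: sumr_ge0 => j _; exact: sqr_ge0. Qed.

Lemma sqnormD (a c : R) (x y : 'I_d -> R) :
  sqnorm (fun j => a * x j + c * y j) = a ^+ 2 * sqnorm x + 2 * a * c * inner x y + c ^+ 2 * sqnorm y.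
Proof.
rewrite /sqnorm /inner !big_distrr -!big_split/=; apply: eq_bigr => j _; ring.
Qed.

Lemma inner_le (t : R) (x y : 'I_d -> R) : 0 < t ->
  2 * `|inner x y| <= t * sqnorm x + t^-1 * sqnorm y.
Proof.
move=> t0.
have K s : s ^+ 2 = 1 -> 2 * s * inner x y <= t * sqnorm x + t^-1 * sqnorm y.
  move=> s2; have := sqnorm_ge0 (fun j => 1 * x j + (- s / t) * y j).
  rewrite sqnormD => /(mulr_ge0 (ltW t0)) H.
  have E : t * (1 ^+ 2 * sqnorm x + 2 * 1 * (- s / t) * inner x y + (- s / t) ^+ 2 * sqnorm y) =
     t * sqnorm x - 2 * s * inner x y + s ^+ 2 * (t^-1 * sqnorm y) by field; rewrite gt_eqF.
  by move: H; rewrite E s2 mul1r; lra.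
have h1 := K 1 (expr1n _ _); have h2 := K (-1) (sqrr_sign _ 1).
by case: (ger0P (inner x y)) => _; lra.
Qed.

Lemma lvar_ge b m n : (m <= n)%N -> lvar b m <= lvar b n.
Proof.
move=> mn; rewrite /lvar (big_cat_nat (leq0n m) mn)/= lerDl.
by apply: sumr_ge0 => l _; exact: sqnorm_ge0.
Qed.

Lemma lvar_le_lim b (v : R) n : lvar b n @[n --> \oo] --> v -> lvar b n <= v.
Proof.
move=> bv; apply: (@cvgr_to_ge _ _ _ _ _ _ _ bv).
by near=> m; apply: lvar_ge; near: m; exact: nbhs_infty_ge.
Unshelve. all: by end_near. Qed.

Lemma lvar_delay e b n : lvar (delay e b) n = lvar b (n - e)%N.
Proof.
rewrite /lvar; have [en|ne] := leqP e n; last first.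
  rewrite (eqP (ltnW ne)) [RHS]big_geq// big_nat_cond big1// => l /andP[/andP[_ ln] _].
  by rewrite /delay leqNgt (ltn_trans ln ne)/= /sqnorm big1// => j _; rewrite expr0n.
rewrite (big_cat_nat (leq0n e) en)/= [X in X + _]big_nat_cond [X in X + _]big1 ?add0r; last first.
  move=> l /andP[/andP[_ ln] _].
  by rewrite /delay leqNgt ln/= /sqnorm big1// => j _; rewrite expr0n.
rewrite -{1}[e]add0n big_addn; apply: eq_bigr => l _.
by rewrite /delay leq_addl addnK.
Qed.

Definition lcov b b' n : R := \sum_(0 <= l < n) inner (b l) (b' l).

Lemma lvarD (a c : R) b b' n :
  lvar (fun l j => a * b l j + c * b' l j) n =
  a ^+ 2 * lvar b n + 2 * a * c * lcov b b' n + c ^+ 2 * lvar b' n.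
Proof.
rewrite /lvar /lcov !big_distrr -!big_split/=; apply: eq_bigr => l _; exact: sqnormD.
Qed.

Lemma is_cvg_lcov b b' (v v' : R) : lvar b n @[n --> \oo] --> v -> lvar b' n @[n --> \oo] --> v' ->
  cvgn (lcov b b').
Proof.
move=> bv bv'.
have -> : lcov b b' = series (fun l => inner (b l) (b' l)) by [].
apply: normed_cvg; apply: (@series_le_cvg _ _ (fun l => sqnorm (b l) + sqnorm (b' l))).
- by move=> l; exact: normr_ge0.
- by move=> l; rewrite addr_ge0// sqnorm_ge0.
- move=> l; have := @inner_le 1 (b l) (b' l) ltr01; rewrite invr1 !mul1r.
  have : 0 <= `|inner (b l) (b' l)| by [].
  by rewrite /=; lra.
- apply/cvg_ex; exists (v + v').
  rewrite (_ : series _ = lvar b \+ lvar b'); first exact: cvgD.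
  by apply/funext => n; rewrite /series/= /lvar -big_split.
Qed.

(** The newest innovation enters only the first series, so the part [beta] of its unit variance
    carried at lag 0 does not contribute. The other coefficients have square sum at most [1 - beta],
    and the weight [1 + beta] in [inner_le] produces [1 - beta^2] and [1 / (1 + beta)]. *)
Lemma lcov_delay_le b b' e n (beta : R) : (0 < e)%N -> 0 < beta ->
  lvar b n @[n --> \oo] --> (1 : R) -> lvar b' n @[n --> \oo] --> (1 : R) ->
  beta <= sqnorm (b 0%N) ->
  `|lcov b (delay e b') n| <= (1 - beta ^+ 2 + (1 + beta)^-1) / 2.
Proof.
move=> e0 beta0 b1 b1' bb.
have t0 : 0 < 1 + beta by rewrite addr_gt0.
have rhs0 : 0 <= 1 - beta ^+ 2 + (1 + beta)^-1.
  have be1 : beta <= 1.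
    apply: (le_trans bb); have := lvar_le_lim 1 b1.
    by rewrite /lvar big_nat1.
  have : beta ^+ 2 <= 1 by rewrite expr_le1// ltW.
  have : 0 < (1 + beta)^-1 by rewrite invr_gt0.
  by lra.
case: n => [|n]; first by rewrite /lcov big_geq// normr0 divr_ge0.
rewrite /lcov big_nat_recl//=.
have -> : inner (b 0%N) (delay e b' 0) = 0.
  by rewrite /delay leqNgt e0/= /inner big1// => j _; rewrite mulr0.
rewrite add0r ler_pdivlMr// mulrC.
apply: (le_trans (ler_wpM2l _ (ler_norm_sum _ _ _))) => //.
rewrite big_distrr/=.
apply: (@le_trans _ _ (\sum_(0 <= l < n) ((1 + beta) * sqnorm (b l.+1) + (1 + beta)^-1 * sqnorm (delay e b' l.+1)))).
  by apply: ler_sum => l _; exact: inner_le.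
rewrite big_split/= -!big_distrr/=.
have h1 : \sum_(0 <= l < n) sqnorm (b l.+1) <= 1 - beta.
  have := lvar_le_lim n.+1 b1; rewrite /lvar big_nat_recl//=; lra.
have h2 : \sum_(0 <= l < n) sqnorm (delay e b' l.+1) <= 1.
  have := lvar_le_lim (n.+1 - e)%N b1'; rewrite -lvar_delay /lvar big_nat_recl//=.
  by have := sqnorm_ge0 (delay e b' 0); lra.
have h3 : (1 + beta) * (1 - beta) = 1 - beta ^+ 2 by ring.
rewrite -h3 lerD ?ler_wpM2l ?(ltW t0)// -[leRHS]mulr1 ler_wpM2l//.
by rewrite invr_ge0 ltW.
Qed.

(** Here the gain is at lag 0: whichever sign the inner product has, one of the two lower bounds
    [gamma] shows that twice its size is at most [|b 0|^2 + |b' 0|^2 - gamma]. The remaining lags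
    obey AM-GM. *)
Lemma lcov_le b b' n (gamma : R) : 0 < gamma ->
  lvar b n @[n --> \oo] --> (1 : R) -> lvar b' n @[n --> \oo] --> (1 : R) ->
  gamma <= sqnorm (fun j => 1 * b 0%N j + 1 * b' 0%N j) ->
  gamma <= sqnorm (fun j => 1 * b 0%N j + (-1) * b' 0%N j) -> 
  gamma <= 2 ->
  `|lcov b b' n| <= (2 - gamma) / 2.
Proof.
move=> g0 b1 b1'; rewrite !sqnormD !expr1n => g1 g2 g3.
case: n => [|n]; first by rewrite /lcov big_geq// normr0 divr_ge0 ?subr_ge0.
rewrite /lcov big_nat_recl//= ler_pdivlMr// mulrC.
apply: (le_trans (ler_wpM2l _ (ler_normD _ _))) => //.
rewrite mulrDr.
have h1 := lvar_le_lim n.+1 b1; have h2 := lvar_le_lim n.+1 b1'.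
rewrite /lvar big_nat_recl//= in h1; rewrite /lvar big_nat_recl//= in h2.
have h3 : 2 * `|\sum_(0 <= l < n) inner (b l.+1) (b' l.+1)| <=
    \sum_(0 <= l < n) sqnorm (b l.+1) + \sum_(0 <= l < n) sqnorm (b' l.+1).
  apply: (le_trans (ler_wpM2l _ (ler_norm_sum _ _ _))) => //.
  rewrite big_distrr/= -big_split/=; apply: ler_sum => l _.
  by have := @inner_le 1 (b l.+1) (b' l.+1) ltr01; rewrite invr1 !mul1r.
have h4 : 2 * `|inner (b 0%N) (b' 0%N)| <= sqnorm (b 0%N) + sqnorm (b' 0%N) - gamma.
  by case: (ger0P (inner (b 0%N) (b' 0%N))) => _; lra.
by lra.
Qed.

End coefficient_bounds.

Lemma measure_ae_eq {R : realType} {dO : measure_display} {O : measurableType dO}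
  (P : probability O R) (A B : set O) : measurable A -> measurable B ->
  {ae P, forall w, A w <-> B w} -> P A = P B.
Proof.
move=> mA mB [N [mN N0 sN]].
have half C D : measurable C -> measurable D -> (forall w, C w -> ~ D w -> N w) -> (P C <= P D)%E.
  move=> mC mD CDN; apply: (@le_trans _ _ (P (D `|` N))).
    apply: le_measure; rewrite ?inE//; first exact: measurableU.
    by move=> w Cw; have [|nD] := pselect (D w); [left|right; exact: CDN nD].
  by apply: (le_trans (@measureU2 _ _ _ P _ _ mD mN)); rewrite [X in (_ + X)%E]N0 adde0.
apply/eqP; rewrite eq_le !half//.
- by move=> w Bw nA; apply: sN => /= -[_ /(_ Bw)].
- by move=> w Aw nB; apply: sN => /= -[/(_ Aw)].
Qed.

Section linear_gaussian.
Context {R : realType} {dO : measure_display} {O : measurableType dO} {d : nat}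
  (P : probability O R) (eps : int -> O -> d.-tuple R).
Hypotheses (mE : forall k, measurable_fun setT (eps k)) (indE : mutually_independent P eps)
  (gE : forall k, gaussian_vector P (eps k))
  (cE : forall k, centered_vector P (eps k)) (vE : forall k, identity_covariance P (eps k)).
Implicit Types (b : nat -> 'I_d -> R) (k : int) (n : nat).

Lemma dotD (a c : R) (x y : 'I_d -> R) (z : d.-tuple R) :
  dot (fun j => a * x j + c * y j) z = a * dot x z + c * dot y z.
Proof. by rewrite /dot !big_distrr -big_split/=; apply: eq_bigr => j _; ring. Qed.

Lemma lsumD (a c : R) b b' k n w :
  lsum eps (fun l j => a * b l j + c * b' l j) k n w = a * lsum eps b k n w + c * lsum eps b' k n w.
Proof. by rewrite /lsum !big_distrr -big_split/=; apply: eq_bigr => l _; exact: dotD. Qed.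

Lemma lsum_delay e b k n w : lsum eps (delay e b) (k + e%:Z) n w = lsum eps b k (n - e)%N w.
Proof.
have z0 (z : d.-tuple R) : dot (fun=> 0) z = 0 by rewrite /dot big1// => j _; rewrite mul0r.
rewrite /lsum; have [en|ne] := leqP e n; last first.
  rewrite (eqP (ltnW ne)) [RHS]big_geq// big_nat_cond big1// => l /andP[/andP[_ ln] _].
  by rewrite /delay leqNgt (ltn_trans ln ne)/= z0.
rewrite (big_cat_nat (leq0n e) en)/= [X in X + _]big_nat_cond [X in X + _]big1 ?add0r; last first.
  by move=> l /andP[/andP[_ ln] _]; rewrite /delay leqNgt ln/= z0.
rewrite -{1}[e]add0n big_addn; apply: eq_bigr => l _.
rewrite /delay leq_addl addnK; congr (dot _ (eps _ w)).
by rewrite PoszD; ring.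
Qed.

Lemma lsum_shift b k m n w :
  lsum eps b k (m + n) w = lsum eps b k m w + lsum eps (fun l => b (l + m)%N) (k - m%:Z) n w.
Proof.
rewrite /lsum (big_cat_nat (leq0n m) (leq_addr n m))/=; congr (_ + _).
rewrite -{1}[m]add0n big_addn addKn; apply: eq_bigr => l _.
by congr (dot _ (eps _ w)); rewrite PoszD; ring.
Qed.

Lemma limS_ae b k : {ae P, forall w, cvgn (lsum eps b k ^~ w)} ->
  {ae P, forall w, lsum eps b k n w @[n --> \oo] --> limS eps b k w}.
Proof. by apply: filterS => w /cvg_ex[x Hx]; rewrite (limS_cvg Hx). Qed.

Lemma limS_law b k (v : R) : 0 <= v -> {ae P, forall w, cvgn (lsum eps b k ^~ w)} ->
  lvar b n @[n --> \oo] --> v -> forall B, measurable B ->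
  P (limS eps b k @^-1` B) = normal_law 0 (Num.sqrt v) B.
Proof.
move=> v0 cb bv; apply: cos_law; first exact: measurable_limS.
by move=> t u; rewrite sqr_sqrtr//; exact: (limit_cos mE indE gE cE vE _ _ (measurable_limS mE _ _) (limS_ae cb)).
Qed.

Lemma limS_law1 b k : {ae P, forall w, cvgn (lsum eps b k ^~ w)} ->
  lvar b n @[n --> \oo] --> (1 : R) -> forall B, measurable B ->
  P (limS eps b k @^-1` B) = normal_prob 0 1 B.
Proof.
move=> cb b1 B mB; rewrite (limS_law _ cb b1)// sqrtr1 /normal_law.
by rewrite (negbTE (oner_neq0 R)).
Qed.

(** A linear combination of the two variables is again one series in the innovations, with
    coefficients [a * b + c * delay e b'], so its transform depends only on the limiting
    variance. *)
Lemma limS_pair_cos b b' k e (rho a c u : R) :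
  {ae P, forall w, cvgn (lsum eps b (k + e%:Z) ^~ w)} ->
  {ae P, forall w, cvgn (lsum eps b' k ^~ w)} ->
  lvar b n @[n --> \oo] --> (1 : R) -> lvar b' n @[n --> \oo] --> (1 : R) ->
  lcov b (delay e b') n @[n --> \oo] --> rho ->
  \int[P]_w cos (a * limS eps b (k + e%:Z) w + c * limS eps b' k w + u) =
  cos u * expR (- ((a ^+ 2 + 2 * a * c * rho + c ^+ 2) / 2)).
Proof.
move=> cb cb' b1 b1' br.
pose T w := a * limS eps b (k + e%:Z) w + c * limS eps b' k w.
have mT : measurable_fun setT T.
  by apply: measurable_funD; apply: measurable_funM => //; exact: measurable_limS.
have cT : {ae P, forall w, lsum eps (fun l j => a * b l j + c * delay e b' l j) (k + e%:Z) n w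
    @[n --> \oo] --> T w}.
  apply: filterS2 (limS_ae cb) (limS_ae cb') => w h1 h2.
  under eq_fun do rewrite lsumD lsum_delay.
  apply: (@cvgD _ R^o); first by apply: cvgM => //; exact: cvg_cst.
  apply: cvgM; first exact: cvg_cst.
  by apply: (cvg_comp (fun n => (n - e)%N) (lsum eps b' k ^~ w) _ h2); exact: cvg_subnr.
have cv : lvar (fun l j => a * b l j + c * delay e b' l j) n @[n --> \oo] --> a ^+ 2 * 1 + 2 * a * c * rho + c ^+ 2 * 1.
  under eq_fun do rewrite lvarD lvar_delay.
  apply: (@cvgD _ R^o); first apply: (@cvgD _ R^o).
  - by apply: cvgM => //; exact: cvg_cst.
  - by apply: cvgM => //; exact: cvg_cst.
  - apply: cvgM; first exact: cvg_cst.
    by apply: (cvg_comp (fun n => (n - e)%N) (lvar b') _ b1'); exact: cvg_subnr.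
have := limit_cos mE indE gE cE vE 1 u mT cT cv.
rewrite expr1n !mulr1 => <-; by apply: eq_Rintegral => w _; rewrite mul1r.
Qed.

Lemma limS_pair_bound b b' k e (rho rho0 r : R) (A G : set R) :
  {ae P, forall w, cvgn (lsum eps b (k + e%:Z) ^~ w)} ->
  {ae P, forall w, cvgn (lsum eps b' k ^~ w)} ->
  lvar b n @[n --> \oo] --> (1 : R) -> lvar b' n @[n --> \oo] --> (1 : R) ->
  lcov b (delay e b') n @[n --> \oo] --> rho ->
  `|rho| <= rho0 -> rho0 < 1 -> 0 <= r -> measurable A -> measurable G ->
  (normal_prob 0 1 A <= (expR (- (r ^+ 2 / 2)))%:E)%E ->
  (normal_prob 0 1 G <= (expR (- (r ^+ 2 / 2)))%:E)%E ->
  (P (limS eps b (k + e%:Z) @^-1` A `&` limS eps b' k @^-1` G) <=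
    (9 * (normal_peak (Num.sqrt (1 - rho0 ^+ 2)) * normal_peak 1 / normal_peak (Num.sqrt (1 + rho0)) ^+ 2)
     * expR (- (r ^+ 2 / (1 + rho0))))%:E)%E.
Proof.
move=> cb cb' b1 b1' br rr0 r01 r0 mA mG pA pG.
set X := limS eps b (k + e%:Z); set Y := limS eps b' k.
have mX : measurable_fun setT X by exact: measurable_limS.
have mY : measurable_fun setT Y by exact: measurable_limS.
(* The regression residual: the joint transform of [Z] and [Y] factorises, so they are independent
   and [gaussian_pair_bound] applies to [X = Z + rho * Y]. *)
pose Z w := X w - rho * Y w.
have mZ : measurable_fun setT Z by apply: measurable_funB => //; exact: measurable_funM.
have rho2 : rho ^+ 2 < 1.
  by rewrite -(real_normK (num_real rho)) expr_lt1// (le_lt_trans rr0).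
have s2 : Num.sqrt (1 - rho ^+ 2) ^+ 2 = 1 - rho ^+ 2 by rewrite sqr_sqrtr//; lra.
have H a c u : \int[P]_w cos (a * Z w + c * Y w + u) =
    cos u * expR (- (Num.sqrt (1 - rho ^+ 2) ^+ 2 * a ^+ 2 / 2)) * expR (- (1 ^+ 2 * c ^+ 2 / 2)).
  rewrite -mulrA -expRD s2.
  transitivity (\int[P]_w cos (a * X w + (c - a * rho) * Y w + u)).
    by apply: eq_Rintegral => w _; congr cos; rewrite /Z; ring.
  rewrite (limS_pair_cos a (c - a * rho) u cb cb' b1 b1' br).
  by congr (_ * expR _); field.
have -> : X @^-1` A `&` Y @^-1` G = [set w | A (Z w + rho * Y w) /\ G (Y w)].
  by apply/seteqP; split => w /=; rewrite /Z subrK.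
apply: (gaussian_pair_bound rr0 r01 r0 mY mZ mA mG _ _ _ pA pG).
- exact: limS_law1.
- move=> B mB; rewrite (@cos_law _ _ _ P Z (Num.sqrt (1 - rho ^+ 2)) mZ)//.
    by rewrite /normal_law gt_eqF// sqrtr_gt0; lra.
  move=> t u; have := H t 0 u; rewrite expr0n/= mulr0 mul0r oppr0 expR0 mulr1 => <-.
  by apply: eq_Rintegral => w _; rewrite mul0r addr0.
- exact: (cos_indep mY mZ H).
Qed.

(* X = U + V with U the sum of the m most recent terms and V a small
   function of the past, so that X is nearly independent of the past. *)
Lemma limS_mixing b k m (v : R) (B : set R) (D : set O) (r del : R) :
  {ae P, forall w, cvgn (lsum eps b k ^~ w)} ->
  lvar b n @[n --> \oo] --> (1 : R) ->
  1 - lvar b m <= v ^+ 2 -> 0 < v -> v ^+ 2 <= 2^-1 -> 0 <= r -> 0 <= del ->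
  measurable B -> <<s cylinders eps [set q | q <= k - m%:Z] >> D ->
  `|fine (P (limS eps b k @^-1` B `&` D)) - fine (P (limS eps b k @^-1` B)) * fine (P D)| <=
  fine (P (limS eps b k @^-1` B)) *
    (r ^+ 2 * v ^+ 2 + 2 * r * del + del ^+ 2 + 2 * expR (- (del ^+ 2 / (2 * v ^+ 2)))) + 2 * expR (- (r ^+ 2 / 2)).
Proof.
move=> cb b1 bv v0 v2 r0 del0 mB sD.
pose U := lsum eps b k m; pose V := limS eps (fun l => b (l + m)%N) (k - m%:Z).
pose past := [set q : int | q <= k - m%:Z].
pose recent := [set q : int | k - m%:Z < q].
(* The exact variance of [V]; [v^2] is an upper bound for it, and the error terms increase with the
   variance. *)
pose vv := 1 - lvar b m.
have vv0 : 0 <= vv by rewrite subr_ge0; exact: lvar_le_lim.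
have sv2 : Num.sqrt vv ^+ 2 = vv by rewrite sqr_sqrtr.
have lvb n : lvar (fun l => b (l + m)%N) n = lvar b (m + n) - lvar b m.
  rewrite /lvar (big_cat_nat (leq0n m) (leq_addr n m))/= addrAC subrr add0r.
  by rewrite -{2}[m]add0n big_addn addKn.
have cV : {ae P, forall w, cvgn (lsum eps (fun l => b (l + m)%N) (k - m%:Z) ^~ w)}.
  apply: filterS cb => w /cvg_ex[x Hx]; apply/cvg_ex; exists (x - U w).
  rewrite (_ : (fun n => _) = fun n => lsum eps b k (m + n) w - U w); last first.
    by apply/funext => n; rewrite lsum_shift -/(U w) addrAC subrr add0r.
  apply: (@cvgB _ R^o); last exact: cvg_cst.
  apply: (cvg_comp (fun n => (m + n)%N) (lsum eps b k ^~ w) _ Hx); exact: cvg_addnl.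
have bV : lvar (fun l => b (l + m)%N) n @[n --> \oo] --> vv.
  under eq_fun do rewrite lvb.
  apply: (@cvgB _ R^o); last exact: cvg_cst.
  apply: (cvg_comp (fun n => (m + n)%N) (lvar b) _ b1); exact: cvg_addnl.
have mU : measurable_fun setT U by exact: measurable_lsum.
have mV : measurable_fun setT V by exact: measurable_limS.
have XUV : {ae P, forall w, limS eps b k w = U w + V w}.
  apply: filterS2 (limS_ae cb) (limS_ae cV) => w h1 h2.
  have h1' : lsum eps b k (m + n)%N w @[n --> \oo] --> limS eps b k w.
    by apply: (cvg_comp (fun n => (m + n)%N) (lsum eps b k ^~ w) _ h1); exact: cvg_addnl.
  have h2' : lsum eps b k (m + n)%N w @[n --> \oo] --> U w + V w.
    under eq_fun do rewrite lsum_shift.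
    by apply: (@cvgD _ R^o) => //; exact: cvg_cst.
  exact: (cvg_unique _ h1' h2').
have mXB : measurable (limS eps b k @^-1` B).
  by rewrite -[X in measurable X]setTI; apply: (measurable_limS mE).
have mUV A : measurable A -> measurable [set w | A (U w + V w)].
  by move=> mA; rewrite -[X in measurable X]setTI; apply: (measurable_funD mU mV).
have mD : measurable D by exact: (measurable_sigma_cylinders mE sD).
have XE : P (limS eps b k @^-1` B) = P [set w | B (U w + V w)].
  apply: measure_ae_eq => //; first exact: mUV.
  by apply: filterS XUV => w /= ->.
have XDE : P (limS eps b k @^-1` B `&` D) = P ([set w | B (U w + V w)] `&` D).
  apply: measure_ae_eq => //; [exact: measurableI|by apply: measurableI => //; exact: mUV|].
  by apply: filterS XUV => w /= ->.
have vv2 : vv <= 2^-1 by apply: le_trans v2.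
have lU A : measurable A -> P (U @^-1` A) = normal_prob 0 (Num.sqrt (1 - Num.sqrt vv ^+ 2)) A.
  move=> mA; rewrite sv2 (_ : 1 - vv = lvar b m); last by rewrite /vv; ring.
  have lv : 0 < lvar b m by move: vv2; rewrite /vv; lra.
  rewrite (@cos_law _ _ _ P U (Num.sqrt (lvar b m)) mU)//.
    by rewrite /normal_law gt_eqF// sqrtr_gt0.
  by move=> t u; rewrite sqr_sqrtr ?ltW//; exact: (lsum_cos mE indE gE cE vE).
have lX A : measurable A -> P [set w | A (U w + V w)] = normal_prob 0 1 A.
  move=> mA; rewrite -(limS_law1 cb b1 mA); apply: measure_ae_eq.
  - exact: mUV.
  - by rewrite -[X in measurable X]setTI; apply: (measurable_limS mE).
  - by apply: filterS XUV => w /= ->.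
(* [W] is the identity map onto the same set with the smaller sigma-algebra of the past: freezing it
   conditions on the whole past, and [D] may be any past event. *)
pose T := g_sigma_algebraType (cylinders eps past).
have mW : @measurable_fun _ _ O T setT id.
  by move=> _ C mC; rewrite setTI; exact: (measurable_sigma_cylinders mE mC).
have ind A C : measurable A -> @measurable _ T C -> (P (id @^-1` C `&` U @^-1` A) = P (id @^-1` C) * P (U @^-1` A))%E.
  move=> mA mC; apply: (@sigma_cylinders_indep _ _ _ _ _ _ P eps mE indE past recent) => //.
  - by move=> q; rewrite /past /recent/= => ? ?; lia.
  - by apply: measurable_wrt_preimage => //; apply: lsum_wrt => l lm; rewrite /recent/=; lia.
have mV' : @measurable_fun _ _ T R setT V.
  by apply: limS_wrt => l; rewrite /past/=; lia.
have := @gaussian_mixing R _ _ O T P id U V (Num.sqrt vv) B mW mU mV' mB (sqrtr_ge0 _) _ lU lX ind r del r0 del0 D sD.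
rewrite sv2 => /(_ vv2); rewrite XE XDE => H; apply: (le_trans H).
rewrite lerD2r ler_wpM2l ?fine_ge0// -!addrA lerD//; first by rewrite ler_wpM2l ?sqr_ge0.
rewrite !lerD2l.
have mVd : measurable [set w | del < `|V w|].
  by have := mV measurableT _ (measurable_norm_gt del); rewrite setTI.
rewrite -lee_fin fineK ?fin_num_measure//.
rewrite [X in (X <= _)%E](limS_law vv0 cV bV (measurable_norm_gt del)) /normal_law.
(* If no variance is left, the law of [V] is the point mass at 0 and the event is null. *)
have [s0|s0] := eqVneq (Num.sqrt vv) 0.
  rewrite diracE memNset ?lee_fin ?mulr_ge0 ?expR_ge0//= normr0.
  by apply/negP; rewrite -leNgt.
have sp : 0 < Num.sqrt vv by rewrite lt_neqAle eq_sym s0 sqrtr_ge0.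
apply: (le_trans (normal_tail sp del0)); rewrite lee_fin ler_pM2l// ler_expR lerN2 sv2.
rewrite ler_wpM2l ?sqr_ge0// lef_pV2 ?posrE ?mulr_gt0 ?exprn_gt0//; first by rewrite ler_pM2l.
by rewrite -sv2 exprn_gt0.
Qed.

End linear_gaussian.

(** * Poisson approximation for weakly dependent events *)

Section avoidance.
Context {R : realType} {dO : measure_display} {O : measurableType dO}
  (P : probability O R) (E : nat -> set O).
Hypothesis mE : forall t, measurable (E t).

Definition avoid (t : nat) : set O := [set w | forall s, (s < t)%N -> ~ E s w].

Local Notation pr A := (fine (P A)).

Lemma avoid0 : avoid 0 = setT.
Proof. by apply/seteqP; split. Qed.

Lemma avoidS t : avoid t.+1 = avoid t `\` E t.
Proof.
apply/seteqP; split => w.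
  by move=> H; split=> [s st|]; apply: H => //; exact: ltnW.
by move=> [H nE] s; rewrite ltnS leq_eqVlt => /predU1P[->//|]; exact: H.
Qed.

Lemma measurable_avoid t : measurable (avoid t).
Proof. by elim: t => [|t IH]; rewrite ?avoid0// avoidS; exact: measurableD. Qed.

Let mA := measurable_avoid.

Lemma pr_le (A B : set O) : measurable A -> measurable B -> A `<=` B -> pr A <= pr B.
Proof.
move=> mA' mB AB; rewrite fine_le ?fin_num_measure//.
by apply: le_measure; rewrite ?inE.
Qed.

Lemma pr_setDI (A B : set O) : measurable A -> measurable B -> pr A = pr (A `\` B) + pr (A `&` B).
Proof.
move=> mA' mB; apply/EFin_inj; rewrite EFinD !fineK ?fin_num_measure//; last 2 first.
- exact: measurableI.
- exact: measurableD.
exact: measureDI.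
Qed.

Lemma pr_avoidS t (A : set O) : measurable A ->
  pr (avoid t `&` A) = pr (avoid t.+1 `&` A) + pr (avoid t `&` A `&` E t).
Proof.
move=> mA'; rewrite (pr_setDI (measurableI _ _ (mA t) mA') (mE t)) avoidS; congr (pr _ + _).
by rewrite !setDE setIAC.
Qed.

Lemma pr_avoid_diff u t (A : set O) : measurable A -> (u <= t)%N ->
  0 <= pr (avoid u `&` A) - pr (avoid t `&` A) <= \sum_(u <= s < t) pr (E s `&` A).
Proof.
move=> mA' ut; rewrite -(subnKC ut); elim: (t - u)%N => [|n IH].
  by rewrite addn0 subrr big_geq// lexx.
rewrite addnS big_nat_recr ?leq_addr//=.
have h1 := pr_avoidS (u + n) mA'.
have h2 : pr (avoid (u + n) `&` A `&` E (u + n)%N) <= pr (E (u + n)%N `&` A).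
  apply: pr_le; [by do 2!apply: measurableI => //|exact: measurableI|].
  by move=> w [[_ ?] ?].
have h3 : 0 <= pr (avoid (u + n) `&` A `&` E (u + n)%N) by exact: fine_ge0.
by move: IH => /andP[]; lra.
Qed.

(** Hitting [E t] after avoiding all earlier events has probability [P(E t)] less at most [t * b].
    Summation over [t] gives both the union bound and its second-order correction. *)
Lemma bonferroni n (b : R) : 0 <= b -> (forall s t, (s < t < n)%N -> pr (E s `&` E t) <= b) ->
  0 <= \sum_(0 <= t < n) pr (E t) - (1 - pr (avoid n)) <= n%:R * n%:R * b.
Proof.
move=> b0 H.
have step t : pr (avoid t) = pr (avoid t.+1) + pr (avoid t `&` E t).
  by have := pr_avoidS t measurableT; rewrite !setIT.
have lo t : (t < n)%N -> 0 <= pr (E t) - pr (avoid t `&` E t) <= n%:R * b.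
  move=> tn; have := pr_avoid_diff (mE t) (leq0n t); rewrite avoid0 setTI => /andP[-> /=] h.
  apply: (le_trans h); apply: (@le_trans _ _ (\sum_(0 <= s < t) b)).
    rewrite big_nat_cond [leRHS]big_nat_cond; apply: ler_sum => s /andP[/andP[_ st] _].
    by apply: H; rewrite st.
  by rewrite big_const_nat subn0 iter_addr addr0 -[leLHS]mulr_natl ler_wpM2r ?ler_nat ?(ltnW tn).
have : forall m, (m <= n)%N -> 0 <= \sum_(0 <= t < m) pr (E t) - (1 - pr (avoid m)) <= m%:R * (n%:R * b).
  elim=> [_|m IH mn]; first by rewrite big_geq// avoid0 probability_setT /= subrr subr0 !mul0r lexx.
  rewrite big_nat_recr//= -[m.+1]addn1 natrD mulrDl mul1r addn1.
  have := IH (ltnW mn); have := lo m mn; have := step m.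
  by move=> -> /andP[h1 h2] /andP[h3 h4]; apply/andP; split; lra.
by move=> /(_ n (leqnn n)); rewrite mulrA.
Qed.

Lemma expR_sub_le (p : R) : 0 <= p <= 1 -> 0 <= expR (- p) - (1 - p) <= p ^+ 2.
Proof.
move=> /andP[p0 p1]; have h1 := expR_ge1Dx (- p).
have h2 : expR (- p) <= (1 + p)^-1.
  by rewrite expRN lef_pV2 ?posrE ?expR_gt0 ?ltr_wpDr// expR_ge1Dx.
have h3 : (1 + p)^-1 <= 1 - p + p ^+ 2.
  rewrite -[leLHS]mul1r ler_pdivrMr ?ltr_wpDr//.
  have : 0 <= p ^+ 3 by rewrite exprn_ge0.
  by rewrite !exprS expr0; lra.
by apply/andP; split; lra.
Qed.

(* Telescoping over t: the events before t - W cost the mixing error e p_t + b1,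
   those in the window [t - W, t) the pair error b2 and the square of q. *)
Lemma avoid_poisson (N W : nat) (e b1 b2 q : R) :
  0 <= e -> 0 <= b1 -> 0 <= b2 ->
  (forall t, (t < N)%N ->
    `|pr (E t `&` avoid (t - W)) - pr (E t) * pr (avoid (t - W))| <= e * pr (E t) + b1) ->
  (forall s t, (s < t < N)%N -> (t - W <= s)%N -> pr (E s `&` E t) <= b2) ->
  (forall t, (t < N)%N -> pr (E t) <= q) ->
  `|pr (avoid N) - expR (- \sum_(0 <= t < N) pr (E t))| <=
  e * \sum_(0 <= t < N) pr (E t) + N%:R * (b1 + W%:R * b2 + (W%:R + 1) * q ^+ 2).
Proof.
move=> e0 b10 b20 H1 H2 H3.
set c := b1 + _ + _.
have c0 : 0 <= c.
  apply: addr_ge0; last by apply: mulr_ge0; [exact: addr_ge0|exact: sqr_ge0].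
  by apply: addr_ge0 => //; exact: mulr_ge0.
have f0 (A : set O) : 0 <= pr A by exact: fine_ge0.
have f1 (A : set O) : measurable A -> pr A <= 1.
  by move=> mA'; rewrite -lee_fin fineK ?fin_num_measure// probability_le1.
suff : forall n, (n <= N)%N -> `|pr (avoid n) - expR (- \sum_(0 <= t < n) pr (E t))| <=
   e * \sum_(0 <= t < n) pr (E t) + n%:R * c by apply.
elim=> [_|n IH nN].
  by rewrite big_geq// avoid0 [X in fine X](@probability_setT _ _ _ P) oppr0 expR0 subrr normr0 mulr0 mul0r addr0.
rewrite big_nat_recr//=; set S := \sum_(0 <= t < n) _ in IH *.
have {}IH := IH (ltnW nN).
have step : pr (avoid n) = pr (avoid n.+1) + pr (avoid n `&` E n).
  by have := pr_avoidS n measurableT; rewrite !setIT.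
have nW : (n - W <= n)%N by exact: leq_subr.
have win (F : nat -> R) (x : R) : 0 <= x -> (forall s, (n - W <= s < n)%N -> F s <= x) ->
    \sum_(n - W <= s < n) F s <= W%:R * x.
  move=> x0 Fx; apply: (@le_trans _ _ (\sum_(n - W <= s < n) x)).
    by rewrite big_nat_cond [leRHS]big_nat_cond; apply: ler_sum => s /andP[hs _]; exact: Fx.
  rewrite big_const_nat iter_addr addr0 -[leLHS]mulr_natl ler_wpM2r// ler_nat; lia.
have q0 : 0 <= q by apply: le_trans (H3 n nN).
have d1 := pr_avoid_diff (mE n) nW; have d2 := pr_avoid_diff measurableT nW.
rewrite !setIT in d2.
have w1 : \sum_(n - W <= s < n) pr (E s `&` E n) <= W%:R * b2.
  by apply: win => // s /andP[s1 s2]; apply: H2 => //; rewrite s2.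
have w2 : \sum_(n - W <= s < n) pr (E s `&` setT) <= W%:R * q.
  by apply: win => // s /andP[s1 s2]; rewrite setIT; apply: H3; exact: ltn_trans s2 nN.
have := H1 n nN; rewrite setIC.
have p0 := f0 (E n); have pq := H3 n nN; have p1 := f1 _ (mE n).
have D0 := f0 (avoid n); have D1 := f1 _ (mA n).
have ex := expR_sub_le (introT andP (conj p0 p1)).
have eS0 : 0 <= expR (- S) by exact: expR_ge0.
have eS1 : expR (- S) <= 1.
  by rewrite -[leRHS]expR0 ler_expR oppr_le0 sumr_ge0.
rewrite opprD expRD.
move: d1 d2 step IH ex; set p := pr (E n); set x := pr (avoid (n - W) `&` E n); set y := pr (avoid n `&` E n).
set dw := pr (avoid (n - W)); set dn := pr (avoid n); set eS := expR (- S); set ep := expR (- p).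
rewrite -/p in p0 pq p1 *; rewrite -/dn in D0 D1 *; rewrite -/eS in eS0 eS1 *.
move=> /andP[d11 d12] /andP[d21 d22] step IH /andP[ex1 ex2] HM.
have -> : pr (avoid n.+1) = dn - y by lra.
have pp : p ^+ 2 <= q ^+ 2 by rewrite ler_pXn2r// ?nnegrE.
have pw : p * (dw - dn) <= W%:R * q ^+ 2.
  rewrite expr2 mulrCA; apply: ler_pM => //; first exact: (le_trans d22).
have pw0 : 0 <= p * (dw - dn) by rewrite mulr_ge0.
have A1 : `|dn - y - dn * (1 - p)| <= e * p + b1 + W%:R * b2 + W%:R * q ^+ 2.
  move: HM; rewrite !ler_norml => /andP[m1 m2]; apply/andP; split; lra.
have A2 : `|(dn - eS) * (1 - p)| <= e * S + n%:R * c.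
  rewrite normrM; apply: le_trans IH; rewrite ler_piMr// ler_norml; lra.
have A3 : `|eS * (1 - p - ep)| <= q ^+ 2.
  rewrite normrM (ger0_norm eS0); apply: le_trans pp.
  rewrite -[leRHS]mul1r; apply: ler_pM => //; rewrite ler_norml; lra.
(* One step of the telescoping: the dependence of [E n] on the earlier events, the previous error
   damped by [1 - p], and the difference between [1 - p] and [exp (- p)]. *)
rewrite (_ : dn - y - eS * ep = (dn - y - dn * (1 - p)) + (dn - eS) * (1 - p) + eS * (1 - p - ep)); last by ring.
apply: (le_trans (ler_normD _ _)); apply: (le_trans (lerD (ler_normD _ _) (lexx _))).
rewrite -addn1 natrD /c; move: A1 A2 A3; rewrite /c; lra.
Qed.

End avoidance.

(** * Two-point and mixing estimates for standardised linear processes *)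

Section gaussian_array.
Context {R : realType} {dO : measure_display} {O : measurableType dO} {d : nat}
  (P : probability O R) (eps : int -> O -> d.-tuple R).
Hypotheses (mE : forall k, measurable_fun setT (eps k)) (indE : mutually_independent P eps)
  (gE : forall k, gaussian_vector P (eps k))
  (cE : forall k, centered_vector P (eps k)) (vE : forall k, identity_covariance P (eps k)).
Variable (b : 'I_d -> nat -> 'I_d -> R).
Hypotheses (cb : forall i k, {ae P, forall w, cvgn (lsum eps (b i) k ^~ w)})
  (b1 : forall i, lvar (b i) n @[n --> \oo] --> (1 : R)).
Variables (beta gamma : R).
Hypotheses (beta0 : 0 < beta) (gamma0 : 0 < gamma) (gamma2 : gamma <= 2).
Hypotheses (bbeta : forall i, beta <= sqnorm (b i 0%N))
  (bgammaD : forall i j, i != j -> gamma <= sqnorm (fun l => 1 * b i 0%N l + 1 * b j 0%N l))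
  (bgammaB : forall i j, i != j -> gamma <= sqnorm (fun l => 1 * b i 0%N l + (-1) * b j 0%N l)).
Hypothesis btail : forall i, ln (n.+1%:R) * (1 - lvar (b i) n) @[n --> \oo] --> (0 : R).

Local Notation X i k := (limS eps (b i) k).
Local Notation pr A := (fine (P A)).
Local Notation N1 A := (fine (normal_prob (0 : R) 1 A)).

(* Bounds |corr| between distinct variables: the first term, by AM-GM with weight
   1 + beta, at positive lags; the second, from |b_i(0) +- b_j(0)|^2 >= gamma, at
   lag 0. *)
Definition corr_bound : R := Num.max ((1 - beta ^+ 2 + (1 + beta)^-1) / 2) ((2 - gamma) / 2).

Lemma corr_bound_lt1 : (0 < d)%N -> 0 <= corr_bound < 1.
Proof.
move=> d0; pose i0 := Ordinal d0; have hb := beta0; have hg := gamma0; have hg2 := gamma2.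
have be1 : beta <= 1.
  apply: (le_trans (bbeta i0)); have := lvar_le_lim 1 (b1 i0).
  by rewrite /lvar big_nat1.
have B2 : beta ^+ 2 <= 1 by rewrite expr_le1// ltW.
have B0 : 0 < beta ^+ 2 by rewrite exprn_gt0.
have I1 : (1 + beta)^-1 < 1 by rewrite invf_lt1; lra.
rewrite /corr_bound gt_max le_max; apply/andP; split; first by apply/orP; right; lra.
by apply/andP; split; lra.
Qed.

Let limS_pair_delay i j (k : int) (e : nat) (r : R) (A G : set R) : (0 < d)%N ->
  ((0 < e)%N || (i != j)) -> 0 <= r -> measurable A -> measurable G ->
  (normal_prob 0 1 A <= (expR (- (r ^+ 2 / 2)))%:E)%E ->
  (normal_prob 0 1 G <= (expR (- (r ^+ 2 / 2)))%:E)%E ->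
  (P (X i (k + e%:Z) @^-1` A `&` X j k @^-1` G) <=
    (9 * (normal_peak (Num.sqrt (1 - corr_bound ^+ 2)) * normal_peak 1 / normal_peak (Num.sqrt (1 + corr_bound)) ^+ 2)
     * expR (- (r ^+ 2 / (1 + corr_bound))))%:E)%E.
Proof.
move=> d0 ij r0 mA mG pA pG; have /andP[c0 c1] := corr_bound_lt1 d0.
have bd : lvar (delay e (b j)) n @[n --> \oo] --> (1 : R).
  under eq_fun do rewrite lvar_delay.
  by apply: (cvg_comp (fun n => (n - e)%N) (lvar (b j)) _ (@b1 j)); exact: cvg_subnr.
have /cvg_ex[rho Hrho] := is_cvg_lcov (b1 i) bd.
apply: (limS_pair_bound mE indE gE cE vE (cb i _) (cb j _) (b1 i) (b1 j) Hrho _ c1 r0 mA mG pA pG).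
apply: (@cvgr_to_le _ _ _ _ _ _ _ (cvg_norm Hrho)); apply: nearW => n.
rewrite /corr_bound le_max; case/orP: ij => [e0|ij].
  by rewrite lcov_delay_le.
case: (posnP e) => [->|e0]; last by rewrite lcov_delay_le.
apply/orP; right.
have -> : delay 0 (b j) = b j by apply/funext => l; rewrite /delay leq0n subn0.
by apply: lcov_le => //; [exact: bgammaD|exact: bgammaB].
Qed.

Lemma limS_pair : (0 < d)%N -> exists C h : R, [/\ 0 < C, 0 < h <= 1 &
  forall (i j : 'I_d) (k k' : int) (A G : set R) (p : R), (i, k) != (j, k') -> 0 < p <= 1 -> measurable A -> measurable G ->
    N1 A <= p -> N1 G <= p -> pr (X i k @^-1` A `&` X j k' @^-1` G) <= C * p `^ (1 + h)].
Proof.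
move=> d0; have /andP[c0 c1] := corr_bound_lt1 d0.
set c := corr_bound in c0 c1.
pose C := 9 * (normal_peak (Num.sqrt (1 - c ^+ 2)) * normal_peak 1 / normal_peak (Num.sqrt (1 + c)) ^+ 2).
have c2 : c ^+ 2 < 1 by rewrite expr_lt1.
have C0 : 0 < C.
  have np (x : R) : 0 < x -> 0 < normal_peak (Num.sqrt x).
    by move=> x0; rewrite normal_peak_gt0// gt_eqF// sqrtr_gt0.
  have n1 : 0 < normal_peak (1 : R) by rewrite normal_peak_gt0// oner_eq0.
  by rewrite mulr_gt0// divr_gt0// ?mulr_gt0// ?exprn_gt0// np//; lra.
(* For [p = exp (- r^2 / 2)] the bound [exp (- r^2 / (1 + c))] is the power [2 / (1 + c)] of [p],
   and this exponent exceeds 1 because [c < 1]. *)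
exists C; exists (2 / (1 + c) - 1 : R); split; [exact: C0| |].
  have c10 : 0 < 1 + c by lra.
  by rewrite subr_gt0 ltr_pdivlMr// lerBlDr ler_pdivrMr//; apply/andP; split; lra.
have main (i j : 'I_d) (k : int) (e : nat) (A G : set R) (p : R) : ((0 < e)%N || (i != j)) -> 0 < p <= 1 -> measurable A -> measurable G ->
    N1 A <= p -> N1 G <= p -> pr (X i (k + e%:Z) @^-1` A `&` X j k @^-1` G) <= C * p `^ (2 / (1 + c)).
  move=> ij /andP[p0 p1] mA mG pA pG.
  pose r := Num.sqrt (- 2 * ln p).
  have lp : 0 <= - 2 * ln p by rewrite mulNr -mulrN mulr_ge0// oppr_ge0 ln_le0.
  have r2 : r ^+ 2 = - 2 * ln p by rewrite sqr_sqrtr.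
  have er : expR (- (r ^+ 2 / 2)) = p.
    by rewrite r2 (_ : - _ = ln p) ?lnK//; by field.
  have fN (S : set R) : measurable S -> normal_prob 0 1 S \is a fin_num.
    by move=> mS; exact: (@fin_num_measure _ _ _ (normal_prob 0 1)).
  have pA' : (normal_prob 0 1 A <= (expR (- (r ^+ 2 / 2)))%:E)%E by rewrite er -[leLHS]fineK ?lee_fin ?fN.
  have pG' : (normal_prob 0 1 G <= (expR (- (r ^+ 2 / 2)))%:E)%E by rewrite er -[leLHS]fineK ?lee_fin ?fN.
  have := limS_pair_delay k d0 ij (sqrtr_ge0 _) mA mG pA' pG'.
  have mI : measurable (X i (k + e%:Z) @^-1` A `&` X j k @^-1` G).
    apply: measurableI; rewrite -[Y in measurable Y]setTI.
      exact: (measurable_limS mE _ _ measurableT mA).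
    exact: (measurable_limS mE _ _ measurableT mG).
  rewrite -[Y in (Y <= _)%E]fineK ?fin_num_measure// lee_fin -/c -/C => H; apply: (le_trans H).
  rewrite ler_pM2l// /powR gt_eqF// ler_expR r2 le_eqVlt; apply/orP; left; apply/eqP.
  by field; rewrite gt_eqF//; lra.
move=> i j k k' A G p ijk p01 mA mG pA pG.
rewrite (_ : 1 + _ = 2 / (1 + c)); last by ring.
case: (leP k' k) => kk.
  have := main i j k' `|k - k'|%N A G p; rewrite gez0_abs ?subr_ge0// (addrC k') subrK; apply => //.
  by move: ijk; rewrite xpair_eqE negb_and absz_gt0 subr_eq0 orbC.
rewrite setIC; have := main j i k `|k' - k|%N G A p.
rewrite gez0_abs ?subr_ge0 ?(ltW kk)// (addrC k) subrK; apply => //.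
by rewrite absz_gt0 subr_eq0 (gt_eqF kk).
Qed.

Definition lag (h : R) n := Num.truncn ((n%:R : R) `^ h).

(** [btail] is used at the index [lag h n]. As [n^h < lag h n + 1], [h * ln n] is at most
    [ln (lag h n + 1)], so shortening the window from [n] to [n^h] costs only the constant factor
    [1 / h]. *)
Lemma tail_lag (h kappa : R) : 0 < h -> 0 < kappa ->
  \forall n \near \oo, forall i, 1 - lvar (b i) (lag h n) <= kappa / ln (n%:R : R).
Proof.
move=> h0 k0; apply: filter_forall => i.
have hk0 : 0 < h * kappa by exact: mulr_gt0.
have lagoo : lag h n @[n --> \oo] --> \oo.
  apply/cvgnyPge => A; near=> n.
  rewrite /lag truncn_ge_nat ?powR_ge0//.
  rewrite -[leLHS]powRr1 ?ler0n// -[Y in _ `^ Y](mulVf (lt0r_neq0 h0)) powRrM.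
  rewrite ge0_ler_powR ?nnegrE ?powR_ge0 ?ler0n ?(ltW h0)//.
  by near: n; exact: nbhs_infty_ger.
have := cvg_comp _ _ lagoo (btail i); move/cvgrPdist_lt => /(_ _ hk0); apply: filterS2 (nbhs_infty_gt 1).
move=> n n1; rewrite /= sub0r normrN => H.
have nr1 : (1 : R) < n%:R by rewrite ltr1n.
have ln0 : 0 < ln (n%:R : R) by rewrite ln_gt0.
rewrite ler_pdivlMr//; have := le_lt_trans (ler_norm _) H.
have v0 : 0 <= 1 - lvar (b i) (lag h n) by rewrite subr_ge0; exact: lvar_le_lim.
move=> {}H; rewrite -(ler_pM2l h0); apply: le_trans (ltW H).
rewrite mulrCA mulrC ler_wpM2r// -ln_powR ler_ln ?posrE ?powR_gt0 ?ltr0n ?(ltn_trans _ n1)//.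
by rewrite ltW// /lag truncnS_gt.
Unshelve. all: by end_near. Qed.

Lemma limS_mix (h e : R) : 0 < h -> 0 < e ->
  \forall n \near \oo, forall (i : 'I_d) (k : int) (B : set R) (D : set O), measurable B ->
    <<s cylinders eps [set q | q <= k - (lag h n)%:Z] >> D ->
    `|pr (X i k @^-1` B `&` D) - pr (X i k @^-1` B) * pr D| <=
    e * pr (X i k @^-1` B) + 2 / n%:R ^+ 2.
Proof.
move=> h0 e0.
(* The relative error has four terms: [r^2 v^2 = 4 q^4], [2 r del = 4 q], [del^2 <= q] and a normal
   tail of at most [4 q]; in all at most [13 q]. *)
pose q := Num.min 1 (e / 13).
have q0 : 0 < q by rewrite lt_min ltr01 divr_gt0.
have q1 : q <= 1 by rewrite ge_min lexx.
have qe : 13 * q <= e by rewrite mulrC -ler_pdivlMr// ge_min lexx orbT.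
pose kappa := q ^+ 4.
have k0 : 0 < kappa by exact: exprn_gt0.
near=> n => i k B D mB sD.
have n3 : (3 <= n)%N by near: n; exact: nbhs_infty_ge.
have n0 : 0 < (n%:R : R) by rewrite ltr0n; apply: leq_trans n3.
have ln2 : 2 <= ln (n%:R : R).
  rewrite -[leLHS]expRK ler_ln ?posrE ?expR_gt0//.
  near: n; exact: nbhs_infty_ger.
have ln0 : 0 < ln (n%:R : R) by lra.
have tl : 1 - lvar (b i) (lag h n) <= kappa / ln (n%:R : R).
  move: i; near: n; exact: tail_lag.
(* [r^2 = 4 ln n] makes the absolute error [2 / n^2]. The cut-off [del] is [1 / q] times [v], so
   large values of [V] are rare, and still so small that [r * del = 2 q]. *)
pose v := Num.sqrt (kappa / ln (n%:R : R)); pose r := 2 * Num.sqrt (ln (n%:R : R)); pose del := q / Num.sqrt (ln (n%:R : R)).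
have v2 : v ^+ 2 = kappa / ln (n%:R : R) by rewrite sqr_sqrtr// divr_ge0// ltW.
have v0 : 0 < v by rewrite sqrtr_gt0 divr_gt0.
have r2 : r ^+ 2 = 4 * ln (n%:R : R) by rewrite exprMn sqr_sqrtr ?ltW// -natrX.
have sl0 : 0 < Num.sqrt (ln (n%:R : R)) by rewrite sqrtr_gt0.
have d2 : del ^+ 2 = q ^+ 2 / ln (n%:R : R) by rewrite exprMn exprVn sqr_sqrtr ?ltW.
have r0 : 0 <= r by rewrite mulr_ge0// ltW.
have del0 : 0 <= del by rewrite divr_ge0// ltW.
have kq : kappa <= 1 by rewrite exprn_ile1// ltW.
have vh : v ^+ 2 <= 2^-1.
  by rewrite v2 ler_pdivrMr//; lra.
have tl' : 1 - lvar (b i) (lag h n) <= v ^+ 2 by rewrite v2.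
have := limS_mixing mE indE gE cE vE (cb i k) (b1 i) tl' v0 vh r0 del0 mB sD.
move=> H; apply: (le_trans H); apply: lerD; last first.
  rewrite ler_pM2l// r2 (_ : - _ = - (2%:R * ln (n%:R : R))); last by field.
  by rewrite expRN expRM_natl lnK ?posrE//.
rewrite mulrC ler_wpM2r ?fine_ge0//; apply: le_trans qe.
have -> : r ^+ 2 * v ^+ 2 = 4 * kappa by rewrite r2 v2; field; rewrite gt_eqF.
have -> : 2 * r * del = 4 * q by rewrite /r /del; field; rewrite gt_eqF.
have h1 : del ^+ 2 <= q.
  by rewrite d2 ler_pdivrMr// expr2 ler_pM2l//; lra.
have h2 : 4 * kappa <= 4 * q.
  by rewrite ler_pM2l// /kappa exprS ler_piMr ?(ltW q0)// exprn_ile1// ltW.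
have h3 : 2 * expR (- (del ^+ 2 / (2 * v ^+ 2))) <= 4 * q.
  rewrite d2 v2 (_ : _ / (2 * _) = (2 * q ^+ 2)^-1); last first.
    by rewrite /kappa; field; rewrite !gt_eqF.
  rewrite expRN (_ : 4 * q = 2 * (2 * q)); last by ring.
  rewrite ler_pM2l//; apply: (@le_trans _ _ (2 * q ^+ 2)).
    rewrite -[leRHS]invrK lef_pV2 ?posrE ?expR_gt0 ?invr_gt0 ?mulr_gt0 ?exprn_gt0//.
    by have := expR_ge1Dx (2 * q ^+ 2)^-1; lra.
  by rewrite ler_pM2l// expr2 ler_piMr// ltW.
lra.
Unshelve. all: by end_near. Qed.

End gaussian_array.

Lemma cvg_powRN {R : realType} (h : R) : 0 < h -> (n%:R : R) `^ (- h) @[n --> \oo] --> (0 : R).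
Proof.
move=> h0; apply/cvgrPdist_le => e e0; near=> n.
have n0 : (0 : R) < n%:R by rewrite ltr0n; near: n; exact: nbhs_infty_gt.
rewrite sub0r normrN ger0_norm ?powR_ge0//.
have en : n%:R `^ (- 1) <= e `^ h^-1.
  rewrite powR_inv1 ?ler0n// -[leRHS]invrK lef_pV2 ?posrE ?invr_gt0 ?powR_gt0//.
  by near: n; exact: nbhs_infty_ger.
rewrite -mulN1r powRrM -[leRHS]powRr1 ?(ltW e0)// -[Y in _ <= _ `^ Y](mulVf (lt0r_neq0 h0)) powRrM.
by rewrite ge0_ler_powR ?nnegrE ?powR_ge0 ?(ltW h0).
Unshelve. all: by end_near. Qed.

Lemma cvg_sum_seq {R : realType} {T : Type} (F : set_system T) {FF : Filter F} (I : eqType) (r : seq I)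
    (f : I -> T -> R) (l : I -> R) :
  (forall i, i \in r -> f i x @[x --> F] --> l i) ->
  \sum_(i <- r) f i x @[x --> F] --> \sum_(i <- r) l i.
Proof.
move=> H; rewrite [Y in _ --> Y]big_seq; under eq_fun do rewrite big_seq.
by apply: (cvg_big (@add_continuous R)).
Qed.

(** * Poisson limit for standardised linear processes *)

Section extremes.
Context {R : realType} {dO : measure_display} {O : measurableType dO} {d : nat}
  (P : probability O R) (X : 'I_d -> int -> O -> R).
Hypotheses (d0 : (0 < d)%N) (mX : forall i k, measurable_fun setT (X i k))
  (lX : forall i k B, measurable B -> P (X i k @^-1` B) = normal_prob (0 : R) 1 B).

Local Notation pr A := (fine (P A)).
Local Notation N1 A := (fine (normal_prob (0 : R) 1 A)).

Variables (C h : R).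
Hypotheses (C0 : 0 < C) (h01 : 0 < h <= 1)
  (pairX : forall (i j : 'I_d) (k k' : int) (A G : set R) (p : R),
    (i, k) != (j, k') -> 0 < p <= 1 -> measurable A -> measurable G ->
    N1 A <= p -> N1 G <= p -> pr (X i k @^-1` A `&` X j k' @^-1` G) <= C * p `^ (1 + h)).

(** Stands for the events generated by the innovations up to a given time; the closure properties
    are those that put [avoid] into it. *)
Variable past : int -> set (set O).
Hypotheses (pastT : forall k, past k setT)
  (pastI : forall k (D : set O) i (k' : int) (B : set R), k' <= k -> past k D ->
    measurable B -> past k (D `&` X i k' @^-1` B)).
Hypothesis mixX : forall g e : R, 0 < g -> 0 < e ->
  \forall n \near \oo, forall i (k : int) (B : set R) D, measurable B ->
    past (k - (lag g n)%:Z) D ->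
    `|pr (X i k @^-1` B `&` D) - pr (X i k @^-1` B) * pr D| <=
    e * pr (X i k @^-1` B) + 2 / n%:R ^+ 2.

Variables (B : nat -> 'I_d -> set R) (lam : 'I_d -> R).
Hypotheses (mB : forall n j, measurable (B n j))
  (cB : forall j, n%:R * N1 (B n j) @[n --> \oo] --> lam j).

(** The pairs (time, component) are listed time by time from time 1 on, [d] indices each; a window
    of [m] times is then a window of [m * d] indices, and everything before it lies in the past. *)
Let idx (t : nat) : 'I_d := Ordinal (ltn_pmod t d0).
Let time (t : nat) : int := (t %/ d).+1%:Z.
Let E n t := X (idx t) (time t) @^-1` (B n (idx t)).

Let mE n t : measurable (E n t).
Proof. by have := mX (idx t) (time t) measurableT (mB n (idx t)); rewrite setTI. Qed.

Let prE n t : pr (E n t) = N1 (B n (idx t)).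
Proof. by rewrite /E lX. Qed.

Let sum_idx (F : 'I_d -> R) n : \sum_(0 <= t < n * d) F (idx t) = n%:R * \sum_(j < d) F j.
Proof.
elim: n => [|n IH]; first by rewrite mul0n big_geq// mul0r.
rewrite mulSn addnC (big_cat_nat (leq0n (n * d)) (leq_addr _ _)) IH -natr1 mulrDl mul1r; congr (_ + _).
rewrite -[Y in \sum_(Y <= _ < _) _]add0n big_addn addKn big_mkord; apply: eq_bigr => j _.
by congr F; apply: val_inj; rewrite /= addnC modnMDl modn_small.
Qed.

Let past_avoid n r k : (forall s, (s < r)%N -> time s <= k) -> past k (avoid (E n) r).
Proof.
elim: r => [|r IH] H; first by rewrite avoid0.
rewrite avoidS /E setDE preimage_setC; apply: pastI; [exact: H| |exact: measurableC].
by apply: IH => s sr; apply: H; exact: ltnW.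
Qed.

Lemma avoid_cvg : pr (avoid (E n) (n * d)) @[n --> \oo] --> expR (- \sum_j lam j).
Proof.
have hh := h01; have hC := C0; case/andP: hh => h0 h1.
(* Half of the gain [h] is spent on the window: with length [n^(h/2)] and probabilities of order
   [1/n], pairs inside windows cost [n * n^(h/2) * n^(-1-h)] and squares cost [n^(h/2 - 1)], both at
   most [n^(-h/2)] as [h <= 1]. *)
have g0 : 0 < h / 2 by rewrite divr_gt0.
have cS : n%:R * \sum_j N1 (B n j) @[n --> \oo] --> \sum_j lam j.
  under eq_fun do rewrite mulr_sumr.
  by apply: cvg_sum_seq => j _; exact: cB.
have cE : expR (- (n%:R * \sum_j N1 (B n j))) @[n --> \oo] --> expR (- \sum_j lam j).
  by apply: (continuous_cvg _ (@continuous_expR R _)); exact: cvgN.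
suff H : pr (avoid (E n) (n * d)) - expR (- (n%:R * \sum_j N1 (B n j))) @[n --> \oo] --> (0 : R).
  rewrite -[Y in _ --> Y]add0r.
  by apply: cvg_trans (cvgD H cE); apply: near_eq_cvg; apply: nearW => n /=; rewrite subrK.
pose S := \sum_j lam j + 1.
have S0 : 0 < S.
  rewrite ltr_wpDl//; apply: sumr_ge0 => j _.
  apply: (@cvgr_to_ge _ _ _ _ _ _ _ (@cB j)); apply: nearW => n.
  by rewrite mulr_ge0// fine_ge0.
pose K := \sum_j (`|lam j| + 1) + 1.
have K1 : 1 <= K.
  by rewrite lerDr; apply: sumr_ge0 => j _; rewrite addr_ge0.
have K0 : 0 < K by lra.
have nB : \forall n \near \oo, forall j, n%:R * N1 (B n j) <= K.
  apply: filter_forall => j.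
  have lK : lam j < K.
    apply: (@le_lt_trans _ _ `|lam j|); first exact: ler_norm.
    rewrite /K (bigD1 j)//= -!addrA ltrDl ltr_wpDr//.
    by rewrite addr_ge0//; apply: sumr_ge0 => i _; rewrite addr_ge0.
  by apply: (cvgr_le _ (@cB j)).
(* The three terms belong to the absolute mixing error, the pairs inside a window and the squared
   probabilities. *)
pose D := 2 * d%:R + C * (d%:R ^+ 2) * K `^ (1 + h) + d%:R * (d%:R + 1) * K ^+ 2.
have cD : D * n%:R `^ (- (h / 2)) @[n --> \oo] --> (0 : R).
  by rewrite -[Y in _ --> Y](mulr0 D); apply: cvgM (cvg_cst _) _; exact: cvg_powRN.
apply/cvgrPdist_le => e e0; rewrite /=.
have e'0 : 0 < e / 2 / S by rewrite !divr_gt0.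
near=> n; rewrite sub0r normrN.
have n0 : (0 < n)%N by near: n; exact: nbhs_infty_gt.
have n0r : 0 < (n%:R : R) by rewrite ltr0n.
have n1r : 1 <= (n%:R : R) by rewrite ler1n.
have Kn : K <= n%:R by near: n; exact: nbhs_infty_ger.
have hB j : N1 (B n j) <= K / n%:R.
  rewrite ler_pdivlMr// mulrC; move: j.
  by near: n.
have hS : n%:R * \sum_j N1 (B n j) <= S.
  near: n; apply: (cvgr_le _ cS).
  by rewrite /S ltrDl.
have hD : D * n%:R `^ (- (h / 2)) <= e / 2.
  by near: n; apply: (cvgr_le _ cD); rewrite divr_gt0.
have mixn : forall i (k : int) (G : set R) D, measurable G ->
    past (k - (lag (h / 2) n)%:Z) D ->
    `|pr (X i k @^-1` G `&` D) - pr (X i k @^-1` G) * pr D| <=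
    e / 2 / S * pr (X i k @^-1` G) + 2 / n%:R ^+ 2.
  by near: n; exact: mixX.
pose m := lag (h / 2) n.
have hm : (m%:R : R) <= n%:R `^ (h / 2) by rewrite /m /lag truncn_le powR_ge0.
have q01 : 0 < K / n%:R <= 1 by rewrite divr_gt0//= ler_pdivrMr// mul1r.
have := @avoid_poisson _ _ _ P (E n) (mE n) (n * d) (m * d) (e / 2 / S) (2 / n%:R ^+ 2)
  (C * (K / n%:R) `^ (1 + h)) (K / n%:R) (ltW e'0).
have sumE : \sum_(0 <= t < n * d) pr (E n t) = n%:R * \sum_j N1 (B n j).
  by rewrite -sum_idx; apply: eq_bigr => t _; rewrite prE.
rewrite sumE => H; apply: (le_trans (H _ _ _ _ _)) => {H}.
- by rewrite divr_ge0// exprn_ge0.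
- by rewrite mulr_ge0 ?powR_ge0// ltW.
- move=> t tn; apply: mixn; first exact: mB.
  apply: past_avoid => s st; rewrite /time -/m.
  have h2 : (s %/ d + m <= t %/ d)%N.
    rewrite leq_divRL// mulnDl; apply: (@leq_trans (s + m * d)); first by rewrite leq_add2r leq_divM.
    by rewrite ltnW// -ltn_subRL; move: st; rewrite ltn_subRL addnC -ltn_subRL.
  by rewrite lerBrDr -PoszD lez_nat addSn ltnS.
- move=> s t /andP[st tn] _; rewrite /E; apply: pairX => //.
  by apply/eqP => -[] mst dst; move: st; rewrite (divn_eq s d) (divn_eq t d) dst mst ltnn.
- by move=> t _; rewrite prE.
rewrite [leRHS]splitr; apply: lerD.
  apply: (@le_trans _ _ (e / 2 / S * S)); first by rewrite ler_pM2l.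
  by rewrite divfK// gt_eqF.
apply: le_trans hD; rewrite powRN.
set x : R := n%:R in n0r n1r q01 hm *; set y := x `^ (h / 2) in hm *.
have y1 : 1 <= y by rewrite -[leLHS](powRr0 x) ler_powR// ltW.
have y0 : 0 < y by lra.
have yy : x `^ h = y ^+ 2 by rewrite expr2 -powRD ?gt_eqF// ?implybT// -splitr.
have y2 : y ^+ 2 <= x by rewrite -yy -[leRHS]powRr1 ?(ltW n0r)// ler_powR.
have -> : (K / x) `^ (1 + h) = K `^ (1 + h) / (x * y ^+ 2).
  rewrite powRM ?invr_ge0 ?(ltW K0) ?(ltW n0r)//; congr (_ * _).
  rewrite -[Y in Y `^ _](powR_inv1 (ltW n0r)) -powRrM mulN1r powRN powRD ?(gt_eqF n0r) ?implybT//.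
  by rewrite powRr1 ?(ltW n0r)// yy.
rewrite !natrM /D.
set M : R := m%:R in hm *; set Kp := K `^ (1 + h); set dd : R := d%:R.
have M0 : 0 <= M by exact: ler0n.
have dd0 : 0 <= dd by exact: ler0n.
have Kp0 : 0 <= Kp by exact: powR_ge0.
have t1 : x^-1 <= y^-1 by rewrite lef_pV2 ?posrE//; nra.
have t2 : M / y ^+ 2 <= y^-1.
  by rewrite ler_pdivrMr ?exprn_gt0// expr2 mulKf ?gt_eqF.
have t3 : (M * dd + 1) / x <= (dd + 1) / y.
  apply: (@le_trans _ _ ((M * dd + 1) / y ^+ 2)).
    by rewrite ler_wpM2l ?addr_ge0 ?mulr_ge0// lef_pV2 ?posrE ?exprn_gt0.
  rewrite ler_pdivrMr ?exprn_gt0// expr2 mulrA divfK ?gt_eqF//; nra.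
have -> : x * dd * (2 / x ^+ 2 + M * dd * (C * (Kp / (x * y ^+ 2))) + (M * dd + 1) * (K / x) ^+ 2)
   = 2 * dd * x^-1 + C * dd ^+ 2 * Kp * (M / y ^+ 2) + dd * K ^+ 2 * ((M * dd + 1) / x).
  by field; rewrite !gt_eqF.
have -> : (2 * dd + C * dd ^+ 2 * Kp + dd * (dd + 1) * K ^+ 2) / y
   = 2 * dd * y^-1 + C * dd ^+ 2 * Kp * y^-1 + dd * K ^+ 2 * ((dd + 1) / y).
  by field; rewrite gt_eqF.
by apply: lerD; [apply: lerD|]; apply: ler_wpM2l; rewrite ?mulr_ge0 ?sqr_ge0// ltW.
Unshelve. all: by end_near. Qed.

Lemma avoid_all_cvg :
  pr [set w | forall (k : nat) j, (1 <= k <= n)%N -> ~ B n j (X j k%:Z w)] @[n --> \oo]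
    --> expR (- \sum_j lam j).
Proof.
apply: cvg_trans avoid_cvg; apply: near_eq_cvg; apply: nearW => n.
congr (fine (P _)); apply/seteqP; split => w /= H.
  move=> k j /andP[k1 kn]; have := H (k.-1 * d + j)%N.
  rewrite /E /idx /time /preimage /=.
  have -> : Ordinal (ltn_pmod (k.-1 * d + j) d0) = j by apply: val_inj; rewrite /= modnMDl modn_small.
  rewrite divnMDl// divn_small// addn0 prednK//; apply.
  apply: (@leq_trans (k.-1 * d + d)%N); first by rewrite ltn_add2l.
  by rewrite addnC -mulSn prednK// leq_mul2r kn orbT.
by move=> t tn; apply: H; rewrite /= ltn_divLR.
Qed.

End extremes.

(** * Regularly varying tails and moving maxima *)

Section regular_tail.
Context {R : realType} (F L : R -> R) (alpha : R).
Hypotheses (a0 : 0 < alpha) (Lsv : slowly_varying L)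
  (FE : forall u : R, 0 < u -> F u = u `^ (- alpha) * L u)
  (Fni : forall u v : R, 0 < u -> u <= v -> F v <= F u).

(** Positivity of [L] is given near infinity; monotonicity of [F] carries it down to every level. *)
Lemma tail_gt0 u : 0 < u -> 0 < F u.
Proof.
move=> u0; have [_ Lp _] := Lsv.
have [v [v0 uv Lv]] : exists v, [/\ 0 < v, u <= v & 0 < L v].
  near (pinfty_nbhs R) => v; exists v; split; last by near: v.
    by near: v; exact: nbhs_pinfty_gt.
  by near: v; apply: nbhs_pinfty_ge; rewrite num_real.
by apply: lt_le_trans (Fni u0 uv); rewrite FE// mulr_gt0// powR_gt0.
Unshelve. all: by end_near. Qed.

Lemma tail_ratio t : 0 < t -> F (t * x) / F x @[x --> +oo] --> t `^ (- alpha).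
Proof.
move=> t0; have [_ Lp /(_ t t0) Lt] := Lsv.
rewrite -[Y in _ --> Y]mulr1.
apply: cvg_trans (cvgM (cvg_cst (t `^ (- alpha))) Lt); apply: near_eq_cvg; near=> x.
have x0 : 0 < x by near: x; exact: nbhs_pinfty_gt.
have Lx : 0 < L x by near: x.
rewrite /= !FE ?mulr_gt0// powRM ?ltW//.
have px : 0 < x `^ (- alpha) by exact: powR_gt0.
by field; rewrite !gt_eqF.
Unshelve. all: by end_near. Qed.

Lemma tail_doubling (beta : R) : beta < alpha ->
  exists2 x0, 0 < x0 & forall k x, x0 <= x -> F (2 ^+ k * x) <= 2 `^ (- beta) ^+ k * F x.
Proof.
move=> ba.
have h2 : 2 `^ (- alpha) < 2 `^ (- beta) :> R.
  by rewrite /powR pnatr_eq0/= ltr_expR ltr_pM2r ?ln_gt0 ?ltr1n// ltrN2.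
have [x0 [x0r H]] := cvgr_le _ (tail_ratio (ltr0n R 2)) _ h2.
have x10 : 0 < Num.max 1 (x0 + 1) by rewrite lt_max ltr01.
exists (Num.max 1 (x0 + 1)) => // k x xx.
elim: k => [|k IH]; first by rewrite !expr0 !mul1r.
have x1 : 1 <= x by move: xx; rewrite ge_max => /andP[].
have x2 : 1 <= 2 ^+ k :> R by rewrite exprn_ege1// ler1n.
have xk : x <= 2 ^+ k * x by rewrite ler_peMl//; lra.
have xk0 : 0 < 2 ^+ k * x by rewrite mulr_gt0//; lra.
have : F (2 * (2 ^+ k * x)) / F (2 ^+ k * x) <= 2 `^ (- beta).
  by apply: H; move: xx; rewrite ge_max => /andP[_]; lra.
rewrite ler_pdivrMr ?tail_gt0// mulrA -exprS => h; apply: (le_trans h).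
by rewrite exprS -mulrA ler_pM2l// powR_gt0.
Qed.

(** Potter's upper bound for weights up to 1. Putting [1/c] between [2^k] and [2^(k+1)] loses the
    factor [2^beta]; only the limit of the ratio at 2 is used, iterated, so no uniform convergence
    in slow variation is involved. *)
Lemma tail_potter1 (beta : R) : 0 < beta < alpha ->
  exists2 x0, 0 < x0 & forall c x, x0 <= x -> 0 < c <= 1 -> F (x / c) <= 2 `^ beta * c `^ beta * F x.
Proof.
move=> /andP[b0 ba]; have [x0 x00 H] := tail_doubling ba.
exists x0 => // c x xx /andP[c0 c1].
have xp : 0 < x by lra.
have ci : 1 <= c^-1 by rewrite invf_ge1.
pose n := Num.truncn c^-1; pose k := trunc_log 2 n.
have n0 : (0 < n)%N by rewrite truncn_ge_nat// invr_ge0 ltW.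
have /andP[k1 k2] : (2 ^ k <= n < 2 ^ k.+1)%N by exact: trunc_log_bounds.
have k1r : 2 ^+ k <= c^-1.
  by rewrite -natrX -truncn_ge_nat// invr_ge0 ltW.
have k2r : c^-1 <= 2 ^+ k.+1.
  by apply: (le_trans (ltW (truncnS_gt _))); rewrite -natrX ler_nat.
apply: (@le_trans _ _ (F (2 ^+ k * x))).
  apply: Fni; first by rewrite mulr_gt0// exprn_gt0.
  by rewrite mulrC ler_pM2l.
apply: (le_trans (H k x xx)); rewrite ler_pM2r ?tail_gt0//.
have -> : 2 `^ (- beta) ^+ k = ((2 ^+ k) `^ beta)^-1 :> R.
  rewrite powRN exprVn; congr (_^-1).
  by rewrite -powR_mulrn ?powR_ge0// -powRrM mulrC powRrM powR_mulrn.
have p2 : 0 < 2 ^+ k :> R by rewrite exprn_gt0.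
rewrite -[leLHS]mul1r ler_pdivrMr ?powR_gt0// -!powRM ?mulr_ge0 ?(ltW c0) ?(ltW p2)//.
rewrite [leLHS](_ : 1 = 1 `^ beta); last by rewrite powR1.
rewrite ge0_ler_powR ?nnegrE ?(ltW b0) ?mulr_ge0 ?(ltW c0) ?(ltW p2)//.
by move: k2r; rewrite -(ler_pM2l c0) mulfV ?gt_eqF// exprS mulrA (mulrC c).
Qed.

(** Larger weights are reduced to the previous case by dividing both [x] and [c] by [cmax]; the
    ratio [F (x / cmax) / F x] is eventually at most [cmax^alpha + 1]. *)
Lemma tail_potter (beta cmax : R) : 0 < beta < alpha -> 0 < cmax ->
  exists2 K, 0 < K & \forall x \near +oo, forall c, 0 < c <= cmax -> F (x / c) <= K * c `^ beta * F x.
Proof.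
move=> bb c0; have [x0 x00 H] := tail_potter1 bb.
have cp : 0 < cmax `^ beta by exact: powR_gt0.
exists (2 `^ beta * (cmax `^ beta)^-1 * (cmax `^ alpha + 1)).
  by rewrite !mulr_gt0// ?invr_gt0 ?powR_gt0// ltr_wpDl// powR_ge0.
have ci : 0 < cmax^-1 by rewrite invr_gt0.
have := cvgr_le _ (tail_ratio ci) (cmax `^ alpha + 1).
rewrite -[Y in Y `^ _ < _](powR_inv1 (ltW c0)) -powRrM mulN1r opprK ltrDl => /(_ _ ltr01) R1.
near=> x => c /andP[cp0 cc].
have xp : 0 < x by near: x; exact: nbhs_pinfty_gt.
have xx0 : x0 <= x / cmax.
  by rewrite ler_pdivlMr//; near: x; apply: nbhs_pinfty_ge; rewrite num_real.
have r1 : F (x / cmax) <= (cmax `^ alpha + 1) * F x.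
  by rewrite -ler_pdivrMr ?tail_gt0// (mulrC x); near: x; exact: R1.
have := H (c / cmax) (x / cmax) xx0; rewrite divr_gt0// ler_pdivrMr// mul1r cc => /(_ isT).
rewrite (_ : x / cmax / (c / cmax) = x / c); last by field; rewrite !gt_eqF.
move=> h; apply: (le_trans h).
rewrite powRM ?invr_ge0 ?(ltW c0) ?(ltW cp0)// -[Y in _ * Y `^ _](powR_inv1 (ltW c0)) -powRrM mulN1r powRN.
apply: (@le_trans _ _ (2 `^ beta * (c `^ beta / cmax `^ beta) * ((cmax `^ alpha + 1) * F x))).
  by rewrite ler_wpM2l// !mulr_ge0 ?powR_ge0// invr_ge0 powR_ge0.
by rewrite le_eqVlt; apply/orP; left; apply/eqP; field; rewrite gt_eqF.
Unshelve. all: by end_near. Qed.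

Lemma tail_cvg0 : F x @[x --> +oo] --> (0 : R).
Proof.
have hb : 0 < alpha / 2 < alpha by have h := a0; apply/andP; split; lra.
have [x0 x00 H] := tail_potter1 hb; have /andP[b0 _] := hb.
pose K := 2 `^ (alpha / 2) * x0 `^ (alpha / 2) * F x0.
have K0 : 0 < K by rewrite !mulr_gt0 ?powR_gt0 ?tail_gt0.
apply/cvgrPdist_le => e e0; near=> x.
have xp : 0 < x by near: x; exact: nbhs_pinfty_gt.
have xx : x0 <= x by near: x; apply: nbhs_pinfty_ge; rewrite num_real.
rewrite sub0r normrN gtr0_norm ?tail_gt0//.
(* Potter's bound started at the fixed level [x0], with [c = x0 / x], gives polynomial decay of
   [F x]. *)
have := H (x0 / x) x0 (lexx _); rewrite divr_gt0// ler_pdivrMr// mul1r xx => /(_ isT).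
rewrite (_ : x0 / (x0 / x) = x); last by field; rewrite !gt_eqF.
move=> h; apply: (le_trans h).
rewrite powRM ?invr_ge0 ?(ltW x00) ?(ltW xp)// -[Y in _ * Y `^ _](powR_inv1 (ltW xp)) -powRrM mulN1r powRN.
rewrite (_ : _ * F x0 = K / x `^ (alpha / 2)); last by rewrite /K; field; rewrite gt_eqF ?powR_gt0.
rewrite ler_pdivrMr ?powR_gt0// mulrC -ler_pdivrMr//.
have Ke : 0 < K / e by exact: divr_gt0.
rewrite -[leLHS]powRr1 ?(ltW Ke)// -[Y in _ `^ Y <= _](mulVf (lt0r_neq0 b0)) [leLHS]powRrM.
rewrite ge0_ler_powR ?nnegrE ?powR_ge0 ?(ltW b0) ?(ltW xp)//.
Unshelve. all: by end_near. Qed.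

End regular_tail.

Lemma cvg_sum_limn {R : realType} (b : nat -> R) : (forall t, 0 <= b t) -> cvgn (series b) ->
  forall m n, (m <= n)%N -> \sum_(m <= t < n) b t <= limn (series b) - series b m.
Proof.
move=> b0 cb m n mn; rewrite lerBrDl /series/= -(big_cat_nat (leq0n m) mn).
apply: (@nondecreasing_cvgn_le _ (series b)) => // i j ij.
by rewrite /series/= (big_cat_nat (leq0n i) ij)/= lerDl sumr_ge0.
Qed.

(** * Asymptotic probability of a countable union *)

Section union_limit.
Context {R : realType} {dO : measure_display} {O : measurableType dO} (P : probability O R).
Local Notation pr A := (fine (P A)).

Lemma pr_setC (A : set O) : measurable A -> pr (~` A) = 1 - pr A.
Proof. by move=> mA; rewrite probability_setC// -[Y in (_ - Y)%E]fineK ?fin_num_measure. Qed.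

Lemma pr_avoid_cvg (E : nat -> set O) : (forall t, measurable (E t)) ->
  1 - pr (avoid E N) @[N --> \oo] --> pr (\bigcup_t E t).
Proof.
move=> mE; have mA := measurable_avoid mE.
have -> : \bigcup_t E t = \bigcup_N ~` avoid E N.
  apply/seteqP; split => w; first by move=> [t _ Et]; exists t.+1 => //= /(_ t (ltnSn _)).
  move=> [N _ /= /existsNP[t /not_implyP[_ /contrapT Et]]]; by exists t.
have mC N : measurable (~` avoid E N) by exact: measurableC.
have H : {homo (fun N => ~` avoid E N) : n m / (n <= m)%N >-> (n <= m)%O}.
  move=> n m nm; apply/subsetPset; apply: subsetC => x Ex s sn; apply: Ex.
  exact: leq_trans sn nm.
have mU : measurable (\bigcup_N ~` avoid E N) by exact: bigcup_measurable.
have := nondecreasing_cvg_mu (mu := P) mC mU H.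
rewrite -[Y in _ --> Y]fineK ?fin_num_measure// => /fine_cvg; apply: cvg_trans.
apply: near_eq_cvg; apply: nearW => N /=.
by rewrite pr_setC.
Qed.

Lemma pr_bigcup_le (E : nat -> set O) c : (forall t, measurable (E t)) ->
  (forall N, \sum_(0 <= t < N) pr (E t) <= c) -> pr (\bigcup_t E t) <= c.
Proof.
move=> mE H; apply: (@cvgr_to_le _ _ _ _ _ _ _ (pr_avoid_cvg mE)); apply: nearW => N.
apply: le_trans (H N).
(* With the trivial bound 1 on pairs only the first inequality is kept, which is the union bound. *)
have := @bonferroni _ _ _ P E mE N 1 ler01; case/(_ _)/andP; last by rewrite subr_ge0.
move=> s t _; rewrite -lee_fin fineK ?fin_num_measure//; last exact: measurableI.
by apply: probability_le1; exact: measurableI.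
Qed.

Section cvg.
Variables (E : nat -> nat -> set O) (T : nat -> R) (w b : nat -> R).
Hypotheses (mE : forall n t, measurable (E n t)) (T0 : \forall n \near \oo, 0 < T n)
  (cw : forall t, T n * pr (E n t) @[n --> \oo] --> w t)
  (leb : \forall n \near \oo, forall t, T n * pr (E n t) <= b t)
  (cb : cvgn (series b))
  (cpair : forall s t, (s < t)%N -> T n * pr (E n s `&` E n t) @[n --> \oo] --> (0 : R)).

Lemma union_limit_ge0 t : 0 <= w t.
Proof.
apply: (@cvgr_to_ge _ _ _ _ _ _ _ (@cw t)); near=> n.
by rewrite mulr_ge0 ?fine_ge0// ltW//; near: n.
Unshelve. all: by end_near. Qed.

Lemma union_limit_le t : w t <= b t.
Proof.
apply: (@cvgr_to_le _ _ _ _ _ _ _ (@cw t)); near=> n.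
by move: t; near: n.
Unshelve. all: by end_near. Qed.

Let b0 t : 0 <= b t.
Proof. exact: le_trans (union_limit_ge0 t) (union_limit_le t). Qed.

Lemma union_limit_cvg : cvgn (series w).
Proof. exact: series_le_cvg union_limit_ge0 b0 union_limit_le cb. Qed.

(** Dominated convergence for sums: beyond [N] the bound [b] makes the union bound small uniformly
    in [n], and among the first [N] sets the Bonferroni correction vanishes in the limit. *)
Lemma union_limit : T n * pr (\bigcup_t E n t) @[n --> \oo] --> limn (series w).
Proof.
have cw' := union_limit_cvg.
apply/cvgrPdist_le => e e0.
have e4 : 0 < e / 4 by rewrite divr_gt0.
have [N HN] : exists N, limn (series b) - series b N <= e / 4.
  have /cvgrPdist_le/(_ _ e4)[N _ H] := cb.
  by exists N; apply: (le_trans (ler_norm _)); exact: (H N (leqnn N)).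
have HwN : 0 <= limn (series w) - series w N <= e / 4.
  apply/andP; split.
    have := cvg_sum_limn union_limit_ge0 cw' (leqnn N); by rewrite big_geq.
  apply: le_trans HN; rewrite lerBlDr.
  apply: (limr_le cw'); exists N => // M /= NM.
  rewrite -lerBlDr /series/= (big_cat_nat (leq0n N) NM)/= addrAC subrr add0r.
  by apply: le_trans (cvg_sum_limn b0 cb NM); apply: ler_sum => t _; exact: union_limit_le.
(* The sum of all pair probabilities serves as the common pair bound in [bonferroni]. *)
pose bet n := \sum_(0 <= t < N) \sum_(0 <= s < t) pr (E n s `&` E n t).
have cbet0 : T n * bet n @[n --> \oo] --> (0 : R).
  rewrite [Y in _ --> Y](_ : 0 = \sum_(0 <= t < N) \sum_(0 <= s < t) (0 : R)); last first.
    by rewrite big1// => ? _; rewrite big1.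
  under eq_fun do rewrite mulr_sumr; apply: cvg_sum_seq => t _.
  under eq_fun do rewrite mulr_sumr; apply: cvg_sum_seq => s; rewrite mem_index_iota => st.
  exact: cpair.
have cbet : N%:R * N%:R * (T n * bet n) @[n --> \oo] --> (0 : R).
  by rewrite -[Y in _ --> Y](mulr0 (N%:R * N%:R)); exact: cvgM (cvg_cst _) cbet0.
have cS : \sum_(0 <= t < N) T n * pr (E n t) @[n --> \oo] --> series w N.
  by apply: cvg_sum_seq => t _; exact: cw.
near=> n.
have Tn0 : 0 < T n by near: n.
have bn : forall t, T n * pr (E n t) <= b t by near: n.
have h1 : `|series w N - \sum_(0 <= t < N) T n * pr (E n t)| <= e / 4.
  by near: n; move/cvgrPdist_le: cS; apply.
have h2 : N%:R * N%:R * (T n * bet n) <= e / 4 by near: n; exact: (cvgr_le _ cbet).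
have bet0 : 0 <= bet n by do 2!(apply: sumr_ge0 => ? _); exact: fine_ge0.
have up : pr (\bigcup_t E n t) <= (\sum_(0 <= t < N) T n * pr (E n t) + e / 4) / T n.
  apply: pr_bigcup_le => // N'; rewrite ler_pdivlMr// mulrC mulr_sumr.
  apply: (@le_trans _ _ (\sum_(0 <= t < maxn N N') T n * pr (E n t))).
    rewrite [leRHS](big_cat_nat (leq0n N') (leq_maxr _ _))/= lerDl sumr_ge0// => t _.
    by rewrite mulr_ge0 ?fine_ge0// ltW.
  rewrite (big_cat_nat (leq0n N) (leq_maxl _ _))/= lerD2l; apply: le_trans HN.
  apply: le_trans (cvg_sum_limn b0 cb (leq_maxl N N')); exact: ler_sum.
have lo : \sum_(0 <= t < N) pr (E n t) - N%:R * N%:R * bet n <= pr (\bigcup_t E n t).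
  have /andP[_] : 0 <= \sum_(0 <= t < N) pr (E n t) - (1 - pr (avoid (E n) N)) <= N%:R * N%:R * bet n.
    apply: bonferroni => // s t /andP[st tN]; rewrite /bet (bigD1_seq t) ?mem_index_iota ?iota_uniq//=.
    rewrite (bigD1_seq s) ?mem_index_iota ?iota_uniq//= -addrA lerDl addr_ge0 ?sumr_ge0// => ? _.
      exact: fine_ge0.
    by rewrite sumr_ge0// => ? _; exact: fine_ge0.
  have mA : measurable (avoid (E n) N) by exact: measurable_avoid.
  have mU : measurable (\bigcup_t E n t) by exact: bigcup_measurable.
  have : 1 - pr (avoid (E n) N) <= pr (\bigcup_t E n t).
    rewrite -pr_setC//; apply: pr_le => //; first exact: measurableC.
    by move=> o /= /existsNP[t /not_implyP[_ /contrapT Et]]; exists t.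
  by lra.
move: up; rewrite ler_pdivlMr// mulrC => up.
move: lo; rewrite -(ler_pM2l Tn0) mulrBr mulr_sumr (mulrCA (T n)) => lo.
rewrite ler_norml; move: h1; rewrite ler_norml => /andP[h3 h4]; case/andP: HwN => h5 h6.
by apply/andP; split; lra.
Unshelve. all: by end_near. Qed.

End cvg.
End union_limit.

(** * Limits of maxima, nested level sets and elementary probability bounds *)

Lemma cvg_maxr {R : realType} {T : Type} (F : set_system T) {FF : Filter F} (f g : T -> R) (x y : R) :
  f t @[t --> F] --> x -> g t @[t --> F] --> y ->
  Num.max (f t) (g t) @[t --> F] --> Num.max x y.
Proof.
move=> fx gy; rewrite maxr_absE; under eq_fun do rewrite maxr_absE.
by apply: cvgM; [apply: cvgD; [exact: cvgD|apply: cvg_norm; exact: cvgB]|exact: cvg_cst].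
Qed.

Lemma cvg_bigmaxr {R : realType} {T : Type} (F : set_system T) {FF : Filter F} (I : Type) (r : seq I)
    (Q : pred I) (f : I -> T -> R) (l : I -> R) :
  (forall i, f i x @[x --> F] --> l i) ->
  \big[Num.max/0]_(i <- r | Q i) f i x @[x --> F] --> \big[Num.max/0]_(i <- r | Q i) l i.
Proof.
move=> H; elim: r => [|i r IH].
  by rewrite big_nil; under eq_fun do rewrite big_nil; exact: cvg_cst.
rewrite big_cons; under eq_fun do rewrite big_cons.
by case: (Q i) => //; exact: cvg_maxr.
Qed.

Lemma bigmaxr_pMr {R : realType} (I : Type) (r : seq I) (Q : pred I) (f : I -> R) (x : R) : 0 <= x ->
  x * \big[Num.max/0]_(i <- r | Q i) f i = \big[Num.max/0]_(i <- r | Q i) (x * f i).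
Proof.
move=> x0; apply: (big_morph (fun y => x * y)); last by rewrite mulr0.
by move=> y z; rewrite maxr_pMr.
Qed.

(** Upward closed for the preorder induced by [g]; any two such sets are comparable, even when [g]
    is not monotone and they are not half-lines. *)
Definition upper_level {R : realType} (g : R -> R) (S : set R) :=
  forall x y, S x -> g x <= g y -> S y.

Lemma upper_level_comparable {R : realType} (g : R -> R) S T :
  upper_level g S -> upper_level g T -> S `<=` T \/ T `<=` S.
Proof.
move=> uS uT; case: (pselect (S `<=` T)) => [|/existsNP[x /not_implyP[Sx nTx]]]; [by left|right].
move=> y Ty; apply: (uS x) => //; rewrite leNgt; apply/negP => yx; apply: nTx.
by apply: (uT y) => //; exact: ltW.
Qed.

Lemma upper_level_set0 {R : realType} (g : R -> R) : upper_level g set0.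
Proof. by []. Qed.

Lemma upper_levelU {R : realType} (g : R -> R) S T :
  upper_level g S -> upper_level g T -> upper_level g (S `|` T).
Proof. by move=> uS uT x y [Sx|Tx] xy; [left; exact: (uS x)|right; exact: (uT x)]. Qed.

Section pr_misc.
Context {R : realType} {dO : measure_display} {O : measurableType dO} (P : probability O R).
Local Notation pr A := (fine (P A)).

Lemma pr_symdiff (A B C : set O) : measurable A -> measurable B -> measurable C ->
  (forall w, ~ C w -> (A w <-> B w)) -> `|pr A - pr B| <= pr C.
Proof.
move=> mA mB mC H.
have AB : pr (A `\` C) = pr (B `\` C).
  by congr (fine (P _)); apply/seteqP; split => w [Aw Cw]; split => //; apply/H.
have := pr_setDI P mA mC; have := pr_setDI P mB mC; rewrite AB => -> ->.
have h1 : pr (A `&` C) <= pr C by apply: pr_le => //; exact: measurableI.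
have h2 : pr (B `&` C) <= pr C by apply: pr_le => //; exact: measurableI.
have h3 : 0 <= pr (A `&` C) by exact: fine_ge0.
have h4 : 0 <= pr (B `&` C) by exact: fine_ge0.
by rewrite ler_norml; apply/andP; split; lra.
Qed.

Lemma pr_exists_le (A : nat -> set O) n : (forall k, measurable (A k)) ->
  pr [set w | exists2 k, (k < n)%N & A k w] <= \sum_(0 <= k < n) pr (A k).
Proof.
move=> mA; have mv := measurable_avoid mA n.
rewrite (_ : [set _ | _] = ~` avoid A n); last first.
  apply/seteqP; split => w; first by move=> [k kn Ak] /(_ k kn).
  by move=> /existsNP[k /not_implyP[kn /contrapT Ak]]; exists k.
rewrite pr_setC//.
have := @bonferroni _ _ _ P A mA n 1 ler01; case/(_ _)/andP; last by rewrite subr_ge0.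
move=> s t _; rewrite -lee_fin fineK ?fin_num_measure//; last exact: measurableI.
by apply: probability_le1; exact: measurableI.
Qed.

Lemma measurable_exists (A : nat -> set O) (Q : set nat) : (forall k, measurable (A k)) ->
  measurable [set w | exists2 k, Q k & A k w].
Proof.
move=> mA; rewrite (_ : [set _ | _] = \bigcup_(k in Q) A k); last first.
  by apply/seteqP; split => w [k Qk Ak]; exists k.
exact: bigcup_measurable.
Qed.

Lemma pr_setU_le (A B : set O) : measurable A -> measurable B -> pr (A `|` B) <= pr A + pr B.
Proof.
move=> mA mB; rewrite -lee_fin EFinD !fineK ?fin_num_measure//; last exact: measurableU.
exact: measureU2.
Qed.

Lemma pr_bigsetU_le (I : Type) (r : seq I) (A : I -> set O) : (forall i, measurable (A i)) ->
  pr (\big[setU/set0]_(i <- r) A i) <= \sum_(i <- r) pr (A i).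
Proof.
move=> mA; elim: r => [|i r IH]; first by rewrite !big_nil measure0.
rewrite !big_cons; apply: le_trans (pr_setU_le _ _) _ => //; first exact: bigsetU_measurable.
by rewrite lerD2l.
Qed.

End pr_misc.

Lemma nested_max {R : realType} (mu : probability (measurableTypeR R) R) (g : R -> R) (I : Type) (r : seq I)
    (Q : pred I) (S : I -> set R) :
  (forall i, measurable (S i)) -> (forall i, upper_level g (S i)) ->
  fine (mu (\big[setU/set0]_(i <- r | Q i) S i)) = \big[Num.max/0]_(i <- r | Q i) fine (mu (S i)).
Proof.
move=> mS uS; elim: r => [|i r IH]; first by rewrite !big_nil measure0.
rewrite !big_cons; case: (Q i) => //; rewrite -IH.
set T := \big[setU/set0]_(j <- r | Q j) S j.
have mT : measurable T by exact: bigsetU_measurable.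
have uT : upper_level g T.
  by apply: big_ind => [|? ? ? ?|j _]; [exact: upper_level_set0|exact: upper_levelU|].
have le (A B : set R) : measurable A -> measurable B -> A `<=` B -> fine (mu A) <= fine (mu B).
  by move=> mA mB AB; exact: pr_le.
case: (upper_level_comparable (uS i) uT) => H.
  by rewrite (setUidr H) max_r//; exact: le.
by rewrite (setUidl H) max_l//; exact: le.
Qed.

Lemma cvg_powR0 {R : realType} (h : R) (p : nat -> R) : 0 < h -> (\forall n \near \oo, 0 <= p n) ->
  p n @[n --> \oo] --> (0 : R) -> p n `^ h @[n --> \oo] --> (0 : R).
Proof.
move=> h0 p0 cp; apply/cvgrPdist_le => e e0.
have eh : 0 < e `^ h^-1 by exact: powR_gt0.
near=> n.
have pn : 0 <= p n by near: n.
rewrite sub0r normrN ger0_norm ?powR_ge0//.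
rewrite -[leRHS]powRr1 ?(ltW e0)// -[Y in _ <= _ `^ Y](mulVf (lt0r_neq0 h0)) [leRHS]powRrM.
rewrite ge0_ler_powR ?nnegrE ?powR_ge0 ?(ltW h0)//.
by near: n; exact: (cvgr_le _ cp _ eh).
Unshelve. all: by end_near. Qed.

Lemma cvgy_near {R : realType} (v : nat -> R) (Q : R -> Prop) : v n @[n --> \oo] --> +oo ->
  (\forall x \near +oo, Q x) -> \forall n \near \oo, Q (v n).
Proof. by move=> voo; exact: voo. Qed.

Lemma cvgy_gt0 {R : realType} (v : nat -> R) : v n @[n --> \oo] --> +oo ->
  \forall n \near \oo, 0 < v n.
Proof. by move=> voo; apply: (cvgy_near (Q := fun x => 0 < x) voo); exact: nbhs_pinfty_gt. Qed.

Lemma bigmaxr_le_sum {R : realType} (I : finType) (f : I -> R) : (forall i, 0 <= f i) ->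
  \big[Num.max/0]_i f i <= \sum_i f i.
Proof.
move=> f0; apply: bigmax_le => [|i _]; first exact: sumr_ge0.
by rewrite (bigD1 i)//= lerDl sumr_ge0.
Qed.

(** * Exceedances and thresholds of the moving maxima *)

Section levels.
Context {R : realType} {dO : measure_display} {O : measurableType dO} {d : nat}
  (P : probability O R) (X : 'I_d -> int -> O -> R).
Hypotheses (mX : forall i k, measurable_fun setT (X i k))
  (lX : forall i k B, measurable B -> P (X i k @^-1` B) = normal_prob (0 : R) 1 B).

Local Notation pr A := (fine (P A)).
Local Notation N1 A := (fine (normal_prob (0 : R) 1 A)).

Variables (C h : R).
Hypotheses (C0 : 0 < C) (h01 : 0 < h <= 1)
  (pairX : forall (i j : 'I_d) (k k' : int) (A G : set R) (p : R),
    (i, k) != (j, k') -> 0 < p <= 1 -> measurable A -> measurable G ->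
    N1 A <= p -> N1 G <= p -> pr (X i k @^-1` A `&` X j k' @^-1` G) <= C * p `^ (1 + h)).

(** [T * p] stays bounded, so what remains of the pair bound is the extra factor [p^h], which tends
    to 0. *)
Lemma pair_cvg0 (i j : 'I_d) (k k' : int) (A G : nat -> set R) (T p : nat -> R) (K : R) :
  (i, k) != (j, k') -> (forall n, measurable (A n)) -> (forall n, measurable (G n)) ->
  (\forall n \near \oo, 0 < T n) -> (\forall n \near \oo, 0 < p n) ->
  (\forall n \near \oo, T n * p n <= K) -> p n @[n --> \oo] --> (0 : R) ->
  (\forall n \near \oo, N1 (A n) <= p n) -> (\forall n \near \oo, N1 (G n) <= p n) ->
  T n * pr (X i k @^-1` A n `&` X j k' @^-1` G n) @[n --> \oo] --> (0 : R).
Proof.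
move=> ijk mA mG T0 p0 TpK cp pA pG; have /andP[h0 h1] := h01.
have cph : C * K * p n `^ h @[n --> \oo] --> (0 : R).
  rewrite -[Y in _ --> Y](mulr0 (C * K)); apply: cvgM; first exact: cvg_cst.
  by apply: cvg_powR0 => //; near=> n; apply/ltW; near: n.
apply: squeeze_cvgr (cvg_cst 0) cph; near=> n.
have Tn : 0 < T n by near: n.
have pn : 0 < p n by near: n.
have Tp : T n * p n <= K by near: n.
rewrite mulr_ge0 ?fine_ge0 ?(ltW Tn)//=.
have p1 : p n <= 1 by near: n; exact: (cvgr_le _ cp _ ltr01).
have H : pr (X i k @^-1` A n `&` X j k' @^-1` G n) <= C * p n `^ (1 + h).
  apply: pairX => //; first by rewrite pn.
    by near: n.
  by near: n.
apply: (@le_trans _ _ (T n * (C * p n `^ (1 + h)))); first by rewrite ler_pM2l.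
rewrite powRD ?(gt_eqF pn) ?implybT// powRr1 ?(ltW pn)//.
rewrite (_ : _ * _ = (T n * p n) * (C * p n `^ h)); last by ring.
rewrite (_ : C * K * _ = K * (C * p n `^ h)); last by ring.
by rewrite ler_wpM2r// mulr_ge0 ?powR_ge0// ltW.
Unshelve. all: by end_near. Qed.

Variables (hh : 'I_d -> R -> R) (F L : R -> R) (alpha : R).
Hypotheses (mhh : forall j, measurable_fun setT (hh j)) (d0 : (0 < d)%N)
  (HF : forall j (u : R), 0 < u -> N1 [set x | u < hh j x] = F u)
  (a0 : 0 < alpha) (Lsv : slowly_varying L)
  (FE : forall u : R, 0 < u -> F u = u `^ (- alpha) * L u).

Definition level (v a : R) (j : 'I_d) : set R := [set x | v < a * hh j x].

Lemma measurable_level v a j : measurable (level v a j).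
Proof.
rewrite /level (_ : [set _ | _] = (fun x => a * hh j x) @^-1` `]v, +oo[); last first.
  by apply/seteqP; split => x /=; rewrite in_itv/= andbT.
have m : measurable_fun setT (fun x => a * hh j x) by exact: measurable_funM.
by have := m measurableT _ (measurable_itv `]v, +oo[); rewrite setTI.
Qed.

Lemma upper_level_level v a j : 0 <= a -> upper_level (hh j) (level v a j).
Proof. by move=> a_ge0 x y; rewrite /level /= => H xy; apply: (lt_le_trans H); exact: ler_wpM2l. Qed.

Lemma F_nonincreasing (u v : R) : 0 < u -> u <= v -> F v <= F u.
Proof.
move=> u0 uv; have v0 : 0 < v by exact: lt_le_trans uv.
have m (w : R) : measurable [set x | w < hh (Ordinal d0) x].
  by have := measurable_level w 1 (Ordinal d0); rewrite /level; under eq_set do rewrite mul1r.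
rewrite -!(HF (Ordinal d0))//; apply: (pr_le (normal_prob (0 : R) 1)); [exact: m|exact: m|].
by move=> x /=; exact: le_lt_trans.
Qed.

Lemma level_mass v a j : 0 < v -> 0 <= a -> N1 (level v a j) = if 0 < a then F (v / a) else 0.
Proof.
move=> v0; rewrite le_eqVlt => /predU1P[<-|a_gt0].
  rewrite ltxx /level (_ : [set _ | _] = set0) ?measure0//.
  by apply/seteqP; split => // x /=; rewrite mul0r ltNge ltW.
rewrite a_gt0 -(HF j) ?divr_gt0//; congr (fine (normal_prob _ _ _)).
by apply/seteqP; split => x; rewrite /level/= ltr_pdivrMr// mulrC.
Qed.

Variables (jj : nat -> 'I_d) (rr : nat -> int).
Hypothesis inj : injective (fun t => (jj t, rr t)).
Variables (c : 'I_d -> nat -> R) (beta : R).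
Hypotheses (c_ge0 : forall i t, 0 <= c i t) (c_gt0 : forall i, exists t, 0 < c i t)
  (beta_al : 0 < beta < alpha) (csum : forall i, cvgn (series (fun t => c i t `^ beta))).

(** A summable power bounds every single weight; this supplies the [cmax] of [tail_potter] for all
    components and sites at once. *)
Lemma weight_bounded : exists2 M, 0 < M & forall i t, c i t <= M.
Proof.
have /andP[b0 _] := beta_al.
pose S i := limn (series (fun t => c i t `^ beta)).
exists (\sum_i (S i) `^ beta^-1 + 1).
  by rewrite ltr_wpDl// sumr_ge0// => i _; exact: powR_ge0.
move=> i t; apply: (@le_trans _ _ (S i `^ beta^-1)).
  rewrite -[leLHS]powRr1// -[Y in _ `^ Y <= _](mulfV (lt0r_neq0 b0)) powRrM.
  have b0' : 0 <= beta^-1 by rewrite invr_ge0 ltW.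
  have cS : c i t `^ beta <= S i.
    have := cvg_sum_limn (fun t => powR_ge0 (c i t) beta) (@csum i) (leq0n t.+1).
    rewrite (_ : series _ 0%N = 0) ?subr0; last by rewrite /series/= big_geq.
    apply: le_trans.
    by rewrite big_nat_recr//= lerDr sumr_ge0// => s _; exact: powR_ge0.
  by rewrite ge0_ler_powR ?nnegrE ?powR_ge0// (le_trans _ cS)// powR_ge0.
rewrite (bigD1 i)//= -addrA lerDl addr_ge0// sumr_ge0// => k _; exact: powR_ge0.
Qed.

Lemma level_potter : exists2 K, 0 < K & \forall x \near +oo, forall i j t,
  N1 (level x (c i t) j) <= K * c i t `^ beta * F x.
Proof.
have [M M0 cM] := weight_bounded.
have [K K0 H] := tail_potter Lsv FE F_nonincreasing beta_al M0.
exists K => //; near=> x => i j t.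
have x0 : 0 < x by near: x; exact: nbhs_pinfty_gt.
rewrite level_mass//; case: ifPn => [ct|_].
  have HH : forall c, 0 < c <= M -> F (x / c) <= K * c `^ beta * F x by near: x.
  by apply: HH; rewrite ct cM.
rewrite mulr_ge0 ?mulr_ge0 ?powR_ge0 ?(ltW K0)// ltW//.
exact: (tail_gt0 Lsv FE F_nonincreasing).
Unshelve. all: by end_near. Qed.

Lemma level_ratio (v : nat -> R) i j t : v n @[n --> \oo] --> +oo ->
  (F (v n))^-1 * N1 (level (v n) (c i t) j) @[n --> \oo] --> c i t `^ alpha.
Proof.
move=> voo; have := c_ge0 i t; rewrite le_eqVlt => /predU1P[ct|ct].
  rewrite -ct powR0 ?gt_eqF//; apply: cvg_near_cst; near=> n.
  by rewrite level_mass ?lexx// ?ltxx ?mulr0//; near: n; exact: cvgy_gt0.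
have ci : 0 < (c i t)^-1 by rewrite invr_gt0.
have := tail_ratio Lsv FE ci; rewrite -[Y in Y `^ _](powR_inv1 (ltW ct)) -powRrM mulN1r opprK => H.
have := cvg_comp _ _ voo H; apply: cvg_trans; apply: near_eq_cvg; near=> n => /=.
rewrite level_mass ?ltW// ?ct; first by rewrite [RHS]mulrC (mulrC (v n)).
by near: n; exact: cvgy_gt0.
Unshelve. all: by end_near. Qed.

Definition exceed (i : 'I_d) (v : R) (t : nat) : set O := X (jj t) (- rr t) @^-1` level v (c i t) (jj t).

Lemma measurable_exceed i v t : measurable (exceed i v t).
Proof. by have := mX (jj t) (- rr t) measurableT (measurable_level v (c i t) (jj t)); rewrite setTI. Qed.

Lemma pr_exceed i v t : pr (exceed i v t) = N1 (level v (c i t) (jj t)).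
Proof. by rewrite /exceed lX//; exact: measurable_level. Qed.

Lemma site_neq s t : s != t -> (jj s, - rr s) != (jj t, - rr t).
Proof. by apply: contra_neq => -[js /oppr_inj rs]; apply: inj; congr pair. Qed.

(** The tail of one component at one time: its exceedance probability is asymptotic to [A_i * F v].
    This is [union_limit] normalised by [1 / F v], with the domination given by Potter's bound. *)
Lemma exceed_cvg i (v : nat -> R) : v n @[n --> \oo] --> +oo ->
  cvgn (series (fun t => c i t `^ alpha)) /\
  (F (v n))^-1 * pr (\bigcup_t exceed i (v n) t) @[n --> \oo] --> limn (series (fun t => c i t `^ alpha)).
Proof.
move=> voo; have [K K0 HK] := level_potter.
have Fgt u : 0 < u -> 0 < F u by exact: (tail_gt0 Lsv FE F_nonincreasing).
have HKv := cvgy_near voo HK.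
have v0 : \forall n \near \oo, 0 < v n by exact: cvgy_gt0.
have T0 : \forall n \near \oo, 0 < (F (v n))^-1.
  by near=> n; rewrite invr_gt0 Fgt//; near: n.
have cw t : (F (v n))^-1 * pr (exceed i (v n) t) @[n --> \oo] --> c i t `^ alpha.
  under eq_fun do rewrite pr_exceed.
  exact: level_ratio.
have leb : \forall n \near \oo, forall t, (F (v n))^-1 * pr (exceed i (v n) t) <= K * c i t `^ beta.
  near=> n => t; rewrite mulrC ler_pdivrMr ?Fgt//; last by near: n.
  rewrite pr_exceed.
  have HH : forall i j t, N1 (level (v n) (c i t) j) <= K * c i t `^ beta * F (v n).
    by near: n; exact: HKv.
  exact: HH.
have cb : cvgn (series (fun t => K * c i t `^ beta)).
  exact: (is_cvg_seriesZ (f := fun t => c i t `^ beta) (k := K)).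
have cp s t : (s < t)%N -> (F (v n))^-1 * pr (exceed i (v n) s `&` exceed i (v n) t) @[n --> \oo] --> (0 : R).
  move=> st; have [M M0 cM] := weight_bounded.
  have hb := beta_al; case/andP: hb => b0 _.
  have leKM u : K * c i u `^ beta <= K * M `^ beta.
    by rewrite ler_pM2l// ge0_ler_powR ?nnegrE ?(ltW b0)// ltW.
  have HP u : \forall n \near \oo, N1 (level (v n) (c i u) (jj u)) <= K * M `^ beta * F (v n).
    near=> n; apply: (@le_trans _ _ (K * c i u `^ beta * F (v n))).
      have HH : forall i j t, N1 (level (v n) (c i t) j) <= K * c i t `^ beta * F (v n).
        by near: n; exact: HKv.
      exact: HH.
    by rewrite ler_wpM2r// ltW// Fgt//; near: n.
  apply: (@pair_cvg0 _ _ _ _ _ _ _ (fun n => K * M `^ beta * F (v n)) (K * M `^ beta)) => //.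
  - by apply: site_neq; rewrite ltn_eqF.
  - by move=> n; exact: measurable_level.
  - by move=> n; exact: measurable_level.
  - near=> n; rewrite !mulr_gt0 ?powR_gt0// Fgt//; near: n; exact: v0.
  - near=> n; rewrite mulrC mulfK// gt_eqF// Fgt//; near: n; exact: v0.
  - rewrite -[Y in _ --> Y](mulr0 (K * M `^ beta)); apply: cvgM; first exact: cvg_cst.
    exact: (cvg_comp _ _ voo (tail_cvg0 a0 Lsv FE F_nonincreasing)).
have mE n t : measurable (exceed i (v n) t) by exact: measurable_exceed.
by split; [exact: (union_limit_cvg T0 cw leb cb)|exact: (union_limit mE T0 cw leb cb cp)].
Unshelve. all: by end_near. Qed.

Variables (v : nat -> 'I_d -> R) (tau : 'I_d -> R).
Hypotheses (tau_gt0 : forall i, 0 < tau i)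
  (thr : forall i, n%:R * pr (\bigcup_t exceed i (v n i) t) @[n --> \oo] --> tau i).

Let A i := limn (series (fun t => c i t `^ alpha)).

Let cinv : (n%:R : R)^-1 @[n --> \oo] --> (0 : R).
Proof.
have := @cvg_powRN R 1 ltr01; apply: cvg_trans; apply: near_eq_cvg; apply: nearW => n.
by rewrite powR_inv1.
Qed.

(** At a threshold below a fixed level one term of the union alone has probability at least
    [F (y / c i t) > 0], whereas the union has probability tending to 0, as [n] times it
    converges. *)
Lemma threshold_pinfty i : v n i @[n --> \oo] --> +oo.
Proof.
apply/cvgryPgt => z.
pose y := Num.max z 1.
have y0 : 0 < y by rewrite lt_max ltr01 orbT.
have [t ct] := c_gt0 i.
have m0 : 0 < F (y / c i t).
  by apply: (tail_gt0 Lsv FE F_nonincreasing); rewrite divr_gt0.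
have c0 : pr (\bigcup_t exceed i (v n i) t) @[n --> \oo] --> (0 : R).
  rewrite -[Y in _ --> Y](mul0r (tau i)); apply: cvg_trans (cvgM cinv (@thr i)).
  apply: near_eq_cvg; near=> n; rewrite /= mulKf// pnatr_eq0 -lt0n.
  by near: n; exact: nbhs_infty_gt.
near=> n; rewrite ltNge; apply/negP => vz.
have : pr (\bigcup_t exceed i (v n i) t) < F (y / c i t).
  by near: n; exact: (cvgr_lt _ c0).
apply/negP; rewrite -leNgt.
have := level_mass (jj t) y0 (c_ge0 i t); rewrite ct => <-; rewrite -pr_exceed.
apply: pr_le; [exact: measurable_exceed|by apply: bigcup_measurable => k _; exact: measurable_exceed|].
move=> w Ew; exists t => //; move: Ew; rewrite /exceed /level/=; apply: le_lt_trans.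
by apply: (le_trans vz); rewrite le_max lexx.
Unshelve. all: by end_near. Qed.

Let v_gt0 : \forall n \near \oo, forall i, 0 < v n i.
Proof. by apply: filter_forall => i; apply: cvgy_gt0; exact: threshold_pinfty. Qed.

Lemma weight_sum_gt0 i : 0 < A i.
Proof.
have [cA _] := exceed_cvg i (@threshold_pinfty i).
have [t ct] := c_gt0 i; apply: (@lt_le_trans _ _ (c i t `^ alpha)); first exact: powR_gt0.
have := cvg_sum_limn (fun t => powR_ge0 (c i t) alpha) cA (leq0n t.+1).
rewrite (_ : series _ 0%N = 0) ?subr0; last by rewrite /series/= big_geq.
apply: le_trans; rewrite big_nat_recr//= lerDr sumr_ge0// => s _; exact: powR_ge0.
Qed.

Lemma tail_threshold i : n%:R * F (v n i) @[n --> \oo] --> tau i / A i.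
Proof.
have [_ cA] := exceed_cvg i (@threshold_pinfty i).
have cAi : ((F (v n i))^-1 * pr (\bigcup_t exceed i (v n i) t))^-1 @[n --> \oo] --> (A i)^-1.
  by apply: cvgV => //; apply: lt0r_neq0; exact: weight_sum_gt0.
apply: cvg_trans (cvgM (@thr i) cAi); apply: near_eq_cvg; near=> n => /=.
have vn : 0 < v n i by near: n; apply: filterS v_gt0 => n; apply.
have Fn : 0 < F (v n i) by apply: (tail_gt0 Lsv FE F_nonincreasing).
have p0 : pr (\bigcup_t exceed i (v n i) t) != 0.
  have [t ct] := c_gt0 i.
  apply: lt0r_neq0; apply: (@lt_le_trans _ _ (F (v n i / c i t))).
    by apply: (tail_gt0 Lsv FE F_nonincreasing); rewrite divr_gt0.
  have := level_mass (jj t) vn (c_ge0 i t); rewrite ct => <-; rewrite -pr_exceed.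
  apply: pr_le; [exact: measurable_exceed|by apply: bigcup_measurable => k _; exact: measurable_exceed|].
  by move=> w Ew; exists t.
by rewrite invfM invrK; field.
Unshelve. all: by end_near. Qed.

(** All components [i] read the same Gaussian variable at site [t], so their exceedance sets are
    upper level sets of one function and the union has the largest of their masses; this is the
    maximum over [i] in the limit. *)
Definition bad n t : set R := \big[setU/set0]_(i < d) level (v n i) (c i t) (jj t).

Lemma measurable_bad n t : measurable (bad n t).
Proof. by apply: bigsetU_measurable => i _; exact: measurable_level. Qed.

Lemma upper_level_bad n t : upper_level (hh (jj t)) (bad n t).
Proof.
apply: big_ind => [|? ? ? ?|i _]; [exact: upper_level_set0|exact: upper_levelU|].
exact: upper_level_level.
Qed.

Lemma bad_mass n t : N1 (bad n t) = \big[Num.max/0]_i N1 (level (v n i) (c i t) (jj t)).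
Proof.
apply: (@nested_max _ _ (hh (jj t))) => i; first exact: measurable_level.
exact: upper_level_level.
Qed.

Definition wt t := \big[Num.max/0]_i (c i t `^ alpha * tau i / A i).

Lemma bad_cvg t : n%:R * N1 (bad n t) @[n --> \oo] --> wt t.
Proof.
under eq_fun do rewrite bad_mass bigmaxr_pMr//.
apply: cvg_bigmaxr => i.
rewrite [Y in _ --> Y](_ : _ = tau i / A i * c i t `^ alpha); last by rewrite -mulrA mulrC.
have lr : (F (v n i))^-1 * N1 (level (v n i) (c i t) (jj t)) @[n --> \oo] --> c i t `^ alpha.
  by apply: level_ratio; exact: threshold_pinfty.
apply: cvg_trans (cvgM (@tail_threshold i) lr); apply: near_eq_cvg; near=> n => /=.
have vn : 0 < v n i by near: n; apply: filterS v_gt0 => n; apply.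
have Fn : 0 < F (v n i) by apply: (tail_gt0 Lsv FE F_nonincreasing).
by field; rewrite gt_eqF.
Unshelve. all: by end_near. Qed.

(** The maximum over components is bounded by the sum, and [n * F (v n i)] is bounded because it
    converges; Potter's bound makes the rest summable over the sites. *)
Lemma bad_le : exists b : nat -> R, cvgn (series b) /\
  \forall n \near \oo, forall t, n%:R * N1 (bad n t) <= b t.
Proof.
have [K K0 HK] := level_potter.
pose D i := tau i / A i + 1.
exists (fun t => \sum_i D i * K * c i t `^ beta); split.
  have -> : series (fun t => \sum_i D i * K * c i t `^ beta) =
      fun n => \sum_i D i * K * series (fun t => c i t `^ beta) n.
    apply/funext => n; rewrite /series/= exchange_big; apply: eq_bigr => i _.
    by rewrite mulr_sumr.
  apply: (cvgP (\sum_i D i * K * limn (series (fun t => c i t `^ beta)))).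
  by apply: cvg_sum_seq => i _; apply: cvgM; [exact: cvg_cst|exact: csum].
have HD : \forall n \near \oo, forall i, n%:R * F (v n i) <= D i.
  by apply: filter_forall => i; apply: (cvgr_le _ (@tail_threshold i)); rewrite ltrDl.
have HKv : \forall n \near \oo, forall i i' j t, N1 (level (v n i) (c i' t) j) <= K * c i' t `^ beta * F (v n i).
  by apply: filter_forall => i; exact: (cvgy_near (@threshold_pinfty i) HK).
near=> n => t.
have h1 : forall i, n%:R * F (v n i) <= D i by near: n.
have h2 : forall i i' j t, N1 (level (v n i) (c i' t) j) <= K * c i' t `^ beta * F (v n i) by near: n.
rewrite bad_mass bigmaxr_pMr//; apply: le_trans (bigmaxr_le_sum _) _.
  by move=> i; rewrite mulr_ge0// fine_ge0.
apply: ler_sum => i _; apply: (@le_trans _ _ (n%:R * (K * c i t `^ beta * F (v n i)))).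
  by rewrite ler_wpM2l.
rewrite (_ : n%:R * _ = n%:R * F (v n i) * (K * c i t `^ beta)); last by ring.
by rewrite -(mulrA (D i)) ler_wpM2r// mulr_ge0 ?powR_ge0// ltW.
Unshelve. all: by end_near. Qed.

Lemma wt_ge0 t : 0 <= wt t.
Proof. by rewrite /wt; elim/big_ind : _ => // [x y x0 y0|i _]; rewrite ?le_max ?x0// !mulr_ge0 ?powR_ge0// ?invr_ge0 ltW// ?weight_sum_gt0. Qed.

Let site t := X (jj t) (- rr t).

(** The limit is [- ln H]. At a single time distinct sites read distinct variables, so joint
    exceedances are negligible and the contributions of the lags add up. *)
Lemma joint_cvg : cvgn (series wt) /\
  n%:R * pr (\bigcup_t site t @^-1` bad n t) @[n --> \oo] --> limn (series wt).
Proof.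
have [b [cb leb]] := bad_le.
have prE n t : pr (site t @^-1` bad n t) = N1 (bad n t).
  by rewrite /site lX//; exact: measurable_bad.
have mE n t : measurable (site t @^-1` bad n t).
  by have := mX (jj t) (- rr t) measurableT (measurable_bad n t); rewrite setTI.
have T0 : \forall n \near \oo, 0 < n%:R :> R by near=> n; rewrite ltr0n; near: n; exact: nbhs_infty_gt.
have cw t : n%:R * pr (site t @^-1` bad n t) @[n --> \oo] --> wt t.
  by under eq_fun do rewrite prE; exact: bad_cvg.
have leb' : \forall n \near \oo, forall t, n%:R * pr (site t @^-1` bad n t) <= b t.
  near=> n => t; rewrite prE; move: t; near: n; exact: leb.
have b0 t : 0 <= b t.
  exact: le_trans (wt_ge0 t) (union_limit_le cw leb' t).
have cp s t : (s < t)%N -> n%:R * pr (site s @^-1` bad n s `&` site t @^-1` bad n t) @[n --> \oo] --> (0 : R).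
  move=> st; apply: (@pair_cvg0 _ _ _ _ _ _ _ (fun n => (b s + b t + 1) / n%:R) (b s + b t + 1)) => //.
  - by apply: site_neq; rewrite ltn_eqF.
  - by move=> n; exact: measurable_bad.
  - by move=> n; exact: measurable_bad.
  - near=> n; rewrite divr_gt0//; last by near: n.
    by have := b0 s; have := b0 t; lra.
  - near=> n; rewrite mulrC divfK// gt_eqF//; near: n; exact: T0.
  - rewrite -[Y in _ --> Y](mulr0 (b s + b t + 1)); apply: cvgM; first exact: cvg_cst.
    exact: cinv.
  - near=> n; rewrite ler_pdivlMr 1?mulrC; last by near: n.
    apply: (@le_trans _ _ (b s)); last by have := b0 t; lra.
    by near: n; apply: filterS leb => n; apply.
  - near=> n; rewrite ler_pdivlMr 1?mulrC; last by near: n.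
    apply: (@le_trans _ _ (b t)); last by have := b0 s; lra.
    by near: n; apply: filterS leb => n; apply.
by split; [exact: (union_limit_cvg T0 cw leb' cb)|exact: (union_limit mE T0 cw leb' cb cp)].
Unshelve. all: by end_near. Qed.

Hypotheses (rr_le : forall t, (`|rr t| <= t)%N)
  (key : forall (B : nat -> 'I_d -> set R) (lam : 'I_d -> R),
    (forall n j, measurable (B n j)) ->
    (forall j, n%:R * N1 (B n j) @[n --> \oo] --> lam j) ->
    pr [set w | forall (k : nat) j, (1 <= k <= n)%N -> ~ B n j (X j k%:Z w)] @[n --> \oo]
      --> expR (- \sum_j lam j)).

Let hit n t (k : int) : set O := X (jj t) (k - rr t) @^-1` bad n t.

Let mhit n t k : measurable (hit n t k).
Proof. by have := mX (jj t) (k - rr t) measurableT (measurable_bad n t); rewrite setTI. Qed.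

Let pr_hit n t k : pr (hit n t k) = N1 (bad n t).
Proof. by rewrite /hit lX//; exact: measurable_bad. Qed.

Let BM n T j : set R := \big[setU/set0]_(0 <= t < T | jj t == j) bad n t.

Let BMP n T j x : BM n T j x <-> exists t, [/\ (t < T)%N, jj t = j & bad n t x].
Proof.
rewrite /BM -bigcup_seq_cond; split.
  by move=> [t /= /andP[]]; rewrite mem_index_iota => tT /eqP tj b; exists t.
by move=> [t [tT tj b]]; exists t => //=; rewrite mem_index_iota tT tj eqxx.
Qed.

Let mBM n T j : measurable (BM n T j).
Proof. by apply: bigsetU_measurable => t _; exact: measurable_bad. Qed.

Let BM_mass n T j : N1 (BM n T j) = \big[Num.max/0]_(0 <= t < T | jj t == j) N1 (bad n t).
Proof.
pose S t := if jj t == j then bad n t else set0.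
have -> : BM n T j = \big[setU/set0]_(0 <= t < T | jj t == j) S t.
  by apply: eq_bigr => t tj; rewrite /S tj.
rewrite (@nested_max _ _ (hh j)).
- by apply: eq_bigr => t tj; rewrite /S tj.
- by move=> t; rewrite /S; case: ifP => // _; exact: measurable_bad.
move=> t; rewrite /S; case: ifPn => [/eqP <-|_]; first exact: upper_level_bad.
exact: upper_level_set0.
Qed.

Definition wmax T j := \big[Num.max/0]_(0 <= t < T | jj t == j) wt t.

Let BM_cvg T j : n%:R * N1 (BM n T j) @[n --> \oo] --> wmax T j.
Proof.
under eq_fun do rewrite BM_mass bigmaxr_pMr//.
by apply: cvg_bigmaxr => t; exact: bad_cvg.
Qed.

Definition clear n := [set w | forall (k : nat) t, (1 <= k <= n)%N -> ~ bad n t (X (jj t) (k%:Z - rr t) w)].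

Let trunc n T := [set w | forall (k : nat) t, (1 <= k <= n)%N -> (t < T)%N -> ~ hit n t k%:Z w].

Let clearT n T := [set w | forall (k : nat) j, (1 <= k <= n)%N -> ~ BM n T j (X j k%:Z w)].

Let hits n t : set O := [set w | exists2 k, (k < n)%N & hit n t k.+1%:Z w].

Let mhits n t : measurable (hits n t).
Proof. exact: (measurable_exists (A := fun k => hit n t k.+1%:Z)). Qed.

Let pr_hits n t : pr (hits n t) <= n%:R * N1 (bad n t).
Proof.
apply: le_trans (pr_exists_le P n (fun k => mhit n t k.+1%:Z)) _.
under eq_bigr do rewrite pr_hit.
by rewrite big_mkord sumr_const card_ord mulr_natl.
Qed.

Let clearE n : clear n = ~` \bigcup_t hits n t.
Proof.
apply/seteqP; split => w H.
  by move=> [t _ [k kn]]; apply: H; rewrite /= kn.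
move=> k t /andP[k1 kn] Hb; apply: H; exists t => //; exists k.-1; rewrite ?prednK//.
Qed.

Let truncE n T : trunc n T = avoid (hits n) T.
Proof.
apply/seteqP; split => w H.
  by move=> t tT [k kn]; apply: H => //; rewrite /= kn.
move=> k t /andP[k1 kn] tT Hb; apply: (H t tT); exists k.-1; rewrite ?prednK//.
Qed.

Let mtrunc n T : measurable (trunc n T).
Proof. by rewrite truncE; exact: measurable_avoid. Qed.

Lemma measurable_clear n : measurable (clear n).
Proof. by rewrite clearE; apply: measurableC; exact: bigcup_measurable. Qed.

Let clear_trunc n T r : (forall N, \sum_(0 <= t < N) n%:R * N1 (bad n (T + t)%N) <= r) ->
  `|pr (clear n) - pr (trunc n T)| <= r.
Proof.
move=> H; apply: (@le_trans _ _ (pr (\bigcup_t hits n (T + t)%N))).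
  apply: pr_symdiff; [exact: measurable_clear|exact: mtrunc|exact: bigcup_measurable|].
  rewrite clearE truncE => w nb; split => [nh t tT ht|nh [t _ ht]]; first by apply: nh; exists t.
  have [tT|Tt] := ltnP t T; first exact: nh ht.
  by apply: nb; exists (t - T)%N => //; rewrite subnKC.
apply: pr_bigcup_le => [t|N]; first exact: mhits.
by apply: le_trans (H N); apply: ler_sum => t _; exact: pr_hits.
Qed.

(* Up to exceedances at times within T of 0 or of n, a filter with lags in
   (-T, T) sees the same variables as the window [1, n]. *)
Let edge_site n T u : set O := [set w | exists j, BM n T j (X j (u%:Z - T%:Z) w) \/ BM n T j (X j (n%:Z + u%:Z - T%:Z) w)].

Let edge_siteE n T u : edge_site n T u = \big[setU/set0]_(j < d)
  (X j (u%:Z - T%:Z) @^-1` BM n T j `|` X j (n%:Z + u%:Z - T%:Z) @^-1` BM n T j).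
Proof.
rewrite -bigcup_seq; apply/seteqP; split => w [j]; last by move=> _; exists j.
by exists j => //=; rewrite mem_index_enum.
Qed.

Let mBMX n T j k : measurable (X j k @^-1` BM n T j).
Proof. by have := mX j k measurableT (mBM n T j); rewrite setTI. Qed.

Let medge_site n T u : measurable (edge_site n T u).
Proof. by rewrite edge_siteE; apply: bigsetU_measurable => j _; exact: measurableU. Qed.

Let pr_edge_site n T u : pr (edge_site n T u) <= 2 * \sum_j N1 (BM n T j).
Proof.
rewrite edge_siteE; apply: le_trans (pr_bigsetU_le _ _ _) _; first by move=> j; exact: measurableU.
rewrite mulr_sumr; apply: ler_sum => j _; apply: le_trans (pr_setU_le _ _ _) _ => //.
by rewrite !lX// -mulr2n mulr_natl.
Qed.

Let trunc_clearT n T : `|pr (trunc n T) - pr (clearT n T)| <= (2 * T + 1)%:R * (2 * \sum_j N1 (BM n T j)).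
Proof.
have mclearT : measurable (clearT n T).
  rewrite (_ : clearT n T = ~` [set w | exists2 k, (k < n)%N &
      (\big[setU/set0]_(j < d) X j k.+1%:Z @^-1` BM n T j) w]).
    apply: measurableC; apply: (measurable_exists (A := fun k =>
      \big[setU/set0]_(j < d) X j k.+1%:Z @^-1` BM n T j)) => k.
    exact: bigsetU_measurable.
  apply/seteqP; split => w H.
    by move=> [k kn]; rewrite -bigcup_seq => -[j _]; apply: H; rewrite /= kn.
  move=> k j /andP[k1 kn] Hb; apply: H; exists k.-1; first by rewrite prednK.
  by rewrite -bigcup_seq prednK//; exists j => //=; rewrite mem_index_enum.
(* [u] runs over the [2 T + 1] offsets from [-T] to [T] around 0 and around [n]. A time [k] in the
   window is moved by a lag with [|rr t| <= t < T], so it leaves the window only if it lies near an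
   end. *)
pose edge := [set w | exists2 u, (u < 2 * T + 1)%N & edge_site n T u w].
apply: (@le_trans _ _ (pr edge)).
  apply: pr_symdiff => //; first exact: measurable_exists.
  move=> w nedge; split => H k.
    move=> j /andP[k1 kn] /BMP[t [tT tj bt]]; have rt := rr_le t.
    have bj : BM n T j (X j k%:Z w) by apply/BMP; exists t.
    have [s1|s1] := boolP (1 <= k%:Z + rr t).
      have [sn|sn] := boolP (k%:Z + rr t <= n%:Z).
        have kr : (1 <= `|(k%:Z + rr t)%R|%N <= n)%N by lia.
        apply: (H _ t kr tT).
        by rewrite /hit tj gez0_abs ?addrK//; lia.
      apply: nedge; exists (k + T - n)%N; first by lia.
      by exists j; right; rewrite (_ : _ - _ = k%:Z)//; lia.
    apply: nedge; exists (k + T)%N; first by lia.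
    by exists j; left; rewrite (_ : _ - _ = k%:Z)//; lia.
  move=> t /andP[k1 kn] tT ht; have rt := rr_le t.
  have bj : BM n T (jj t) (X (jj t) (k%:Z - rr t) w) by apply/BMP; exists t.
  have [s1|s1] := boolP (1 <= k%:Z - rr t).
    have [sn|sn] := boolP (k%:Z - rr t <= n%:Z).
      have kr : (1 <= `|(k%:Z - rr t)%R|%N <= n)%N by lia.
      apply: (H _ (jj t) kr).
      by rewrite gez0_abs//; lia.
    apply: nedge; exists `|(k%:Z - rr t + T%:Z - n%:Z)%R|%N; first by lia.
    by exists (jj t); right; rewrite (_ : _ + _ - _ = k%:Z - rr t)//; lia.
  apply: nedge; exists `|(k%:Z - rr t + T%:Z)%R|%N; first by lia.
  by exists (jj t); left; rewrite (_ : _ - T%:Z = k%:Z - rr t)//; lia.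
apply: le_trans (pr_exists_le P _ (medge_site n T)) _.
apply: (@le_trans _ _ (\sum_(0 <= u < 2 * T + 1) 2 * \sum_j N1 (BM n T j))).
  by apply: ler_sum => u _; exact: pr_edge_site.
by rewrite sumr_const_nat subn0 [leRHS]mulr_natl.
Qed.

(** [T] is fixed first, so that both the discarded weights and the change in the limit are small;
    the Poisson limit then applies as [n] grows, while the fixed number of boundary sites has
    vanishing probability. *)
Lemma clear_cvg (s : 'I_d -> R) : (forall j, wmax T j @[T --> \oo] --> s j) ->
  pr (clear n) @[n --> \oo] --> expR (- \sum_j s j).
Proof.
move=> ws; have [b [cb leb]] := bad_le.
have b0 t : 0 <= b t.
  apply: le_trans (wt_ge0 t) _; apply: (@cvgr_to_le _ _ _ _ _ _ _ (@bad_cvg t)).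
  by apply: filterS leb => n; apply.
have cexp : expR (- \sum_j wmax T j) @[T --> \oo] --> expR (- \sum_j s j).
  apply: (continuous_cvg _ (@continuous_expR R _)); apply: cvgN.
  by apply: cvg_sum_seq => j _; exact: ws.
apply/cvgrPdist_le => e e0.
have e4 : 0 < e / 4 by rewrite divr_gt0.
have [T HT1 HT2] : exists2 T, limn (series b) - series b T <= e / 4 &
    `|expR (- \sum_j s j) - expR (- \sum_j wmax T j)| <= e / 4.
  near \oo => T; exists T; last by near: T; move/cvgrPdist_le : cexp; apply.
  apply: (le_trans (ler_norm _)); near: T; move/cvgrPdist_le : cb; apply.
  exact: e4.
have ck := key (fun n j => mBM n T j) (@BM_cvg T).
have cB : (2 * T + 1)%:R * (2 * \sum_j N1 (BM n T j)) @[n --> \oo] --> (0 : R).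
  rewrite [Y in _ --> Y](_ : 0 = (2 * T + 1)%:R * (2 * \sum_(j < d) 0)); last by rewrite big1// !mulr0.
  apply: cvgM; first exact: cvg_cst.
  apply: cvgM; first exact: cvg_cst.
  apply: cvg_sum_seq => j _; rewrite -[Y in _ --> Y](mul0r (wmax T j)).
  apply: cvg_trans (cvgM cinv (@BM_cvg T j)); apply: near_eq_cvg; near=> n.
  by rewrite /= mulKf// pnatr_eq0 -lt0n; near: n; exact: nbhs_infty_gt.
near=> n.
have h1 : `|pr (clear n) - pr (trunc n T)| <= e / 4.
  have hb : forall t, n%:R * N1 (bad n t) <= b t by near: n.
  apply: clear_trunc => N; apply: le_trans HT1.
  apply: le_trans (cvg_sum_limn b0 cb (leq_addr N T)).
  rewrite [leRHS](_ : _ = \sum_(0 <= t < N) b (t + T)%N); last first.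
    by rewrite -[Y in \sum_(Y <= _ < _) _]add0n big_addn addKn.
  by apply: ler_sum => t _; rewrite addnC.
have h2 : `|pr (trunc n T) - pr (clearT n T)| <= e / 4.
  apply: le_trans (trunc_clearT n T) _; near: n; exact: (cvgr_le _ cB _ e4).
have h3 : `|expR (- \sum_j wmax T j) - pr (clearT n T)| <= e / 4.
  by near: n; move/cvgrPdist_le : ck; apply.
move: h1 h2 h3 HT2; rewrite !ler_norml => /andP[? ?] /andP[? ?] /andP[? ?] /andP[? ?].
by apply/andP; split; lra.
Unshelve. all: by end_near. Qed.

End levels.

(** * Variance decay and standardisation of the linear process *)

Lemma log_series_tail {R : realType} (n N : nat) : (2 <= n <= N)%N ->
  \sum_(n <= l < N) (l%:R * ln (l%:R : R) ^+ 2)^-1 <= 4 / ln (n%:R : R).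
Proof.
move=> /andP[n2 nN].
(* [4 / ln] telescopes: [ln (l+1) - ln l >= 1/(l+1)], and the constant is 2 times 2, from
   [ln (l+1) <= 2 ln l] and [l + 1 <= 2 l]. *)
have step (l : nat) : (2 <= l)%N -> (l%:R * ln (l%:R : R) ^+ 2)^-1 <= 4 / ln (l%:R : R) - 4 / ln (l.+1%:R : R).
  move=> l2; have l2r : (2 : R) <= l%:R by rewrite ler_nat.
  set x : R := l%:R in l2r *; have x0 : 0 < x by lra.
  have -> : l.+1%:R = x + 1 :> R by rewrite natr1.
  set a := ln x; set b := ln (x + 1).
  have a_gt0 : 0 < a by rewrite ln_gt0; lra.
  have ba : b <= 2 * a.
    rewrite -[2]/(2%:R) mulr_natl -lnXn// ler_ln ?posrE; [|lra|by rewrite exprn_gt0].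
    nra.
  have ab : (x + 1)^-1 <= b - a.
    have h : ln (x / (x + 1)) <= x / (x + 1) - 1.
      have := expR_ge1Dx (ln (x / (x + 1))); rewrite lnK ?posrE ?divr_gt0//; lra.
    have e : x / (x + 1) - 1 = - (x + 1)^-1 by field; lra.
    move: h; rewrite e ln_div ?posrE; [|lra..].
    by rewrite -/a -/b; lra.
  have b0 : 0 < b.
    have : 0 < (x + 1)^-1 by rewrite invr_gt0; lra.
    lra.
  rewrite (_ : 4 / a - 4 / b = 4 * (b - a) / (a * b)); last by field; rewrite !gt_eqF.
  rewrite ler_pdivlMr ?mulr_gt0//.
  apply: (@le_trans _ _ (2 / x)).
    rewrite (_ : (x * a ^+ 2)^-1 * (a * b) = b / a / x); last by field; rewrite !gt_eqF.
    by rewrite ler_pM2r ?invr_gt0// ler_pdivrMr.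
  apply: (@le_trans _ _ (4 * (x + 1)^-1)); last by rewrite ler_pM2l.
  rewrite ler_pdivrMr// mulrAC ler_pdivlMr; lra.
rewrite (le_trans (_ : _ <= \sum_(n <= l < N) (4 / ln (l%:R : R) - 4 / ln (l.+1%:R : R))))//.
  by rewrite !big_nat; apply: ler_sum => l /andP[nl _]; apply: step; exact: leq_trans nl.
under eq_bigr do rewrite -opprB; rewrite sumrN (telescope_sumr (fun l => 4 / ln (l%:R : R))) // opprB.
have N0 : 0 <= 4 / ln (N%:R : R) by rewrite divr_ge0// ln_ge0// ler1n (leq_trans _ nN)// ltnW.
lra.
Qed.

(** Meant for squared row norms: the square of [o(l^(-1/2) / ln l)] is [o(1 / (l ln^2 l))], with
    tails [o(1 / ln n)]. *)
Lemma decay_series {R : realType} (f : nat -> R) : (forall l, 0 <= f l) ->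
  (forall kappa, 0 < kappa -> \forall l \near \oo, f l <= kappa * (l%:R * ln (l%:R : R) ^+ 2)^-1) ->
  cvgn (series f) /\ ln (n.+1%:R) * (limn (series f) - series f n) @[n --> \oo] --> (0 : R).
Proof.
move=> f0 H.
have tail kappa : 0 < kappa -> \forall n \near \oo, forall N, (n <= N)%N ->
    \sum_(n <= l < N) f l <= kappa * (4 / ln (n%:R : R)).
  move=> k0; have [m _ Hm] := H _ k0; exists (maxn m 2) => // n /=; rewrite geq_max => /andP[mn n2] N nN.
  apply: (@le_trans _ _ (\sum_(n <= l < N) kappa * (l%:R * ln (l%:R : R) ^+ 2)^-1)).
    by rewrite !big_nat; apply: ler_sum => l /andP[nl _]; apply: Hm; exact: leq_trans nl.
  by rewrite -mulr_sumr ler_pM2l// log_series_tail// n2.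
have nd : {homo series f : n m / (n <= m)%N >-> n <= m}.
  by move=> n m nm; rewrite /series/= (big_cat_nat (leq0n n) nm)/= lerDl sumr_ge0.
have cf : cvgn (series f).
  have [m _ /(_ m (leqnn m)) Hm] := tail _ ltr01.
  apply: nondecreasing_is_cvgn => //; exists (series f m + 1 * (4 / ln (m%:R : R))) => _ [n _ <-].
  have [nm|mn] := leqP n m.
    apply: (le_trans (nd _ _ nm)); rewrite lerDl; apply: le_trans (Hm m (leqnn m)).
    by rewrite big_geq.
  by rewrite /series/= (big_cat_nat (leq0n m) (ltnW mn))/= lerD2l Hm// ltnW.
split=> //; apply/cvgrPdist_le => e e0.
have e8 : 0 < e / 8 by rewrite divr_gt0.
have := tail _ e8; apply: filterS2 (nbhs_infty_gt 1) => n n1 Hn.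
have n1r : 1 < (n%:R : R) by rewrite ltr1n.
have ln0 : 0 < ln (n%:R : R) by rewrite ln_gt0.
have lS0 : 0 <= ln (n.+1%:R : R) by rewrite ln_ge0// ler1n.
have dn0 : 0 <= limn (series f) - series f n.
  by rewrite subr_ge0; exact: nondecreasing_cvgn_le.
rewrite sub0r normrN ger0_norm ?mulr_ge0//.
have dn : limn (series f) - series f n <= e / 8 * (4 / ln (n%:R : R)).
  rewrite lerBlDl; apply: (limr_le cf); exists n => // N /= nN.
  by rewrite /series/= (big_cat_nat (leq0n n) nN)/= lerD2l Hn.
have l2 : ln (n.+1%:R : R) <= 2 * ln (n%:R : R).
  rewrite -[2]/(2%:R) mulr_natl -lnXn ?(lt_trans _ n1r)// ler_ln ?posrE ?exprn_gt0 ?(lt_trans _ n1r)//.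
  by rewrite -natrX ler_nat; case: n n1 {Hn n1r ln0 lS0 dn0 dn} => [|[|n]]//; nia.
apply: (@le_trans _ _ (2 * ln (n%:R : R) * (e / 8 * (4 / ln (n%:R : R))))).
  by apply: ler_pM.
by rewrite le_eqVlt; apply/orP; left; apply/eqP; field; rewrite gt_eqF.
Qed.

Lemma finite_lower_bound {R : realType} (I : finType) (f : I -> R) : (forall i, 0 < f i) ->
  exists2 m, 0 < m <= 1 & forall i, m <= f i.
Proof.
move=> f0; exists (\big[Num.min/1]_i f i).
  rewrite bigmin_le_id andbT; elim/big_ind : _ => // x y x0 y0.
  by rewrite lt_min x0.
by move=> i; exact: bigmin_le_cond.
Qed.

Section linear_array.
Context {R : realType} {dO : measure_display} {O : measurableType dO} {d : nat}
  (P : probability O R) (eps : int -> O -> d.-tuple R).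
Hypotheses (mE : forall k, measurable_fun setT (eps k)) (indE : mutually_independent P eps)
  (gE : forall k, gaussian_vector P (eps k))
  (cE : forall k, centered_vector P (eps k)) (vE : forall k, identity_covariance P (eps k)).
Variables (Psi : nat -> 'M[R]_d) (X : int -> O -> d.-tuple R).
Hypotheses (d0 : (0 < d)%N) (Psi0 : Psi 0%N \in unitmx)
  (decay : forall i j : 'I_d,
     (fun l : nat => Psi l i j : R^o) =o_\oo
     (fun l : nat => (l%:R `^ (- 2^-1)) * (ln (l%:R : R))^-1 : R^o))
  (linX : linear_process P Psi eps X).

Local Notation pr A := (fine (P A)).
Local Notation N1 A := (fine (normal_prob (0 : R) 1 A)).

Let row (i : 'I_d) (l : nat) (j : 'I_d) : R := Psi l i j.

Let row_decay i kappa : 0 < kappa ->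
  \forall l \near \oo, sqnorm (row i l) <= kappa * (l%:R * ln (l%:R : R) ^+ 2)^-1.
Proof.
move=> k0; have dr : 0 < (d%:R : R) by rewrite ltr0n.
(* The tolerance for each of the [d] entries of a row, so that the squares add up to [kappa]. *)
have e0 : 0 < Num.sqrt (kappa / d%:R) by rewrite sqrtr_gt0 divr_gt0.
have H : \forall l \near \oo, forall j, `|Psi l i j| <=
    Num.sqrt (kappa / d%:R) * `|l%:R `^ (- 2^-1) * (ln (l%:R : R))^-1|.
  by apply: filter_forall => j; have /eqoP := decay i j; exact.
near=> l; have Hl : forall j, `|Psi l i j| <=
    Num.sqrt (kappa / d%:R) * `|l%:R `^ (- 2^-1) * (ln (l%:R : R))^-1| by near: l.
have l0 : 0 < (l%:R : R) by rewrite ltr0n; near: l; exact: nbhs_infty_gt.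
have lp : ((l%:R : R) `^ (- 2^-1)) ^+ 2 = l%:R^-1.
  by rewrite -powR_mulrn ?powR_ge0// -powRrM (_ : - 2^-1 * 2%:R = - 1) ?powR_inv1 ?ler0n//; field.
apply: (@le_trans _ _ (\sum_(j < d) kappa / d%:R * (l%:R * ln (l%:R : R) ^+ 2)^-1)).
  apply: ler_sum => j _; rewrite /row -[leLHS](real_normK (num_real _)).
  apply: (@le_trans _ _ ((Num.sqrt (kappa / d%:R) * `|l%:R `^ (- 2^-1) * (ln (l%:R : R))^-1|) ^+ 2)).
    by rewrite ler_pXn2r ?nnegrE ?mulr_ge0 ?sqrtr_ge0.
  rewrite exprMn sqr_sqrtr ?divr_ge0 ?(ltW k0) ?(ltW dr)// (real_normK (num_real _)) exprMn lp.
  by rewrite exprVn -invfM lexx.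
rewrite sumr_const card_ord -[leLHS]mulr_natl le_eqVlt; apply/orP; left; apply/eqP.
by rewrite mulrA; congr (_ * _); rewrite mulrC divfK ?gt_eqF.
Unshelve. all: by end_near. Qed.

Let row_series i := decay_series (fun l => sqnorm_ge0 (row i l)) (@row_decay i).

Let sig2 i : R := limn (lvar (row i)).

(** A nontrivial combination of the rows of [Psi 0] cannot vanish, by invertibility. Single rows
    yield [beta], signed pairs of rows yield [gamma]. *)
Let comb_gt0 (x : 'rV[R]_d) : x != 0 -> 0 < sqnorm (fun l => (x *m Psi 0%N) 0 l).
Proof.
move=> x0; rewrite lt_neqAle sqnorm_ge0 andbT; apply: contra x0 => /eqP/esym/eqP.
rewrite psumr_eq0 => [/allP H|j _]; last exact: sqr_ge0.
have y0 : x *m Psi 0%N = 0.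
  apply/matrixP => i j; rewrite ord1 [RHS]mxE; apply/eqP; rewrite -sqrf_eq0.
  exact: (implyP (H j (mem_index_enum j))).
by rewrite -[x](mulmxK Psi0) y0 mul0mx.
Qed.

Let row_comb (x y : R) i j : (fun l => x * row i 0%N l + y * row j 0%N l) =
  (fun l => ((x *: delta_mx 0 i + y *: delta_mx 0 j : 'rV[R]_d) *m Psi 0%N) 0 l).
Proof. by apply/funext => l; rewrite mulmxDl -!scalemxAl -!rowE !mxE. Qed.

Let row0_gt0 i : 0 < sqnorm (row i 0%N).
Proof.
have -> : row i 0%N = fun l => ((delta_mx 0 i : 'rV[R]_d) *m Psi 0%N) 0 l.
  by apply/funext => l; rewrite -rowE mxE.
apply: comb_gt0; apply/eqP => /matrixP/(_ 0 i); rewrite !mxE !eqxx => /eqP.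
by rewrite oner_eq0.
Qed.

Let sig2_gt0 i : 0 < sig2 i.
Proof.
apply: (lt_le_trans (row0_gt0 i)); have [cs _] := row_series i.
have := cvg_sum_limn (fun l => sqnorm_ge0 (row i l)) cs (leq0n 1).
rewrite (_ : series _ 0%N = 0) ?subr0; last by rewrite /series/= big_geq.
by rewrite big_nat1.
Qed.

Let sd i := Num.sqrt (sig2 i).
Let sd_gt0 i : 0 < sd i. Proof. by rewrite sqrtr_gt0. Qed.
Let b i l j := row i l j / sd i.

Let lvar_b i n : lvar (b i) n = lvar (row i) n / sig2 i.
Proof.
rewrite /lvar mulr_suml; apply: eq_bigr => l _; rewrite /sqnorm mulr_suml; apply: eq_bigr => j _.
by rewrite /b exprMn exprVn sqr_sqrtr// ltW.
Qed.

Let b_lvar i : lvar (b i) n @[n --> \oo] --> (1 : R).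
Proof.
have [cs _] := row_series i.
rewrite -(divff (lt0r_neq0 (sig2_gt0 i))); under eq_fun do rewrite lvar_b.
by apply: cvgM; [exact: cs|exact: cvg_cst].
Qed.

Let b_tail i : ln (n.+1%:R) * (1 - lvar (b i) n) @[n --> \oo] --> (0 : R).
Proof.
have [_ ct] := row_series i; rewrite -[Y in _ --> Y](mul0r (sig2 i)^-1).
apply: cvg_trans (cvgM ct (cvg_cst _)); apply: near_eq_cvg; apply: nearW => n /=.
rewrite lvar_b -mulrA mulrBl; congr (_ * (_ - _)); exact: (divff (lt0r_neq0 (sig2_gt0 i))).
Qed.

Let b_lsum i k n w : lsum eps (b i) k n w =
  (\sum_(0 <= l < n) \sum_(j < d) Psi l i j * tnth (eps (k - l%:Z) w) j) / sd i.
Proof.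
rewrite /lsum mulr_suml; apply: eq_bigr => l _; rewrite /dot mulr_suml; apply: eq_bigr => j _.
by rewrite /b /row mulrAC.
Qed.

Let b_lsum_cvg i k : {ae P, forall w, lsum eps (b i) k n w @[n --> \oo] --> tnth (X k w) i / sd i}.
Proof.
apply: filterS (linX k i) => w H; under eq_fun do rewrite b_lsum.
by apply: cvgM; [exact: H|exact: cvg_cst].
Qed.

Let b_cvg i k : {ae P, forall w, cvgn (lsum eps (b i) k ^~ w)}.
Proof. by apply: filterS (b_lsum_cvg i k) => w H; apply/cvg_ex; eexists; exact: H. Qed.

Let b_comb_gt0 (x y : R) i j : i != j -> x != 0 ->
  0 < sqnorm (fun l => x * b i 0%N l + y * b j 0%N l).
Proof.
move=> ij x0.
have -> : (fun l => x * b i 0%N l + y * b j 0%N l) =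
    (fun l => x / sd i * row i 0%N l + y / sd j * row j 0%N l).
  by apply/funext => l; rewrite /b; field; rewrite !gt_eqF.
rewrite row_comb; apply: comb_gt0; apply/eqP => /matrixP/(_ 0 i); rewrite !mxE !eqxx/= (negbTE ij).
rewrite mulr1 mulr0 addr0 => /eqP; rewrite mulf_eq0 (negbTE x0)/= invr_eq0.
by rewrite gt_eqF.
Qed.

Lemma linear_gaussian_array : exists (Y : 'I_d -> int -> O -> R) (s : 'I_d -> R) (C h : R),
  [/\ [/\ forall i, 0 < s i, forall i k, measurable_fun setT (Y i k),
    forall i k, {ae P, forall w, tnth (X k w) i = s i * Y i k w} &
    forall i k B, measurable B -> P (Y i k @^-1` B) = normal_prob (0 : R) 1 B],
   0 < C, 0 < h <= 1,
   (forall (i j : 'I_d) (k k' : int) (A G : set R) (p : R),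
     (i, k) != (j, k') -> 0 < p <= 1 -> measurable A -> measurable G ->
     N1 A <= p -> N1 G <= p -> pr (Y i k @^-1` A `&` Y j k' @^-1` G) <= C * p `^ (1 + h)) &
   (forall (B : nat -> 'I_d -> set R) (lam : 'I_d -> R),
     (forall n j, measurable (B n j)) ->
     (forall j, n%:R * N1 (B n j) @[n --> \oo] --> lam j) ->
     pr [set w | forall (k : nat) j, (1 <= k <= n)%N -> ~ B n j (Y j k%:Z w)] @[n --> \oo]
       --> expR (- \sum_j lam j))].
Proof.
have bpos i : 0 < sqnorm (b i 0%N).
  by have := lvar_b i 1; rewrite /lvar !big_nat1 => ->; rewrite divr_gt0.
have [beta /andP[be0 _] Hbe] := finite_lower_bound bpos.
(* All pairs and both signs at once, so that one [gamma] serves them; 1 is a positive filler on the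
   diagonal, where no bound is wanted. *)
pose comb (x : 'I_d * 'I_d * bool) : R := if x.1.1 == x.1.2 then 1 else
  sqnorm (fun l => 1 * b x.1.1 0%N l + (if x.2 then 1 else -1) * b x.1.2 0%N l).
have cpos x : 0 < comb x.
  by case: x => [[i j] e]; rewrite /comb/=; case: eqVneq => // ij; rewrite b_comb_gt0// oner_eq0.
have [gamma /andP[ga0 ga1] Hga] := finite_lower_bound cpos.
have gD i j : i != j -> gamma <= sqnorm (fun l => 1 * b i 0%N l + 1 * b j 0%N l).
  by move=> ij; have := Hga (i, j, true); rewrite /comb/= (negbTE ij).
have gB i j : i != j -> gamma <= sqnorm (fun l => 1 * b i 0%N l + (-1) * b j 0%N l).
  by move=> ij; have := Hga (i, j, false); rewrite /comb/= (negbTE ij).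
have ga2 : gamma <= 2 by lra.
have [C [h [C0 h01 HP]]] := limS_pair mE indE gE cE vE b_cvg b_lvar be0 ga0 ga2 Hbe gD gB d0.
have mY i k : measurable_fun setT (limS eps (b i) k) by exact: measurable_limS.
have lY i k (B : set R) : measurable B -> P (limS eps (b i) k @^-1` B) = normal_prob (0 : R) 1 B.
  exact: (limS_law1 mE indE gE cE vE (b_cvg i k) (b_lvar i)).
exists (fun i k => limS eps (b i) k), sd, C, h; split => //.
  split => // i k; apply: filterS (b_lsum_cvg i k) => w H.
  by rewrite (limS_cvg H) mulrC divfK// gt_eqF.
move=> B lam mB cB.
apply: (@avoid_all_cvg _ _ _ _ P (fun i k => limS eps (b i) k) d0 mY lY C h C0 h01 HP
  (fun k => <<s cylinders eps [set q | q <= k] >>)) => //.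
- by move=> k; exact: (@measurableT _ (g_sigma_algebraType (cylinders eps [set q | q <= k]))).
- move=> k D i k' G kk sD mG.
  apply: (@measurableI _ (g_sigma_algebraType (cylinders eps [set q | q <= k]))) => //.
  apply: (measurable_wrt_preimage _ mG); apply: limS_wrt => // l /=.
  by apply: le_trans kk; rewrite lerBlDr lerDl.
- move=> g e g0 e0; exact: (limS_mix mE indE gE cE vE b_cvg b_lvar b_tail g0 e0).
Qed.

End linear_array.

Definition int_enum (q : nat) : int := if odd q then Negz q./2 else Posz q./2.
Definition int_index (r : int) : nat := match r with Posz m => m.*2 | Negz m => m.*2.+1 end.

Lemma int_indexK : cancel int_index int_enum.
Proof. by case=> m; rewrite /int_enum/= odd_double/= ?uphalf_double ?doubleK. Qed.

Lemma int_enumK : cancel int_enum int_index.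
Proof.
move=> q; rewrite -[RHS]odd_double_half /int_enum; case: (odd q) => //=.
Qed.

(** Keeps the lag of site [t] within [[-t, t]], so truncating the list of sites also truncates the
    lags. *)
Lemma int_enum_le q : (`|int_enum q| <= q)%N.
Proof.
rewrite /int_enum; case: ifP => [oq|_]; last by rewrite absz_nat -[leqRHS]half_double leq_half_double; lia.
by rewrite NegzE abszN absz_nat -[leqRHS]odd_double_half oq; lia.
Qed.

(** * Enumeration of the filter coefficients *)

Section sites.
Variables (d : nat) (d0 : (0 < d)%N).

Definition site_comp (t : nat) : 'I_d := Ordinal (ltn_pmod t d0).
Definition site_lag (t : nat) : int := int_enum (t %/ d).
Definition site_index (j : 'I_d) (r : int) : nat := (int_index r * d + j)%N.

Lemma site_indexK j r : site_comp (site_index j r) = j /\ site_lag (site_index j r) = r.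
Proof.
rewrite /site_comp /site_lag /site_index; split.
  by apply: val_inj; rewrite /= modnMDl modn_small.
by rewrite divnMDl// divn_small// addn0 int_indexK.
Qed.

Lemma site_inj : injective (fun t => (site_comp t, site_lag t)).
Proof.
move=> s t [] st /(can_inj int_enumK) dst.
by rewrite (divn_eq s d) (divn_eq t d) st dst.
Qed.

Lemma site_lag_le t : (`|site_lag t| <= t)%N.
Proof. exact: leq_trans (int_enum_le _) (leq_div _ _). Qed.

Lemma esum_sites {R : realType} (g : 'I_d -> int -> \bar R) : (forall j r, 0 <= g j r)%E ->
  (\sum_(j < d) \esum_(r in [set: int]) g j r =
   \sum_(0 <= t <oo) g (site_comp t) (site_lag t))%E.
Proof.
move=> g0; rewrite nneseries_esumT; last by move=> t; exact: g0.
have bij : set_bij [set: nat] ([set: 'I_d] `*`` (fun=> [set: int])) (fun t => (site_comp t, site_lag t)).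
  split => //; first by move=> s t _ _; exact: site_inj.
  by move=> [j r] _; have [e1 e2] := site_indexK j r; exists (site_index j r) => //; rewrite e1 e2.
have <- := reindex_esum _ _ _ (fun x => g x.1 x.2) bij.
rewrite -(esum_esum (fun j r _ _ => g0 j r)) esum_fset; last 2 first.
- exact: finite_finset.
- by move=> j _; exact: esum_ge0.
rewrite (_ : [set: 'I_d] = [set` index_enum 'I_d]); last first.
  by apply/seteqP; split => j //= _; rewrite mem_index_enum.
by rewrite -fsbig_seq ?index_enum_uniq.
Qed.

Lemma esum_sites_fin {R : realType} (f : 'I_d -> int -> R) : (forall j r, 0 <= f j r) ->
  cvgn (series (fun t => f (site_comp t) (site_lag t))) ->
  (\sum_(j < d) \esum_(r in [set: int]) (f j r)%:E)%E =
  (limn (series (fun t => f (site_comp t) (site_lag t))))%:E.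
Proof.
move=> f0 cf; rewrite esum_sites; last by move=> j r; rewrite lee_fin.
rewrite -EFin_lim//; congr (limn _); apply/funext => n /=.
by rewrite /series/= sumEFin.
Qed.

Lemma esum_sites_fine {R : realType} (f : 'I_d -> int -> R) : (forall j r, 0 <= f j r) ->
  cvgn (series (fun t => f (site_comp t) (site_lag t))) ->
  \sum_(j < d) fine (\esum_(r in [set: int]) (f j r)%:E)%E =
  limn (series (fun t => f (site_comp t) (site_lag t))).
Proof.
move=> f0 cf; have H := esum_sites_fin f0 cf.
have e0 j : (0 <= \esum_(r in [set: int]) (f j r)%:E)%E by apply: esum_ge0 => r _; rewrite lee_fin.
have fn j : (\esum_(r in [set: int]) (f j r)%:E)%E \is a fin_num.
  rewrite ge0_fin_numE//; apply: (@le_lt_trans _ _ (\sum_(j < d) \esum_(r in [set: int]) (f j r)%:E)%E).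
    by rewrite (bigD1 j)//= leeDl// sume_ge0.
  by rewrite H ltry.
by apply/EFin_inj; rewrite -H -sumEFin; apply: eq_bigr => j _; rewrite fineK.
Qed.

End sites.

(** [exp (- q / (1 - q)) <= 1 - q <= exp (- q)], raised to the power [n]. *)
Lemma expR_onem_cvg {R : realType} (q : nat -> R) (x : R) :
  (forall n, 0 <= q n) -> n%:R * q n @[n --> \oo] --> x ->
  (1 - q n) ^+ n @[n --> \oo] --> expR (- x).
Proof.
move=> q0 cq.
have cq0 : q n @[n --> \oo] --> (0 : R).
  have cinv : (n%:R : R)^-1 @[n --> \oo] --> (0 : R).
    apply: cvg_trans (@cvg_powRN R 1 ltr01); apply: near_eq_cvg; apply: nearW => n.
    by rewrite powR_inv1.
  rewrite -[Y in _ --> Y](mul0r x); apply: cvg_trans (cvgM cinv cq).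
  apply: near_eq_cvg; near=> n; rewrite /= mulKf// pnatr_eq0 -lt0n.
  by near: n; exact: nbhs_infty_gt.
have clo : expR (- (n%:R * q n / (1 - q n))) @[n --> \oo] --> expR (- x).
  apply: (continuous_cvg _ (@continuous_expR R _)); apply: cvgN.
  rewrite -[Y in _ --> Y]divr1 -[Y in _ / Y]subr0; apply: cvgM => //.
  apply: cvgV; first by rewrite subr0 oner_neq0.
  by apply: cvgB => //; exact: cvg_cst.
have cup : expR (- (n%:R * q n)) @[n --> \oo] --> expR (- x).
  by apply: (continuous_cvg _ (@continuous_expR R _)); exact: cvgN.
apply: squeeze_cvgr clo cup; near=> n.
have q1 : q n < 1 by near: n; exact: (cvgr_lt _ cq0 _ ltr01).
have p0 : 0 < 1 - q n by rewrite subr_gt0.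
have lo : expR (- (q n / (1 - q n))) <= 1 - q n.
  rewrite expRN -[leRHS]invrK lef_pV2 ?posrE ?invr_gt0 ?expR_gt0//.
  apply: le_trans (expR_ge1Dx _); rewrite le_eqVlt; apply/orP; left; apply/eqP.
  by field; rewrite gt_eqF.
apply/andP; split.
  by rewrite -mulrA -mulrN expRM_natl lerXn2r ?nnegrE ?expR_ge0 ?(ltW p0).
rewrite -mulrN expRM_natl lerXn2r ?nnegrE ?expR_ge0 ?(ltW p0)//.
by have := expR_ge1Dx (- q n).
Unshelve. all: by end_near. Qed.

(** * The constants of the limit law *)

Section constants.
Context {R : realType} (d : nat) (d0 : (0 < d)%N) (a : 'I_d -> 'I_d -> int -> R) (alpha : R)
  (tau : 'I_d -> R).
Hypotheses (a_ge0 : forall i j r, 0 <= a i j r) (a_gt0 : forall i, exists j r, 0 < a i j r)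
  (tau_gt0 : forall i, 0 < tau i).

Definition site_weight i t := a i (site_comp d0 t) (site_lag d t).

Let A i := limn (series (fun t => site_weight i t `^ alpha)).

Hypotheses (csum : forall i, cvgn (series (fun t => site_weight i t `^ alpha)))
  (A_gt0 : forall i, 0 < A i) (cwt : cvgn (series (wt alpha site_weight tau))).

Lemma M4_AbarE i : M4_Abar a alpha i = (A i)%:E.
Proof.
rewrite /M4_Abar; under eq_esum do rewrite -sumEFin.
rewrite esum_sum; last by move=> r j _ _; rewrite lee_fin powR_ge0.
have p0 j r : 0 <= a i j r `^ alpha by exact: powR_ge0.
by have := esum_sites_fin (d0 := d0) p0 (@csum i).
Qed.

Lemma wt_weight t : wt alpha site_weight tau t = M4_weight a alpha tau (site_comp d0 t) (site_lag d t).
Proof. by apply: eq_bigr => i _; rewrite /M4_A M4_AbarE. Qed.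

Lemma weight_wt j r : M4_weight a alpha tau j r = wt alpha site_weight tau (site_index j r).
Proof. by have [e1 e2] := site_indexK d0 j r; rewrite wt_weight e1 e2. Qed.

Lemma M4_weight_ge0 j r : 0 <= M4_weight a alpha tau j r.
Proof. exact: bigmax_ge_id. Qed.

Lemma M4_sumE : M4_sum a alpha tau = limn (series (wt alpha site_weight tau)).
Proof.
have e : wt alpha site_weight tau = fun t => M4_weight a alpha tau (site_comp d0 t) (site_lag d t).
  by apply/funext => t; exact: wt_weight.
rewrite /M4_sum (esum_sites_fine (f := M4_weight a alpha tau) (d0 := d0)) ?e//.
  by move=> j r; exact: M4_weight_ge0.
by rewrite -e.
Qed.

Lemma M4_weight_le_sum j r : M4_weight a alpha tau j r <= M4_sum a alpha tau.
Proof.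
rewrite weight_wt M4_sumE.
set t := site_index j r.
have w0 u : 0 <= wt alpha site_weight tau u by rewrite wt_weight; exact: M4_weight_ge0.
have := cvg_sum_limn w0 cwt (leq0n t.+1).
rewrite (_ : series _ 0%N = 0) ?subr0; last by rewrite /series/= big_geq.
by apply: le_trans; rewrite big_nat_recr//= lerDr sumr_ge0.
Qed.

Let has_supw j : has_sup (range (M4_weight a alpha tau j)).
Proof.
split; first by exists (M4_weight a alpha tau j 0), 0.
by exists (M4_sum a alpha tau) => _ [r _ <-]; exact: M4_weight_le_sum.
Qed.

Lemma wmax_cvg j : wmax alpha (site_comp d0) site_weight tau T j @[T --> \oo]
  --> sup (range (M4_weight a alpha tau j)).
Proof.
set s := sup _.
have le_s T : wmax alpha (site_comp d0) site_weight tau T j <= s.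
  apply: bigmax_le => [|t /eqP tj].
    by apply: le_trans (M4_weight_ge0 j 0) _; apply: sup_upper_bound => //; exists 0.
  rewrite wt_weight tj; apply: sup_upper_bound => //; by exists (site_lag d t).
apply/cvgrPdist_le => e e0.
(* A lag nearly attaining the supremum has some index in the list of sites; once [T] passes it, the
   partial maximum is within [e] of the supremum. *)
have [_ [r _ <-] sr] := sup_adherent e0 (has_supw j).
exists (site_index j r).+1 => // T /= rT.
rewrite ger0_norm ?subr_ge0// lerBlDr -lerBlDl; apply: (le_trans (ltW sr)).
have [e1 _] := site_indexK d0 j r; rewrite weight_wt.
by apply: (le_bigmax_seq _ (site_index j r)); rewrite ?mem_index_iota ?e1.
Qed.

Lemma M4_sup_ge0 : 0 <= M4_sup a alpha tau.
Proof.
apply: sumr_ge0 => j _; apply: le_trans (M4_weight_ge0 j 0) _.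
by apply: sup_upper_bound => //; exists 0.
Qed.

Lemma M4_sum_gt0 : 0 < M4_sum a alpha tau.
Proof.
pose i := Ordinal d0; have [j [r ar]] := a_gt0 i.
apply: lt_le_trans (M4_weight_le_sum j r); apply: (@lt_le_trans _ _ (a i j r `^ alpha * tau i / M4_A a alpha i)).
  by rewrite /M4_A M4_AbarE; apply: divr_gt0; [rewrite mulr_gt0// powR_gt0|exact: A_gt0].
exact: le_bigmax_cond.
Qed.

Lemma M4_sup_le_sum : M4_sup a alpha tau <= M4_sum a alpha tau.
Proof.
have e0 j r : (0 <= (M4_weight a alpha tau j r)%:E)%E by rewrite lee_fin M4_weight_ge0.
have H : (\sum_(j < d) \esum_(r in [set: int]) (M4_weight a alpha tau j r)%:E)%E =
    (limn (series (fun t => M4_weight a alpha tau (site_comp d0 t) (site_lag d t))))%:E.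
  apply: (esum_sites_fin (d0 := d0)) => [j r|]; first exact: M4_weight_ge0.
  rewrite (_ : (fun t => _) = wt alpha site_weight tau)//.
  by apply/funext => t; rewrite wt_weight.
apply: ler_sum => j _; apply: sup_le_ub; first by case: (has_supw j).
move=> _ [r _ <-].
have fn : (\esum_(r in [set: int]) (M4_weight a alpha tau j r)%:E)%E \is a fin_num.
  rewrite ge0_fin_numE ?esum_ge0//; apply: (@le_lt_trans _ _
    (\sum_(j < d) \esum_(r in [set: int]) (M4_weight a alpha tau j r)%:E)%E).
    by rewrite (bigD1 j)//= leeDl// sume_ge0// => ? _; exact: esum_ge0.
  by rewrite H ltry.
rewrite -lee_fin fineK//; apply: esum_ge; exists [set r] => //.
by rewrite fsbig_set1.
Qed.

Lemma M4_H_theta : [/\ 0 < M4_H a alpha tau < 1, 0 <= M4_theta a alpha tau <= 1 &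
  M4_H a alpha tau `^ M4_theta a alpha tau = expR (- M4_sup a alpha tau)].
Proof.
have S0 := M4_sum_gt0; rewrite /M4_H /M4_theta; split.
- by rewrite expR_gt0 expR_lt1 oppr_lt0.
- by rewrite divr_ge0 ?M4_sup_ge0 ?(ltW S0)//= ler_pdivrMr// mul1r M4_sup_le_sum.
by rewrite /powR gt_eqF ?expR_gt0// expRK mulrN divfK// gt_eqF.
Qed.

End constants.

Lemma running_max_le {R : realType} {O : Type} (d : nat) (Z : nat -> O -> d.-tuple (\bar R)) n i w (x : \bar R) :
  (running_max Z n i w <= x)%E <-> forall k, (1 <= k <= n)%N -> (tnth (Z k w) i <= x)%E.
Proof.
rewrite /running_max; split=> [H k kn|H].
  by apply: le_trans H; apply: (le_bigmax_seq _ k); rewrite ?mem_index_iota.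
rewrite big_seq_cond; apply: bigmax_le => [|k]; first exact: leNye.
by rewrite andbT mem_index_iota => kn; exact: H.
Qed.

Lemma max_below_iid {R : realType} (d1 d2 : measure_display) (O1 : measurableType d1) (O2 : measurableType d2)
    (d : nat) (P1 : probability O1 R) (Y0 : O1 -> d.-tuple (\bar R)) (P2 : probability O2 R)
    (Yhat : nat -> O2 -> d.-tuple (\bar R)) (v : nat -> 'I_d -> R) n :
  iid_copies P1 Y0 P2 Yhat ->
  P2 (max_below Yhat v n) = (fine (P1 [set w | forall i, (tnth (Y0 w) i <= (v n i)%:E)%E]) ^+ n)%:E.
Proof.
move=> [[ind _] law].
pose Q := [set y : d.-tuple (\bar R) | forall i, (tnth y i <= (v n i)%:E)%E].
have mQ : measurable Q.
  rewrite (_ : Q = \big[setI/setT]_(i < d) ((fun y : d.-tuple (\bar R) => tnth y i) @^-1` `]-oo, (v n i)%:E])).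
    apply: bigsetI_measurable => i _.
    by have := @measurable_tnth _ _ d i measurableT _ (emeasurable_itv `]-oo, (v n i)%:E]); rewrite setTI.
  rewrite -bigcap_seq; apply/seteqP; split => y H.
    by move=> i _ /=; rewrite in_itv/=; exact: H.
  by move=> i; have := H i; rewrite /= mem_index_enum in_itv/=; apply.
have := ind [fset k in index_iota 1 n.+1]%fset (fun=> Q) (fun=> mQ).
have -> : \bigcap_(j in [set` [fset k in index_iota 1 n.+1]%fset]) (Yhat j @^-1` Q) = max_below Yhat v n.
  apply/seteqP; split => w H.
    by move=> i; apply/running_max_le => k kn; apply: H; rewrite /= !inE mem_index_iota.
  move=> k /=; rewrite !inE mem_index_iota => kn i; have /running_max_le := H i; exact.
move=> ->; congr (_%:E); under eq_bigr do rewrite law//.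
have pe : perm_eq [fset k in index_iota 1 n.+1]%fset (index_iota 1 n.+1).
  by apply: uniq_perm; rewrite ?fset_uniq ?iota_uniq// => k; rewrite !inE.
by rewrite (perm_big _ pe)/= prodr_const_nat subn1.
Qed.

(** * The moving maxima in terms of the Gaussian variables *)

Section model.
Context {R : realType} {dO : measure_display} {O : measurableType dO} {d : nat} (d0 : (0 < d)%N)
  (P : probability O R) (X : int -> O -> d.-tuple R) (h : R -> R) (W : int -> 'I_d -> O -> R)
  (a : 'I_d -> 'I_d -> int -> R).
Hypotheses (mX : forall k, measurable_fun setT (X k)) (mh : measurable_fun setT h)
  (W_def : forall k i w, W k i w = h (tnth (X k w) i)).

Local Notation jj := (site_comp d0).
Local Notation rr := (site_lag d).
Local Notation c := (site_weight d0 a).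

Lemma measurable_W k j : measurable_fun setT (W k j).
Proof.
have -> : W k j = h \o (fun w => tnth (X k w) j) by apply/funext => w; exact: W_def.
apply: (measurableT_comp mh).
exact: (measurableT_comp (measurable_tnth j) (mX k)).
Qed.

Lemma M4_gtP k i (v : R) w : (v%:E < tnth (M4 a W k w) i)%E <->
  exists t, v < c i t * W (k - rr t) (jj t) w.
Proof.
rewrite /M4 tnth_mktuple; split.
  move/ereal_sup_gt => [_ [r _ [j _ <-]]]; rewrite lte_fin => H.
  by have [e1 e2] := site_indexK d0 j r; exists (site_index j r); rewrite /site_weight e1 e2.
move=> [t H]; apply/ereal_sup_gtP; exists (c i t * W (k - rr t) (jj t) w)%:E; last by rewrite lte_fin.
by exists (rr t) => //; exists (jj t).
Qed.

Lemma M4_leP k i (v : R) w : (tnth (M4 a W k w) i <= v%:E)%E <->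
  forall t, ~ v < c i t * W (k - rr t) (jj t) w.
Proof.
rewrite leNgt; split; first by move=> /negP H t vt; apply: H; apply/M4_gtP; exists t.
by move=> H; apply/negP => /M4_gtP[t]; exact: H.
Qed.

Lemma measurable_M4_gt k i (v : R) : measurable [set w | (v%:E < tnth (M4 a W k w) i)%E].
Proof.
rewrite (_ : [set _ | _] = \bigcup_t (fun w => c i t * W (k - rr t) (jj t) w) @^-1` `]v, +oo[).
  apply: bigcup_measurable => t _.
  have m : measurable_fun setT (fun w => c i t * W (k - rr t) (jj t) w).
    by apply: measurable_funM => //; exact: measurable_W.
  by have := m measurableT _ (measurable_itv `]v, +oo[); rewrite setTI.
apply/seteqP; split => w; first by move=> /M4_gtP[t H]; exists t => //=; rewrite in_itv/= andbT.
by move=> [t _ /=]; rewrite in_itv/= andbT => H; apply/M4_gtP; exists t.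
Qed.

Lemma measurable_M4_le k (v : 'I_d -> R) :
  measurable [set w | forall i, (tnth (M4 a W k w) i <= (v i)%:E)%E].
Proof.
rewrite (_ : [set _ | _] = \big[setI/setT]_(i < d) ~` [set w | ((v i)%:E < tnth (M4 a W k w) i)%E]).
  by apply: bigsetI_measurable => i _; apply: measurableC; exact: measurable_M4_gt.
rewrite -bigcap_seq; apply/seteqP; split => w H.
  by move=> i _ /=; apply/negP; rewrite -leNgt; exact: H.
by move=> i; have := H i; rewrite /= mem_index_enum => /(_ isT)/negP; rewrite -leNgt.
Qed.

Lemma measurable_max_below (v : nat -> 'I_d -> R) n :
  measurable (max_below (fun k => M4 a W k%:Z) v n).
Proof.
rewrite (_ : max_below _ _ _ = ~` [set w | exists2 k, (1 <= k <= n)%N &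
    (~` [set w | forall i, (tnth (M4 a W k%:Z w) i <= (v n i)%:E)%E]) w]).
  apply: measurableC; apply: (@measurable_exists _ _ (fun k : nat =>
    ~` [set w | forall i, (tnth (M4 a W k%:Z w) i <= (v n i)%:E)%E]) (fun k => (1 <= k <= n)%N)) => k.
  by apply: measurableC; exact: measurable_M4_le.
apply/seteqP; split => w H.
  by move=> [k kn]; apply=> i; have /running_max_le := H i; exact.
move=> i; apply/running_max_le => k kn; apply: contrapT => nH; apply: H.
by exists k => // /(_ i).
Qed.

Variables (Y : 'I_d -> int -> O -> R) (s : 'I_d -> R).
Hypotheses (mY : forall i k, measurable_fun setT (Y i k))
  (XY : forall i k, {ae P, forall w, tnth (X k w) i = s i * Y i k w})
  (lY : forall i k B, measurable B -> P (Y i k @^-1` B) = normal_prob (0 : R) 1 B).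

Definition rescaled (j : 'I_d) (x : R) : R := h (s j * x).

Lemma measurable_rescaled j : measurable_fun setT (rescaled j).
Proof. by apply: (measurableT_comp mh); exact: measurable_funM. Qed.

(** Enumerating the integer times leaves countably many null sets, so the identity holds
    simultaneously at all times and for all components. *)
Lemma ae_W : {ae P, forall w, forall k j, W k j w = rescaled j (Y j k w)}.
Proof.
have H : {ae P, forall w, forall (q : nat) j, W (int_enum q) j w = rescaled j (Y j (int_enum q) w)}.
  apply: ae_foralln => q; apply: filter_forall => j.
  by apply: filterS (XY j (int_enum q)) => w e; rewrite W_def e.
by apply: filterS H => w H k j; rewrite -[k]int_indexK; exact: H.
Qed.

Lemma tail_rescaled (j : 'I_d) (u : R) :
  P [set w | u < W 0 j w] = normal_prob (0 : R) 1 [set x | u < rescaled j x].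
Proof.
have pre (f : R -> R) : [set x | u < f x] = f @^-1` `]u, +oo[.
  by apply/seteqP; split => x /=; rewrite in_itv/= andbT.
have mB : measurable [set x | u < rescaled j x].
  by rewrite pre; have := measurable_rescaled j measurableT (measurable_itv `]u, +oo[); rewrite setTI.
rewrite -(lY j 0 mB); apply: measure_ae_eq.
- rewrite (_ : [set _ | _] = W 0 j @^-1` `]u, +oo[); last first.
    by apply/seteqP; split => x /=; rewrite in_itv/= andbT.
  by have := measurable_W 0 j measurableT (measurable_itv `]u, +oo[); rewrite setTI.
- by have := mY j 0 measurableT mB; rewrite setTI.
by apply: filterS ae_W => w e; rewrite /= e.
Qed.

Lemma exceed_law i (v : R) : P [set w | (v%:E < tnth (M4 a W 0 w) i)%E] =
  P (\bigcup_t exceed Y rescaled jj rr c i v t).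
Proof.
apply: measure_ae_eq; first exact: measurable_M4_gt.
  by apply: bigcup_measurable => t _; apply: measurable_exceed => //; exact: measurable_rescaled.
apply: filterS ae_W => w e; rewrite /=; split.
  by move=> /M4_gtP[t]; rewrite e sub0r => H; exists t.
by move=> [t _]; rewrite /exceed /level/= => H; apply/M4_gtP; exists t; rewrite e sub0r.
Qed.

Lemma bad_memP (v : nat -> 'I_d -> R) n t x : bad rescaled jj c v n t x <->
  exists i, v n i < c i t * rescaled (jj t) x.
Proof.
rewrite /bad -bigcup_seq; split; first by move=> [i _ H]; exists i.
by move=> [i H]; exists i => //=; rewrite mem_index_enum.
Qed.

Lemma joint_law (v : nat -> 'I_d -> R) n :
  fine (P [set w | forall i, (tnth (M4 a W 0 w) i <= (v n i)%:E)%E]) =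
  1 - fine (P (\bigcup_t Y (jj t) (- rr t) @^-1` bad rescaled jj c v n t)).
Proof.
have mU : measurable (\bigcup_t Y (jj t) (- rr t) @^-1` bad rescaled jj c v n t).
  apply: bigcup_measurable => t _.
  have mb : measurable (bad rescaled jj c v n t) by apply: measurable_bad; exact: measurable_rescaled.
  by have := mY (jj t) (- rr t) measurableT mb; rewrite setTI.
rewrite -pr_setC//; congr fine; apply: measure_ae_eq.
- exact: measurable_M4_le.
- exact: measurableC.
apply: filterS ae_W => w e; split => /= H.
  by move=> [t _ /= /bad_memP[i Hi]]; have /M4_leP/(_ t) := H i; rewrite e sub0r; exact.
move=> i; apply/M4_leP => t; rewrite e sub0r => Hi; apply: H.
by exists t => //=; apply/bad_memP; exists i.
Qed.

Lemma max_law (v : nat -> 'I_d -> R) n :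
  P (max_below (fun k => M4 a W k%:Z) v n) = P (clear Y rescaled jj rr c v n).
Proof.
apply: measure_ae_eq.
- exact: measurable_max_below.
- by apply: measurable_clear => //; exact: measurable_rescaled.
apply: filterS ae_W => w e; split => H.
  move=> k t kn /bad_memP[i Hi]; have /running_max_le/(_ k kn)/M4_leP/(_ t) := H i.
  by rewrite e.
move=> i; apply/running_max_le => k kn; apply/M4_leP => t; rewrite e => Hi.
by apply: (H k t kn); apply/bad_memP; exists i.
Qed.

End model.

Theorem theorem2p4 (R : realType) (d : nat) (d_gt0 : (0 < d)%N)
  (dO : measure_display) (O : measurableType dO) (P : probability O R)
  (eps : int -> {RV P >-> d.-tuple R})
  (eps_iid : iid P (fun k : int => (eps k : O -> d.-tuple R)))
  (eps_gaussian : forall k, gaussian_vector P (eps k))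
  (eps_centered : forall k, centered_vector P (eps k))
  (eps_cov : forall k, identity_covariance P (eps k))
  (Psi : nat -> 'M[R]_d)
  (Psi0_nonsingular : Psi 0%N \in unitmx)
  (Psi_decay : forall i j : 'I_d,
     (fun l : nat => Psi l i j : R^o) =o_\oo
     (fun l : nat => (l%:R `^ (- 2^-1)) * (ln (l%:R : R))^-1 : R^o))
  (X : int -> {RV P >-> d.-tuple R})
  (X_linear : linear_process P Psi (fun k => (eps k : O -> d.-tuple R))
                (fun k => (X k : O -> d.-tuple R)))
  (h : R -> R) (h_measurable : measurable_fun [set: R] h)
  (W : int -> 'I_d -> O -> R)
  (W_def : forall k i w, W k i w = h (tnth (X k w) i))
  (W_ge0 : forall k i, {ae P, forall w, 0 <= W k i w})
  (alpha : R) (alpha_gt0 : 0 < alpha)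
  (L : R -> R) (L_slow : slowly_varying L)
  (W_tail : forall (k : int) (i : 'I_d) (u : R), 0 < u ->
     P [set w | u < W k i w] = (u `^ (- alpha) * L u)%:E)
  (a : 'I_d -> 'I_d -> int -> R)
  (a_ge0 : forall i j r, 0 <= a i j r)
  (a_gt0 : forall i, exists j r, 0 < a i j r)
  (a_summable : exists e : R, 0 < e < alpha /\
     forall i j,
       (\esum_(r in [set: int]) (a i j r `^ (alpha - e))%:E < +oo)%E)
  (dO' : measure_display) (O' : measurableType dO') (P' : probability O' R)
  (Yhat : nat -> {RV P' >-> d.-tuple (\bar R)})
  (Yhat_copies : iid_copies P (M4 a W 0) P'
                   (fun k => (Yhat k : O' -> d.-tuple (\bar R))))
  (tau : 'I_d -> R) (tau_gt0 : forall i, 0 < tau i)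
  (u : nat -> 'I_d -> R -> R)
  (u_threshold : forall i : 'I_d,
     (n%:R%:E * P [set w | (u n i (tau i))%:E < tnth (M4 a W 0 w) i])%E
       @[n --> \oo] --> (tau i)%:E) :
  [/\ forall i, (0 < M4_Abar a alpha i < +oo)%E,
      multivariate_extremal_index P (M4 a W)
        P' (fun k => (Yhat k : O' -> d.-tuple (\bar R)))
        (fun n i => u n i (tau i)) (M4_H a alpha tau) (M4_theta a alpha tau),
      P (max_below (fun k => M4 a W k%:Z) (fun n i => u n i (tau i)) n)
        @[n --> \oo] --> (M4_H a alpha tau `^ M4_theta a alpha tau)%:E
    & M4_H a alpha tau `^ M4_theta a alpha tau = expR (- M4_sup a alpha tau)].
Proof.
have mE k : measurable_fun setT (eps k : O -> d.-tuple R) by exact: measurable_funPT.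
have mX k : measurable_fun setT (X k : O -> d.-tuple R) by exact: measurable_funPT.
have [indE _] := eps_iid.
have [Y [s [C [h' [[s0 mY XY lY] C0 h01 HP KEY]]]]] := linear_gaussian_array mE indE
  eps_gaussian eps_centered eps_cov d_gt0 Psi0_nonsingular Psi_decay X_linear.
have [e [/andP[e0 ea] sumE]] := a_summable.
(* [alpha - e] is the exponent for Potter's bound: it lies below [alpha], and the corresponding
   powers of the weights are summable. *)
have beta_al : 0 < alpha - e < alpha by apply/andP; split; lra.
pose c := site_weight d_gt0 a.
have c_ge0 i t : 0 <= c i t by exact: a_ge0.
have c_gt0 i : exists t, 0 < c i t.
  have [j [r ar]] := a_gt0 i; exists (site_index j r).
  by have [e1 e2] := site_indexK d_gt0 j r; rewrite /c /site_weight e1 e2.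
have csum i : cvgn (series (fun t => c i t `^ (alpha - e))).
  apply: nnseries_is_cvg => [t|]; first exact: powR_ge0.
  rewrite -(esum_sites d_gt0 (g := fun j r => (a i j r `^ (alpha - e))%:E)).
    by apply: lte_sum_pinfty => j _; exact: sumE.
  by move=> j r; rewrite lee_fin powR_ge0.
pose hh := rescaled h s.
have mhh j : measurable_fun setT (hh j) by exact: measurable_rescaled.
pose F (x : R) := x `^ (- alpha) * L x.
have HF (j : 'I_d) (x : R) : 0 < x -> fine (normal_prob (0 : R) 1 [set y | x < hh j y]) = F x.
  by move=> x0; rewrite -(tail_rescaled mX h_measurable W_def mY XY lY) W_tail.
pose v n i := u n i (tau i).
have thr i : n%:R * fine (P (\bigcup_t exceed Y hh (site_comp d_gt0) (site_lag d) c i (v n i) t))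
    @[n --> \oo] --> tau i.
  have E n : fine (n%:R%:E * P [set w | ((u n i (tau i))%:E < tnth (M4 a W 0 w) i)%E]) =
      n%:R * fine (P (\bigcup_t exceed Y hh (site_comp d_gt0) (site_lag d) c i (v n i) t)).
    rewrite fineM//; last first.
      by apply: fin_num_measure; exact: (measurable_M4_gt d_gt0 a mX h_measurable W_def).
    by rewrite (exceed_law d_gt0 a mX h_measurable W_def mY XY).
  have := @u_threshold i; move/fine_cvg; apply: cvg_trans; apply: near_eq_cvg; apply: nearW => n.
  by rewrite -E.
have FE (x : R) : 0 < x -> F x = x `^ (- alpha) * L x by [].
have injS := @site_inj d d_gt0.
have [cw cJ] := joint_cvg mY lY C0 h01 HP mhh d_gt0 HF alpha_gt0 L_slow FE injS c_ge0 c_gt0 beta_al csum tau_gt0 thr.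
have A0 := weight_sum_gt0 mY lY C0 h01 HP mhh d_gt0 HF alpha_gt0 L_slow FE injS c_ge0 c_gt0 beta_al csum thr.
have cA i : cvgn (series (fun t => c i t `^ alpha)).
  have [] := exceed_cvg mY lY C0 h01 HP mhh d_gt0 HF alpha_gt0 L_slow FE injS c_ge0 beta_al csum i
    (threshold_pinfty mY lY mhh d_gt0 HF L_slow FE c_ge0 c_gt0 thr i).
  by [].
have cS := clear_cvg mY lY C0 h01 HP mhh d_gt0 HF alpha_gt0 L_slow FE injS c_ge0 c_gt0 beta_al csum tau_gt0 thr
  (@site_lag_le d) KEY (fun j => @wmax_cvg R d d_gt0 a alpha tau cA cw j).
have [H01 T01 HT] := M4_H_theta a_gt0 tau_gt0 cA A0 cw.
have cM : P (max_below (fun k => M4 a W k%:Z) v n) @[n --> \oo] --> (expR (- M4_sup a alpha tau))%:E.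
  apply: cvg_EFin.
    by apply: nearW => n; apply: fin_num_measure; exact: (measurable_max_below d_gt0 a mX h_measurable W_def).
  apply: cvg_trans cS; apply: near_eq_cvg; apply: nearW => n /=.
  by rewrite (max_law d_gt0 a mX h_measurable W_def mY XY).
have AE i : (0 < M4_Abar a alpha i < +oo)%E.
  by rewrite (M4_AbarE cA) lte_fin A0 ltry.
split=> //; last by rewrite HT.
split => //; last by rewrite HT.
(* For the i.i.d. copies the probability is the [n]-th power of [1 - q_n], where [q_n] is the
   probability that some component exceeds its threshold at time 0 and [n * q_n] tends to
   [M4_sum]. *)
have q0 n : 0 <= fine (P (\bigcup_t Y (site_comp d_gt0 t) (- site_lag d t) @^-1`
    bad hh (site_comp d_gt0) c v n t)) by exact: fine_ge0.
have cI := expR_onem_cvg q0 cJ.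
rewrite /M4_H (M4_sumE cA cw).
have E n : P' (max_below (fun k => (Yhat k : O' -> d.-tuple (\bar R))) v n) =
    ((1 - fine (P (\bigcup_t Y (site_comp d_gt0 t) (- site_lag d t) @^-1`
    bad hh (site_comp d_gt0) c v n t))) ^+ n)%:E.
  by rewrite (max_below_iid v n Yhat_copies) (joint_law d_gt0 a mX h_measurable W_def mY XY).
apply: cvg_EFin; first by apply: nearW => n; rewrite E.
by apply: cvg_trans cI; apply: near_eq_cvg; apply: nearW => n; rewrite /= E.
Qed.
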